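(* Let $d\in\{2,3\}$ and let $\varepsilon>0$ (arbitrarily small). Let $u$ be the solution of $i\partial_tu=-\Delta u+\mu|u|^2u$ on $\mathbb{T}^d$, $u(0)=u_0$, let $T>0$ be smaller than its maximal existence time, and suppose $M_{2+d/2+\varepsilon}<\infty$. Let $u^n$ be computed by the scheme sLRI2: $u^0=u_0$, $$u^1=e^{i\tau\Delta}u_0-i\mu\tau e^{i\tau\Delta}\bigl(u_0^2[\varphi_1(-2i\tau\Delta)-\varphi_2(-2i\tau\Delta)]\overline{u_0}\bigr)-i\mu\tau(e^{i\tau\Delta}u_0)^2\bigl[e^{i\tau\Delta}\varphi_2(-2i\tau\Delta)\overline{u_0}\bigr]-\mu^2\tfrac{\tau^2}{2}e^{i\tau\Delta}\bigl[|u_0|^4u_0\bigr],$$ and for $n\ge1$ $$\begin{aligned}u^{n+1}={}&e^{2i\tau\Delta}u^{n-1}-2i\mu\tau e^{i\tau\Delta}\bigl((u^n)^2[\mathrm{Re}\,\varphi_1(-2i\tau\Delta)-\mathrm{Re}\,\varphi_2(-2i\tau\Delta)]\overline{u^n}\bigr)\\&-i\mu\tau(e^{i\tau\Delta}u^n)^2\bigl[e^{i\tau\Delta}\varphi_2(-2i\tau\Delta)\overline{u^n}\bigr]\\&-i\mu\tau e^{2i\tau\Delta}\bigl((e^{-i\tau\Delta}u^n)^2\bigl[e^{-i\tau\Delta}\varphi_2(2i\tau\Delta)\overline{u^n}\bigr]\bigr).\end{aligned}$$ Then for all $0<\tau\le\tau_0$ with $\tau_0>0$ depending on $M_{2+d/2+\varepsilon}$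 and $T$, $$\|u(t_n)-u^n\|_{H^1}\le C(M_{2+d/2+\varepsilon})\,\tau^2,\qquad0\le n\le T/\tau,\quad t_n=n\tau.$$
   Context: $\mathbb{T}^d$ is the $2\pi$-periodic torus, $\mu$ a nonzero real constant; $H^\delta=H^\delta(\mathbb{T}^d)$ is the periodic Sobolev space with norm $\|u\|_{H^\delta}^2=\sum_{\mathbf{k}\in\mathbb{Z}^d}(1+|\mathbf{k}|^2)^\delta|\hat u_{\mathbf{k}}|^2$. $M_\delta:=\sup_{0\le t\le T}\|u(t)\|_{H^\delta}$. $\varphi_1(z)=(e^z-1)/z$ and $\varphi_2(z)=(e^z-\varphi_1(z))/z$, extended continuously by $\varphi_1(0)=1$, $\varphi_2(0)=1/2$. Functions of $\Delta$ are Fourier multipliers: $f(\Delta)$ has symbol $f(-|\mathbf{k}|^2)$; $\mathrm{Re}\,\varphi_j(-2i\tau\Delta)$ has symbol $\mathrm{Re}\,\varphi_j(2i\tau|\mathbf{k}|^2)$. $C(M_\delta)$ denotes a positive constant depending on $M_\delta$ and on the fixed data ($T$, $\mu$, $d$, $\varepsilon$), but independent of $\tau$ and $n$; likewise $\tau_0$ may depend on the fixed data. *)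

(* Defs.v *)
From HB Require Import structures.
From mathcomp Require Import all_boot all_order all_algebra.
From mathcomp Require Import all_classical all_reals all_analysis.
From mathcomp Require Import complex.

Set Implicit Arguments.
Unset Strict Implicit.
Unset Printing Implicit Defensive.

Import Order.TTheory GRing.Theory Num.Theory.
Import numFieldNormedType.Exports.

Local Open Scope classical_set_scope.
Local Open Scope complex_scope.
Local Open Scope ring_scope.

Local Notation Re := complex.Re.
Local Notation Im := complex.Im.

(* R[i] carries no topology in the libraries, so limits, integrals, derivatives
   and continuity of complex-valued functions are taken on real and imaginary
   parts. *)

Section ComplexFunctions.
Context {R : realType}.
Local Notation C := R[i].

Definition expC (z : C) : C :=
  (expR (Re z))%:C * (cos (Im z) +i* sin (Im z)).

Definition phi1 (z : C) : C := if z == 0 then 1 else (expC z - 1) / z.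

Definition phi2 (z : C) : C := if z == 0 then 1 / 2 else (expC z - phi1 z) / z.

Definition cderivable {V : normedModType R} (f : V -> C) (x v : V) : Prop :=
  derivable (fun y => Re (f y)) x v /\ derivable (fun y => Im (f y)) x v.

Definition cderive {V : normedModType R} (v : V) (f : V -> C) (x : V) : C :=
  'D_v (fun y => Re (f y)) x +i* 'D_v (fun y => Im (f y)) x.

Definition ccontinuous_on {X : topologicalType} (A : set X) (f : X -> C) : Prop :=
  {within A, continuous (fun y => Re (f y))} /\
  {within A, continuous (fun y => Im (f y))}.

End ComplexFunctions.

(* A function on the torus is a function on R^d that is 2 pi-periodic in each
   coordinate. *)
Section Torus.
Context {R : realType} {d : nat}.
Local Notation C := R[i].

Definition periodic (f : 'rV[R]_d -> C) : Prop :=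
  forall (x : 'rV[R]_d) (j : 'I_d), f (x + (2 * pi) *: delta_mx 0 j) = f x.

Definition partial (j : 'I_d) (f : 'rV[R]_d -> C) : 'rV[R]_d -> C :=
  cderive (delta_mx 0 j) f.

Definition laplacian (f : 'rV[R]_d -> C) (x : 'rV[R]_d) : C :=
  \sum_(j < d) partial j (partial j f) x.

End Torus.

(* Integral over [0, 2 pi]^d, iterated one coordinate at a time. *)
Fixpoint cube_integral {R : realType} (d : nat) : ('rV[R]_d -> R) -> R :=
  match d with
  | 0 => fun f => f 0
  | d'.+1 => fun f =>
      \int[lebesgue_measure]_(s in `[0, 2 * pi])
        cube_integral (fun y : 'rV[R]_d' => f (row_mx (s%:M : 'rV[R]_1) y))
  end.

Section Fourier.
Context {R : realType} {d : nat}.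
Local Notation C := R[i].

Definition freq_sq (k : 'rV[int]_d) : R := \sum_(j < d) (k 0 j)%:~R ^+ 2.

Definition freq_dot (k : 'rV[int]_d) (x : 'rV[R]_d) : R :=
  \sum_(j < d) (k 0 j)%:~R * x 0 j.

Definition wave (k : 'rV[int]_d) (x : 'rV[R]_d) : C := expC ('i%C * (freq_dot k x)%:C).

Definition fourier_coef (f : 'rV[R]_d -> C) (k : 'rV[int]_d) : C :=
  let g x := f x * wave (- k) x in
  ((2 * pi) ^- d)%:C *
    (cube_integral (fun x => Re (g x)) +i* cube_integral (fun x => Im (g x))).

Definition freq_box (N : nat) : set 'rV[int]_d :=
  [set k | forall j, `|k 0 j| <= N%:Z].

Definition freq_sum (c : 'rV[int]_d -> C) : C :=
  let S (N : nat) := \sum_(k \in freq_box N) c k in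
  lim (Re (S N) @[N --> \oo]) +i* lim (Im (S N) @[N --> \oo]).

(* The Fourier multiplier m(Delta): Delta has symbol - |k|^2. *)
Definition fmult (m : R -> C) (f : 'rV[R]_d -> C) (x : 'rV[R]_d) : C :=
  freq_sum (fun k => m (- freq_sq k) * fourier_coef f k * wave k x).

Definition sobolev_norm (delta : R) (f : 'rV[R]_d -> C) : \bar R :=
  ((\esum_(k in [set: 'rV[int]_d])
      ((1 + freq_sq k) `^ delta * Re (`|fourier_coef f k| ^+ 2))%:E) `^ 2^-1)%E.

End Fourier.

Section NLS.
Context {R : realType} {d : nat}.
Local Notation C := R[i].

(* Classical solutions on [0, Tend) of
   i d_t u = - Delta u + mu |u|^2 u,  u(0) = u0. *)
Definition nls_solution (mu : R) (u0 : 'rV[R]_d -> C) (Tend : \bar R)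
    (u : R -> 'rV[R]_d -> C) : Prop :=
  let closed_dom := [set p : R * 'rV[R]_d | 0 <= p.1 /\ (p.1%:E < Tend)%E] in
  let open_dom := [set p : R * 'rV[R]_d | 0 < p.1 /\ (p.1%:E < Tend)%E] in
  [/\ forall x, u 0 x = u0 x,
      forall t, 0 <= t -> (t%:E < Tend)%E -> periodic (u t),
      ccontinuous_on closed_dom (fun p => u p.1 p.2),
      forall j, ccontinuous_on open_dom (fun p => partial j (u p.1) p.2) /\
        forall l, ccontinuous_on open_dom
          (fun p => partial l (partial j (u p.1)) p.2) &
      forall t x, 0 < t -> (t%:E < Tend)%E ->
        [/\ forall j, cderivable (u t) x (delta_mx 0 j),
            forall j l, cderivable (partial j (u t)) x (delta_mx 0 l),
            cderivable (fun s : R^o => u s x) t 1 &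
            'i%C * cderive (1 : R^o) (fun s => u s x) t
            = - laplacian (u t) x + mu%:C * `|u t x| ^+ 2 * u t x]].

Definition nls_maximal_solution (mu : R) (u0 : 'rV[R]_d -> C) (Tmax : \bar R)
    (u : R -> 'rV[R]_d -> C) : Prop :=
  [/\ (0 < Tmax)%E, nls_solution mu u0 Tmax u &
      forall (T' : \bar R) (v : R -> 'rV[R]_d -> C),
        nls_solution mu u0 T' v -> (T' <= Tmax)%E].

Definition sup_norm (delta T : R) (u : R -> 'rV[R]_d -> C) : \bar R :=
  ereal_sup [set sobolev_norm delta (u t) | t in `[0, T]].

(* The operator e^{i s Delta}. *)
Definition schrod (s : R) : ('rV[R]_d -> C) -> 'rV[R]_d -> C :=
  fmult (fun lam => expC ('i%C * (s * lam)%:C)).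

Definition slri2_start (mu tau : R) (u0 : 'rV[R]_d -> C) : 'rV[R]_d -> C :=
  let u0b x := (u0 x)^*%C in
  let z lam : C := - 2 * 'i%C * (tau * lam)%:C in
  let A := schrod tau (fun x => u0 x ^+ 2 *
             fmult (fun lam => phi1 (z lam) - phi2 (z lam)) u0b x) in
  let B x := schrod tau u0 x ^+ 2 *
             schrod tau (fmult (fun lam => phi2 (z lam)) u0b) x in
  let D := schrod tau (fun x => `|u0 x| ^+ 4 * u0 x) in
  fun x => schrod tau u0 x
    - 'i%C * (mu * tau)%:C * A x
    - 'i%C * (mu * tau)%:C * B x
    - (mu ^+ 2 * (tau ^+ 2 / 2))%:C * D x.

Definition slri2_step (mu tau : R) (uprev un : 'rV[R]_d -> C) : 'rV[R]_d -> C :=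
  let unb x := (un x)^*%C in
  let z lam : C := - 2 * 'i%C * (tau * lam)%:C in
  let A := schrod tau (fun x => un x ^+ 2 *
             fmult (fun lam => (Re (phi1 (z lam)) - Re (phi2 (z lam)))%:C) unb x) in
  let B x := schrod tau un x ^+ 2 *
             schrod tau (fmult (fun lam => phi2 (z lam)) unb) x in
  let D := schrod (2 * tau) (fun x => schrod (- tau) un x ^+ 2 *
             schrod (- tau) (fmult (fun lam => phi2 (- z lam)) unb) x) in
  fun x => schrod (2 * tau) uprev x
    - 2 * 'i%C * (mu * tau)%:C * A x
    - 'i%C * (mu * tau)%:C * B x
    - 'i%C * (mu * tau)%:C * D x.

Fixpoint slri2 (mu tau : R) (u0 : 'rV[R]_d -> C) (n : nat) : 'rV[R]_d -> C :=
  match n with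
  | 0 => u0
  | p.+1 => match p with
            | 0 => slri2_start mu tau u0
            | m.+1 => slri2_step mu tau (slri2 mu tau u0 m) (slri2 mu tau u0 p)
            end
  end.

End NLS.

(* Main.v *)
(** All estimates are made on Fourier coefficients, in the norm of l^1 /\ H^1, an
algebra norm in every dimension.  A solution bounded in H^(2 + d/2 + eps) has
coefficients a with |k|^2 a in l^1 /\ H^1, hence equals its Fourier series, and
its coefficients solve an infinite system of ODEs.  In the interaction picture
W, the two-step method compares W(tau) - W(- tau) with a symmetric integral:
the first order Taylor terms of W cancel, while the phase
e^(i s (psi + 2 |k3|^2)) is integrated with e^(2 i s |k3|^2) exact and
e^(i s psi) interpolated linearly, which costs tau^3 psi^2.  As
psi = 2 (k1.k2 + k1.k3 + k2.k3), psi^2 takes at most two derivatives from each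
factor.  The local error is thus O(tau^3), and O(tau^2) is enough for the single
starting step.  Since the free flow is an isometry, the larger of two
consecutive errors grows by a factor 1 + O(tau) per step, as long as the
numerical solution stays bounded, which the error bound itself guarantees. *)

From HB Require Import structures.
From mathcomp Require Import all_boot all_order all_algebra.
From mathcomp Require Import all_classical all_reals all_analysis.
From mathcomp Require Import complex ring lra.
Require Import Defs.

Set Implicit Arguments.
Unset Strict Implicit.
Unset Printing Implicit Defensive.

Import Order.TTheory GRing.Theory Num.Theory.
Import numFieldNormedType.Exports.
Import Normc.

Local Open Scope classical_set_scope.
Local Open Scope complex_scope.
Local Open Scope ring_scope.

Local Notation Re := complex.Re.
Local Notation Im := complex.Im.

(** * Complex numbers and absolutely convergent sums *)

(** In dimensions 2 and 3 the space H^1 is not an algebra, so an error recursion in H^1 alone does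
    not close; adding the l^1 norm repairs this at no cost in regularity. Weighted by |k|^2, the l^1
    half asks for 2 + d/2 + eps derivatives by Cauchy-Schwarz and the H^1 half for 3, which is no
    more since d >= 2: hence the regularity assumed. The obstacle in the phase is the term 2 |k3|^2.
    Interpolating the whole phase linearly would put four derivatives on one factor, whereas psi
    consists of products of distinct frequencies. No bound on the numerical solution is known
    beforehand. The growth constant is therefore computed on a ball of radius B + 1, where B bounds
    the exact solution, and tau0 is chosen so that the resulting error is at most 1. The solution is
    classical and its equation holds at interior times only; continuity carries the estimates to the
    end points 0 and T. *)

Lemma le_of_eq (disp : Order.disp_t) (T : porderType disp) (x y : T) : x = y -> (x <= y)%O.
Proof. by move=> ->. Qed.

Section ComplexNumbers.
Context {R : realType}.
Local Notation C := R[i].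
Implicit Types (x y z : C) (r s : R).

Lemma normc_ge0 z : 0 <= normc z.
Proof. by case: z => a b /=; exact: sqrtr_ge0. Qed.

Lemma normc_sqr z : normc z ^+ 2 = Re z ^+ 2 + Im z ^+ 2.
Proof. by case: z => a b /=; rewrite sqr_sqrtr// addr_ge0// sqr_ge0. Qed.

Lemma normcD x y : normc (x + y) <= normc x + normc y.
Proof. exact: le_normcD. Qed.

Lemma normcB x y : normc (x - y) <= normc x + normc y.
Proof. by rewrite -(normcN y) normcD. Qed.

Lemma normc_real r : normc r%:C = `|r|.
Proof. by rewrite /= expr0n /= addr0 sqrtr_sqr. Qed.

Lemma normc_conj z : normc z^*%C = normc z.
Proof. by case: z => a b /=; rewrite sqrrN. Qed.

Lemma normRe_le z : `|Re z| <= normc z.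
Proof.
rewrite -(ler_pXn2r (_ : 0 < 2)%N) ?nnegrE ?normc_ge0//.
by rewrite normc_sqr real_normK ?num_real// lerDl sqr_ge0.
Qed.

Lemma normIm_le z : `|Im z| <= normc z.
Proof.
rewrite -(ler_pXn2r (_ : 0 < 2)%N) ?nnegrE ?normc_ge0//.
by rewrite normc_sqr real_normK ?num_real// lerDr sqr_ge0.
Qed.

Lemma normc_le_add z : normc z <= `|Re z| + `|Im z|.
Proof.
rewrite -(ler_pXn2r (_ : 0 < 2)%N) ?nnegrE ?normc_ge0 ?addr_ge0//.
rewrite normc_sqr sqrrD !real_normK ?num_real//.
by rewrite lerD2r lerDl mulrn_wge0// mulr_ge0.
Qed.

Lemma normc_i : normc ('i%C : C) = 1.
Proof. by rewrite /= expr0n expr1n add0r sqrtr1. Qed.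

Lemma normc_eq0 z : (normc z == 0) = (z == 0).
Proof. by apply/eqP/eqP => [/eq0_normc//|->]; rewrite normc0. Qed.

(** A rotation by a unit number turns a modulus into a real part. Real tools, such as signed sums
    and the mean value theorem, then bound complex quantities with constant 1 instead of losing a
    factor on real and imaginary parts. *)
Lemma normc_polar z : exists e : C, normc e = 1 /\ Re (e * z) = normc z.
Proof.
have [->|z0] := eqVneq z 0.
  by exists 1; rewrite normc1 mulr0 normc0.
have nz : normc z != 0 by rewrite normc_eq0.
exists (z^*%C / (normc z)%:C); split.
  by rewrite normcM normcV normc_conj normc_real ger0_norm ?normc_ge0// divff.
rewrite mulrAC mulrC -fmorphV /=.
have -> : z^*%C * z = (normc z ^+ 2)%:C.
  by rewrite normc_sqr; case: z {z0 nz} => a b; apply/eqP; rewrite eq_complex /=;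
    apply/andP; split; apply/eqP; ring.
by rewrite -rmorphM /= expr2 mulKf.
Qed.

Lemma complex_eqP x y : Re x = Re y -> Im x = Im y -> x = y.
Proof. by case: x y => ? ? [? ?] /= -> ->. Qed.

Lemma cReM x y : Re (x * y) = Re x * Re y - Im x * Im y.
Proof. by case: x y => ? ? []. Qed.

Lemma cImM x y : Im (x * y) = Re x * Im y + Im x * Re y.
Proof. by case: x y => ? ? []. Qed.

Lemma cReD x y : Re (x + y) = Re x + Re y.
Proof. by case: x y => ? ? []. Qed.

Lemma cImD x y : Im (x + y) = Im x + Im y.
Proof. by case: x y => ? ? []. Qed.

Lemma cReN x : Re (- x) = - Re x.
Proof. by case: x. Qed.

Lemma cImN x : Im (- x) = - Im x.
Proof. by case: x. Qed.

Lemma cRe_sum (I : Type) (r : seq I) (P : pred I) (F : I -> C) :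
  Re (\sum_(i <- r | P i) F i) = \sum_(i <- r | P i) Re (F i).
Proof. by elim/big_rec2: _ => // i x y _ <-; rewrite cReD. Qed.

Lemma cIm_sum (I : Type) (r : seq I) (P : pred I) (F : I -> C) :
  Im (\sum_(i <- r | P i) F i) = \sum_(i <- r | P i) Im (F i).
Proof. by elim/big_rec2: _ => // i x y _ <-; rewrite cImD. Qed.

Definition expi (t : R) : C := cos t +i* sin t.

Lemma expC_i t : expC ('i%C * t%:C) = expi t.
Proof.
rewrite /expC /expi; have -> : 'i%C * t%:C = 0 +i* t.
  by apply: complex_eqP; rewrite ?cReM ?cImM /=; ring.
by rewrite /= expR0; apply: complex_eqP; rewrite ?cReM ?cImM /=; ring.
Qed.

Lemma expi0 : expi 0 = 1.
Proof. by rewrite /expi cos0 sin0. Qed.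

Lemma expiD r s : expi (r + s) = expi r * expi s.
Proof. by apply: complex_eqP; rewrite ?cReM ?cImM /= ?cosD ?sinD; ring. Qed.

Lemma expiN r : expi (- r) = (expi r)^*%C.
Proof. by rewrite /expi cosN sinN. Qed.

Lemma normc_expi r : normc (expi r) = 1.
Proof. by rewrite /= cos2Dsin2 sqrtr1. Qed.

End ComplexNumbers.

(** * Unordered signed and complex sums: linearity, exchange, reindexing *)

Section Sums.
Context {R : realType}.
Local Notation C := R[i].

Lemma esum_swap (T1 T2 : choiceType) (a : T1 -> T2 -> \bar R) :
  (forall i j, 0 <= a i j)%E ->
  (\esum_(i in [set: T1]) \esum_(j in [set: T2]) a i j =
   \esum_(j in [set: T2]) \esum_(i in [set: T1]) a i j)%E.
Proof.
move=> a0; rewrite !esum_esum//.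
rewrite (@reindex_esum R (T2 * T1)%type (T1 * T2)%type ([set: T2] `*`` fun=> [set: T1])
  _ (fun p => (p.2, p.1)) (fun p => a p.1 p.2))//.
split => //.
- by move=> [x y] [x' y'] _ _ /= [-> ->].
- by move=> [x y] _; exists (y, x).
Qed.

Lemma esum_pair (T1 T2 : choiceType) (a : T1 -> T2 -> \bar R) :
  (forall i j, 0 <= a i j)%E ->
  (\esum_(p in [set: T1 * T2]) a p.1 p.2 =
   \esum_(i in [set: T1]) \esum_(j in [set: T2]) a i j)%E.
Proof.
move=> a0; rewrite esum_esum//; congr (esum _ _).
by apply/seteqP; split => [[x y]|[x y]].
Qed.

Lemma esumZl (T : choiceType) (r : R) (a : T -> \bar R) : 0 <= r ->
  (forall i, 0 <= a i)%E ->
  (\esum_(i in [set: T]) (r%:E * a i) = r%:E * \esum_(i in [set: T]) a i)%E.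
Proof.
move=> r0 a0; apply/eqP; rewrite eq_le; apply/andP; split.
  apply: ge_ereal_sup => _ [X [finX XI]] <-.
  rewrite -ge0_mule_fsumr// lee_wpmul2l// ?lee_fin//.
  by apply: esum_ge; exists X => //; split.
have [->|r1] := eqVneq r 0; first by rewrite mul0e; apply: esum_ge0 => i _; rewrite mule_ge0.
have rp : 0 < r by rewrite lt_neqAle eq_sym r1.
rewrite -lee_pdivlMl//; apply: ge_ereal_sup => _ [X [finX XI]] <-.
rewrite lee_pdivlMl// ge0_mule_fsumr//.
by apply: esum_ge; exists X => //; split.
Qed.

Lemma esum_reindex_bij (T T' : choiceType) (e : T -> T') (f : T' -> T)
    (a : T' -> \bar R) : cancel e f -> cancel f e ->
  (\esum_(i in [set: T]) a (e i) = \esum_(j in [set: T']) a j)%E.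
Proof.
move=> ef fe; rewrite (@reindex_esum R T T' setT setT e)//; split => //.
- by move=> x y _ _ /(can_inj ef).
- by move=> y _; exists (f y).
Qed.

Lemma esum_ub (T : choiceType) (a : T -> \bar R) i : (forall i, 0 <= a i)%E ->
  (a i <= \esum_(i in [set: T]) a i)%E.
Proof.
move=> a0; apply: esum_ge; exists [set i]; last by rewrite fsbig_set1.
by split.
Qed.

(** Unordered sum, with no enumeration of the lattice. It has its usual meaning only under absolute
    summability, since [fine] sends an infinite part to 0; this is why finiteness of [asum] is
    carried along everywhere. *)
Definition rsum (T : choiceType) (f : T -> R) : R :=
  fine (esum [set: T] (EFin \o f)^\+%E) - fine (esum [set: T] (EFin \o f)^\-%E).

Definition csum (T : choiceType) (c : T -> C) : C :=
  rsum (fun i => Re (c i)) +i* rsum (fun i => Im (c i)).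

Definition asum (T : choiceType) (c : T -> C) : \bar R :=
  (\esum_(i in [set: T]) (normc (c i))%:E)%E.

Lemma asum_ge0 (T : choiceType) (c : T -> C) : (0 <= asum c)%E.
Proof. by apply: esum_ge0 => i _; rewrite lee_fin normc_ge0. Qed.

Section RealSums.
Context {T : choiceType}.
Implicit Types f g p q : T -> R.

Local Notation es f := (\esum_(i in [set: T]) (f i)%:E)%E.

Lemma es_ge0 p : (forall i, 0 <= p i) -> (0 <= es p)%E.
Proof. by move=> p0; apply: esum_ge0 => i _; rewrite lee_fin. Qed.

Lemma fineK_es p : (forall i, 0 <= p i) -> (es p < +oo)%E -> ((fine (es p))%:E = es p)%E.
Proof. by move=> p0 pf; rewrite fineK// ge0_fin_numE// es_ge0. Qed.

(** Any splitting into summable nonnegative families gives the same value as the splitting into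
    positive and negative parts. Additivity rests on this freedom, because the positive part of a
    sum is not the sum of the positive parts. *)
Lemma rsumBE p q : (forall i, 0 <= p i) -> (forall i, 0 <= q i) ->
  (es p < +oo)%E -> (es q < +oo)%E ->
  rsum (fun i => p i - q i) = fine (es p) - fine (es q).
Proof.
move=> p0 q0 sp sq; rewrite /rsum.
have := @esumB R T setT (EFin \o p) (EFin \o q).
have E f : (forall i, 0 <= f i) -> (\esum_(i in [set: T]) `|(EFin \o f) i|)%E = es f.
  by move=> f0; apply: eq_esum => i _ /=; rewrite ger0_norm.
rewrite /summable !E// => /(_ sp sq) H.
have {}H := H (fun i _ => p0 i) (fun i _ => q0 i).
rewrite -[LHS]/(fine (_%:E)) -[RHS]/(fine (_%:E)); congr fine.
rewrite !EFinB (fineK_es p0 sp) (fineK_es q0 sq) -H; congr (_ - _)%E; rewrite fineK// ge0_fin_numE ?esum_ge0//.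
  apply: le_lt_trans sp; apply: le_esum => i _.
  by rewrite funeposE ge_max !lee_fin p0 lerBlDr lerDl q0.
apply: le_lt_trans sq; apply: le_esum => i _.
by rewrite funenegE ge_max !lee_fin q0 opprB lerBlDr lerDl p0.
Qed.

Definition rpos f i := Num.max (f i) 0.
Definition rneg f i := Num.max (- f i) 0.

Lemma rpos_ge0 f i : 0 <= rpos f i.
Proof. by rewrite /rpos le_max lexx orbT. Qed.
Lemma rneg_ge0 f i : 0 <= rneg f i.
Proof. by rewrite /rneg le_max lexx orbT. Qed.
Lemma rposneg f i : f i = rpos f i - rneg f i.
Proof.
rewrite /rpos /rneg; have [h|h] := leP 0 (f i).
  by rewrite max_r ?subr0// oppr_le0.
by rewrite max_l ?sub0r ?opprK// oppr_ge0 ltW.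
Qed.
Lemma rpos_le f i : rpos f i <= `|f i|.
Proof. by rewrite /rpos ge_max ler_norm normr_ge0. Qed.
Lemma rneg_le f i : rneg f i <= `|f i|.
Proof. by rewrite /rneg ge_max -normrN ler_norm normr_ge0. Qed.

Lemma le_es p q : (forall i, p i <= q i) -> (es p <= es q)%E.
Proof. by move=> pq; apply: le_esum => i _; rewrite lee_fin. Qed.

Lemma le_fine_es p q : (forall i, 0 <= p i) -> (forall i, p i <= q i) -> (es q < +oo)%E ->
  fine (es p) <= fine (es q).
Proof.
move=> p0 pq qf; have q0 i : 0 <= q i by exact: le_trans (p0 i) (pq i).
have pq' := le_es pq; rewrite -lee_fin (fineK_es q0 qf).
by rewrite (fineK_es p0 (le_lt_trans pq' qf)).
Qed.

Lemma es_pos_fin f : (es (fun i => `|f i|) < +oo)%E -> (es (rpos f) < +oo)%E.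
Proof. by apply: le_lt_trans; apply: le_es => i; exact: rpos_le. Qed.
Lemma es_neg_fin f : (es (fun i => `|f i|) < +oo)%E -> (es (rneg f) < +oo)%E.
Proof. by apply: le_lt_trans; apply: le_es => i; exact: rneg_le. Qed.

Lemma rsumE f : rsum f = fine (es (rpos f)) - fine (es (rneg f)).
Proof.
rewrite /rsum; congr (fine _ - fine _); apply: eq_esum => i _.
  by rewrite funeposE /rpos /= /maxe /Num.max lte_fin; case: ifP.
by rewrite funenegE /rneg /= /maxe /Num.max lte_fin; case: ifP.
Qed.

Lemma esD p q : (forall i, 0 <= p i) -> (forall i, 0 <= q i) ->
  es (fun i => p i + q i) = (es p + es q)%E.
Proof. by move=> p0 q0; rewrite -esumD// => i _; rewrite lee_fin. Qed.

Lemma rsumD f g : (es (fun i => `|f i|) < +oo)%E -> (es (fun i => `|g i|) < +oo)%E ->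
  rsum (fun i => f i + g i) = rsum f + rsum g.
Proof.
move=> sf sg; rewrite (_ : (fun i => _) = fun i => (rpos f i + rpos g i) - (rneg f i + rneg g i)); last first.
  by apply/funext => i; rewrite (rposneg f i) (rposneg g i) opprD addrACA.
have F1 := es_pos_fin sf. have F2 := es_neg_fin sf.
have G1 := es_pos_fin sg. have G2 := es_neg_fin sg.
rewrite rsumBE; first last.
- by rewrite esD ?lte_add_pinfty//; exact: rneg_ge0.
- by rewrite esD ?lte_add_pinfty//; exact: rpos_ge0.
- by move=> i; rewrite addr_ge0 ?rneg_ge0.
- by move=> i; rewrite addr_ge0 ?rpos_ge0.
rewrite !esD; try exact: rpos_ge0; try exact: rneg_ge0.
rewrite !rsumE !fineD ?ge0_fin_numE ?es_ge0//;
  try exact: rpos_ge0; try exact: rneg_ge0.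
by rewrite opprD addrACA.
Qed.

Lemma rsumN f : rsum (fun i => - f i) = - rsum f.
Proof.
rewrite !rsumE opprB; congr (fine _ - fine _); apply: eq_esum => i _ //.
by rewrite /rpos /rneg opprK.
Qed.

Lemma esZ r p : 0 <= r -> (forall i, 0 <= p i) -> es (fun i => r * p i) = (r%:E * es p)%E.
Proof.
by move=> r0 p0; rewrite -esumZl// => i; rewrite lee_fin.
Qed.

Lemma rsumZ r f : (es (fun i => `|f i|) < +oo)%E -> rsum (fun i => r * f i) = r * rsum f.
Proof.
move=> sf; wlog r0 : r f sf / 0 <= r => [H|].
  have [/H|/ltW r0] := leP 0 r; first exact.
  have := H (- r) (fun i => - f i).
  rewrite oppr_ge0 rsumN mulrNN => <- //; last first.
    by under eq_esum do rewrite normrN.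
  by congr rsum; apply/funext => i; rewrite mulrNN.
rewrite (_ : (fun i => _) = fun i => r * rpos f i - r * rneg f i); last first.
  by apply/funext => i; rewrite {1}(rposneg f i) mulrBr.
have F1 := es_pos_fin sf. have F2 := es_neg_fin sf.
have P1 := rpos_ge0 f. have P2 := rneg_ge0 f.
have K p : (forall i, 0 <= p i) -> (es p < +oo)%E -> (es (fun i => r * p i) < +oo)%E.
  by move=> p0 pf; rewrite esZ// -(fineK_es p0 pf) -EFinM ltry.
have Q1 i : 0 <= r * rpos f i by rewrite mulr_ge0.
have Q2 i : 0 <= r * rneg f i by rewrite mulr_ge0.
rewrite (rsumBE Q1 Q2 (K _ P1 F1) (K _ P2 F2)).
rewrite !esZ// rsumE.
by rewrite -(fineK_es P1 F1) -(fineK_es P2 F2) -!EFinM /= mulrBr.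
Qed.

Lemma rsum_le_abs f : (es (fun i => `|f i|) < +oo)%E ->
  rsum f <= fine (es (fun i => `|f i|)).
Proof.
move=> sf; rewrite rsumE lerBlDr -[leLHS]addr0 lerD//.
  exact: le_fine_es (rpos_ge0 f) (rpos_le f) sf.
by apply/fine_ge0/es_ge0; exact: rneg_ge0.
Qed.

End RealSums.

Local Notation es f := (\esum_(i in [set: _]) (f i)%:E)%E.

Section ComplexSums.
Context {T : choiceType}.
Implicit Types (a b c : T -> C).

Lemma fineK_asum c : (asum c < +oo)%E -> ((fine (asum c))%:E = asum c)%E.
Proof. by apply: fineK_es => i; exact: normc_ge0. Qed.

Lemma asum_Re c : (asum c < +oo)%E -> (es (fun i => `|Re (c i)|) < +oo)%E.
Proof. by apply: le_lt_trans; apply: le_es => i; exact: normRe_le. Qed.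
Lemma asum_Im c : (asum c < +oo)%E -> (es (fun i => `|Im (c i)|) < +oo)%E.
Proof. by apply: le_lt_trans; apply: le_es => i; exact: normIm_le. Qed.

Lemma asumD_fin a b : (asum a < +oo)%E -> (asum b < +oo)%E ->
  (asum (fun i => a i + b i)%R < +oo)%E.
Proof.
move=> sa sb; apply: le_lt_trans (lte_add_pinfty sa sb).
rewrite /asum -esD; [|by move=> i; exact: normc_ge0..].
by apply: le_es => i; exact: normcD.
Qed.

Lemma asumN c : asum (fun i => - c i) = asum c.
Proof. by apply: eq_esum => i _; rewrite normcN. Qed.

Lemma asumZ z c : asum (fun i => z * c i) = ((normc z)%:E * asum c)%E.
Proof.
rewrite /asum -esZ; [|exact: normc_ge0|by move=> i; exact: normc_ge0].
by apply: eq_esum => i _; rewrite normcM.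
Qed.

Lemma asumZ_fin z c : (asum c < +oo)%E -> (asum (fun i => z * c i)%R < +oo)%E.
Proof.
by move=> sc; rewrite asumZ -(fineK_asum sc) -EFinM ltry.
Qed.

Lemma csumD a b : (asum a < +oo)%E -> (asum b < +oo)%E ->
  csum (fun i => a i + b i) = csum a + csum b.
Proof.
move=> sa sb; apply: complex_eqP; rewrite ?cReD ?cImD /=.
  rewrite -rsumD; [|exact: asum_Re..].
  by congr rsum; apply/funext => i; rewrite cReD.
rewrite -rsumD; [|exact: asum_Im..].
by congr rsum; apply/funext => i; rewrite cImD.
Qed.

Lemma csumN a : csum (fun i => - a i) = - csum a.
Proof.
apply: complex_eqP; rewrite ?cReN ?cImN /= -rsumN.
  by congr rsum; apply/funext => i; rewrite cReN.
by congr rsum; apply/funext => i; rewrite cImN.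
Qed.

Lemma csumB a b : (asum a < +oo)%E -> (asum b < +oo)%E ->
  csum (fun i => a i - b i) = csum a - csum b.
Proof.
by move=> sa sb; rewrite csumD ?asumN// csumN.
Qed.

Lemma csumZ z a : (asum a < +oo)%E -> csum (fun i => z * a i) = z * csum a.
Proof.
move=> sa; have sR := asum_Re sa; have sI := asum_Im sa.
have sZ r f : (es (fun i : T => `|f i|) < +oo)%E -> (es (fun i => `|r * f i : R|) < +oo)%E.
  move=> sf; under eq_esum do rewrite normrM.
  by rewrite esZ// -(fineK_es _ sf)// -EFinM ltry.
apply: complex_eqP; rewrite ?cReM ?cImM /=.
  rewrite -(rsumZ (Re z) sR) -(rsumZ (Im z) sI) -rsumN -rsumD; first last.
  by under eq_esum do rewrite normrN; exact: sZ.
  exact: sZ.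
  by congr rsum; apply/funext => i; rewrite cReM.
rewrite -(rsumZ (Re z) sI) -(rsumZ (Im z) sR) -rsumD; [|exact: sZ..].
by congr rsum; apply/funext => i; rewrite cImM.
Qed.

(** Rotating the whole sum onto the real axis leaves the modulus of every term unchanged, so the
    real triangle inequality suffices. *)
Lemma normc_csum a : ((normc (csum a))%:E <= asum a)%E.
Proof.
have [sa|] := ltP (asum a) +oo%E; last by rewrite leye_eq => /eqP ->; rewrite leey.
have [e [e1 <-]] := normc_polar (csum a).
rewrite -csumZ//= -(fineK_asum sa).
have sea i : `|Re (e * a i)| <= normc (a i).
  by apply: le_trans (normRe_le _) _; rewrite normcM e1 mul1r.
have fea := le_lt_trans (le_es sea) sa.
rewrite lee_fin (le_trans (rsum_le_abs fea))//.
exact: le_fine_es (fun i => normr_ge0 _) sea sa.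
Qed.

End ComplexSums.

(** Fubini from Tonelli: real and imaginary parts are split into positive and negative parts, for
    which iterated and joint sums always agree. *)
Lemma csum_pair (T1 T2 : choiceType) (G : T1 -> T2 -> C) :
  (\esum_(i in [set: T1]) asum (G i) < +oo)%E ->
  csum (fun p : T1 * T2 => G p.1 p.2) = csum (fun i => csum (G i)).
Proof.
have key (g : T1 -> T2 -> R) : (\esum_(i in [set: T1]) es (fun j => `|g i j|) < +oo)%E ->
  rsum (fun p : T1 * T2 => g p.1 p.2) = rsum (fun i => rsum (g i)).
  move=> sg.
  have fin i : (es (fun j => `|g i j|) < +oo)%E.
    apply: le_lt_trans sg.
    apply: (@esum_ub T1 (fun i => \esum_(j in [set: T2]) `|g i j|%:E)%E) => i'.
    by apply: esum_ge0 => j _; rewrite lee_fin.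
  under [X in _ = rsum X]eq_fun do rewrite rsumE.
  have Q (p : T1 -> T2 -> R) : (forall i j, 0 <= p i j <= `|g i j|) ->
     [/\ forall i, 0 <= fine (es (p i)),
      es (fun i => fine (es (p i))) = (es (fun q : T1 * T2 => p q.1 q.2))%E
      & (es (fun i => fine (es (p i))) < +oo)%E].
    move=> pH.
    have p0 i : (0 <= es (p i))%E by apply: es_ge0 => j; case/andP: (pH i j).
    have pfin i : (es (p i) < +oo)%E.
      by apply: le_lt_trans (fin i); apply: le_es => j; case/andP: (pH i j).
    have E : es (fun i => fine (es (p i))) = (\esum_(i in [set: T1]) \esum_(j in [set: T2]) (p i j)%:E)%E.
      by apply: eq_esum => i _; rewrite fineK_es// => j; case/andP: (pH i j).
    split => //; first by move=> i; rewrite fine_ge0.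
    - rewrite E -(esum_pair (a := fun i j => (p i j)%:E))// => i j.
      by rewrite lee_fin; case/andP: (pH i j).
    - rewrite E; apply: le_lt_trans sg; apply: le_esum => i _; apply: le_es => j.
      by case/andP: (pH i j).
  have [|A1 A2 A3] := Q (fun i => rpos (g i)).
    by move=> i j; rewrite rpos_ge0 rpos_le.
  have [|B1 B2 B3] := Q (fun i => rneg (g i)).
    by move=> i j; rewrite rneg_ge0 rneg_le.
  by rewrite rsumBE// A2 B2 rsumE.
move=> sG; rewrite /csum /=; congr (_ +i* _); apply: key;
  apply: le_lt_trans sG; apply: le_esum => i _; apply: le_es => j;
  [exact: normRe_le|exact: normIm_le].
Qed.

Lemma csum_reindex (T T' : choiceType) (e : T -> T') (f : T' -> T)
    (a : T' -> C) : cancel e f -> cancel f e ->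
  csum (fun i => a (e i)) = csum a.
Proof.
move=> ef fe; rewrite /csum /rsum; congr ((fine _ - fine _) +i* (fine _ - fine _)).
- by rewrite -(esum_reindex_bij ((EFin \o (fun i => Re (a i)))^\+%E) ef fe); apply: eq_esum => i _; rewrite ?funeposE ?funenegE.
- by rewrite -(esum_reindex_bij ((EFin \o (fun i => Re (a i)))^\-%E) ef fe); apply: eq_esum => i _; rewrite ?funeposE ?funenegE.
- by rewrite -(esum_reindex_bij ((EFin \o (fun i => Im (a i)))^\+%E) ef fe); apply: eq_esum => i _; rewrite ?funeposE ?funenegE.
- by rewrite -(esum_reindex_bij ((EFin \o (fun i => Im (a i)))^\-%E) ef fe); apply: eq_esum => i _; rewrite ?funeposE ?funenegE.
Qed.

Lemma csum_swap (T1 T2 : choiceType) (G : T1 -> T2 -> C) :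
  (\esum_(i in [set: T1]) asum (G i) < +oo)%E ->
  csum (fun i => csum (G i)) = csum (fun j => csum (fun i => G i j)).
Proof.
move=> sG; rewrite -csum_pair// -(csum_pair (G := fun j i => G i j)); last first.
  by rewrite esum_swap// => i j; rewrite lee_fin normc_ge0.
by apply: (@csum_reindex (T1 * T2)%type (T2 * T1)%type (fun p => (p.2, p.1)) (fun p => (p.2, p.1))
  (fun p => G p.2 p.1)) => -[].
Qed.

Lemma csum_finite (T : choiceType) (F : seq T) (a : T -> C) : uniq F ->
  (forall i, i \notin F -> a i = 0) -> csum a = \sum_(i <- F) a i.
Proof.
move=> uF aF.
have E (p : T -> R) : (forall i, 0 <= p i) -> (forall i, i \notin F -> p i = 0) ->
    es p = (\sum_(i <- F) p i)%:E.
  move=> p0 pF; have p0' i : (0 <= (p i)%:E)%E by rewrite lee_fin.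
  rewrite (esumID [set` F])//.
  rewrite [X in (_ + X)%E]esum1 ?adde0; last first.
    by move=> i [_ /= /negP iF]; rewrite pF.
  by rewrite setTI esum_fset// -fsbig_seq// sumEFin.
have K (g : T -> R) : (forall i, i \notin F -> g i = 0) -> rsum g = \sum_(i <- F) g i.
  move=> gF; rewrite rsumE !E /=.
  - by rewrite -sumrB; apply: eq_bigr => i _; rewrite -rposneg.
  - exact: rneg_ge0.
  - by move=> i iF; rewrite /rneg gF// oppr0 maxxx.
  - exact: rpos_ge0.
  - by move=> i iF; rewrite /rpos gF// maxxx.
by apply: complex_eqP; rewrite ?cRe_sum ?cIm_sum /=; apply: K => i iF; rewrite aF.
Qed.

End Sums.

(** * The algebra l^1 /\ H^1 of Fourier coefficients *)

Section Weights.
Context {R : realType} {d : nat}.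
Local Notation C := R[i].
Local Notation K := 'rV[int]_d.
Local Notation es f := (\esum_(i in [set: _]) (f i)%:E)%E.
Implicit Types (k l : K).

(** Equivalent to (1 + |k|^2)^(1/2), but built from the sum of the |k_j| so as to be subadditive and
    submultiplicative with constant 1. *)
Definition rho k : R := 1 + \sum_(j < d) `|(k 0 j)%:~R|.

Definition dotk k l : R := \sum_(j < d) (k 0 j)%:~R * (l 0 j)%:~R.

Lemma rho_ge1 k : 1 <= rho k.
Proof. by rewrite /rho lerDl sumr_ge0. Qed.

Lemma rho_ge0 k : 0 <= rho k.
Proof. exact: le_trans ler01 (rho_ge1 k). Qed.

Lemma rhoN k : rho (- k) = rho k.
Proof.
by rewrite /rho; congr (_ + _); apply: eq_bigr => j _; rewrite mxE rmorphN normrN.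
Qed.

Lemma rho_sumD k l : \sum_(j < d) `|((k + l)%R 0 j)%:~R| <=
  \sum_(j < d) `|(k 0 j)%:~R| + \sum_(j < d) `|(l 0 j)%:~R| :> R.
Proof.
by rewrite -big_split /=; apply: ler_sum => j _; rewrite mxE rmorphD ler_normD.
Qed.

Lemma rhoD k l : rho (k + l) <= rho k + rho l.
Proof. by rewrite /rho; have := rho_sumD k l; lra. Qed.

Lemma rhoM k l : rho (k + l) <= rho k * rho l.
Proof.
rewrite /rho; have := rho_sumD k l.
have : 0 <= \sum_(j < d) `|(k 0 j)%:~R| :> R by rewrite sumr_ge0.
have : 0 <= \sum_(j < d) `|(l 0 j)%:~R| :> R by rewrite sumr_ge0.
nra.
Qed.

Lemma dotkk k : dotk k k = freq_sq k.
Proof. by apply: eq_bigr => j _; rewrite expr2. Qed.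

Lemma norm_dotk k l : `|dotk k l| <= rho k * rho l.
Proof.
apply: le_trans (_ : (\sum_(j < d) `|(k 0 j)%:~R|) * rho l <= _); last first.
  by rewrite ler_wpM2r ?rho_ge0// /rho lerDr.
rewrite mulr_suml (le_trans (ler_norm_sum _ _ _))//; apply: ler_sum => j _.
rewrite normrM ler_wpM2l// /rho (bigD1 j)//= addrCA lerDl.
by rewrite addr_ge0// sumr_ge0.
Qed.

Lemma freq_sq_ge0 k : 0 <= freq_sq k :> R.
Proof. by apply: sumr_ge0 => j _; rewrite sqr_ge0. Qed.

Lemma freq_sq_le k : freq_sq k <= rho k ^+ 2.
Proof. by rewrite -dotkk expr2 (le_trans (ler_norm _) (norm_dotk _ _)). Qed.

Lemma freq_sqN k : freq_sq (- k) = freq_sq k :> R.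
Proof. by apply: eq_bigr => j _; rewrite mxE rmorphN sqrrN. Qed.

Lemma freq_sqD k l : freq_sq (k + l) = freq_sq k + freq_sq l + 2 * dotk k l.
Proof.
rewrite /freq_sq /dotk mulr_sumr -!big_split /=; apply: eq_bigr => j _.
by rewrite mxE rmorphD /=; ring.
Qed.

Lemma dotkDl k1 k2 l : dotk (k1 + k2) l = dotk k1 l + dotk k2 l.
Proof.
rewrite /dotk -big_split /=; apply: eq_bigr => j _.
by rewrite mxE rmorphD /=; ring.
Qed.

(** Test sequences for duality: the l^2 norm of a nonnegative sequence is the supremum of its
    pairings with them. *)
Definition l2unit (b : K -> R) : Prop :=
  (forall k, 0 <= b k) /\ (es (fun k => b k ^+ 2) <= 1)%E.

(* By duality, weighing by [xweight]s and summing gives the maximum of the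
   norms of l^1 and of H^1; l^1 /\ H^1 is an algebra in every dimension. *)
Definition xweight (g : K -> R) : Prop :=
  (forall k, g k = 1) \/ exists2 b, l2unit b & forall k, g k = b k * rho k.

(** Only upper bounds on the norm are ever used, so it is kept as a predicate. Linearity in [g] lets
    most estimates treat the l^1 and the H^1 half in one argument. *)
Definition XN (a : K -> R) (B : R) : Prop :=
  forall g, xweight g -> (es (fun k => g k * a k) <= B%:E)%E.

Lemma xweight_ge0 g : xweight g -> forall k, 0 <= g k.
Proof.
move=> [h k|[b [b0 _] h] k]; first by rewrite h.
by rewrite h mulr_ge0// rho_ge0.
Qed.

Lemma xweight1 : xweight (fun=> 1).
Proof. by left. Qed.

Lemma XN_sum a B : XN a B -> (es a <= B%:E)%E.
Proof.
by move=> /(_ _ xweight1); under eq_esum do rewrite mul1r.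
Qed.

Lemma XN_ge0 a B : (forall k, 0 <= a k) -> XN a B -> 0 <= B.
Proof.
by move=> a0 /XN_sum; rewrite -lee_fin; apply: le_trans; exact: es_ge0.
Qed.

Lemma XN_le a b B : (forall k, a k <= b k) -> XN b B -> XN a B.
Proof.
move=> ab H g xg; apply: le_trans (H g xg); apply: le_es => k.
by rewrite ler_wpM2l// xweight_ge0.
Qed.

Lemma XN_leB a B B' : B <= B' -> XN a B -> XN a B'.
Proof. by move=> BB H g xg; apply: le_trans (H g xg) _; rewrite lee_fin. Qed.

Lemma XN_add a b A B : (forall k, 0 <= a k) -> (forall k, 0 <= b k) ->
  XN a A -> XN b B -> XN (fun k => a k + b k) (A + B).
Proof.
move=> a0 b0 HA HB g xg; under eq_esum do rewrite mulrDr.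
have g0 := xweight_ge0 xg.
rewrite esD; [|by move=> k; apply: mulr_ge0..].
by rewrite EFinD; apply: leeD; [exact: HA|exact: HB].
Qed.

Lemma XN_scale r a B : 0 <= r -> (forall k, 0 <= a k) ->
  XN a B -> XN (fun k => r * a k) (r * B).
Proof.
move=> r0 a0 H g xg; under eq_esum do rewrite mulrCA.
rewrite esZ// ?EFinM ?lee_wpmul2l ?H ?lee_fin// => k; rewrite mulr_ge0//.
exact: xweight_ge0.
Qed.

(** Needed because, with two input frequencies frozen, a test sequence evaluated at the output
    frequency is a translate in the remaining one. *)
Lemma l2unit_shift b l : l2unit b -> l2unit (fun k => b (l + k)).
Proof.
move=> [b0 b1]; split => // ; apply: le_trans b1.
by rewrite (@esum_reindex_bij R K K (fun k => l + k) (fun k => - l + k)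
   (fun k => (b k ^+ 2)%:E))// => k; rewrite addrA ?subrr ?addNr add0r.
Qed.

Lemma esum_opp (a : K -> R) : es (fun k => a (- k)) = es a.
Proof.
by rewrite (@esum_reindex_bij R K K (fun k => - k) (fun k => - k)
   (fun k => (a k)%:E))// => k; rewrite opprK.
Qed.

Lemma l2unit_opp b : l2unit b -> l2unit (fun k => b (- k)).
Proof.
by move=> [b0 b1]; split => //; rewrite (esum_opp (fun k => b k ^+ 2)).
Qed.

Lemma xweight_opp g : xweight g -> xweight (fun k => g (- k)).
Proof.
move=> [h|[b b1 h]]; first by left.
by right; exists (fun k => b (- k)); [exact: l2unit_opp|move=> k; rewrite h rhoN].
Qed.

Lemma XN_opp a B : XN a B -> XN (fun k => a (- k)) B.
Proof.
move=> H g xg; apply: le_trans (H _ (xweight_opp xg)).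
by rewrite -[leRHS]esum_opp; apply: le_es => k; rewrite opprK.
Qed.

Lemma nest_le (a b : K -> R) (f : K -> K -> K -> R) (A B G : R) :
  (forall k, 0 <= a k) -> (forall k, 0 <= b k) -> 
  (forall k1 k2 k3, 0 <= f k1 k2 k3) ->
  (es a <= A%:E)%E -> (es b <= B%:E)%E ->
  (forall k1 k2, es (f k1 k2) <= G%:E)%E -> 
  (\esum_(k1 in [set: K]) \esum_(k2 in [set: K]) \esum_(k3 in [set: K])
     (a k1 * (b k2 * f k1 k2 k3))%:E <= (A * (B * G))%:E)%E.
Proof.
move=> a0 b0 f0 aA bB fG.
have G0 : 0 <= G by rewrite -lee_fin (le_trans _ (fG 0 0))// es_ge0.
have B0 : 0 <= B by rewrite -lee_fin (le_trans _ bB)// es_ge0.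
apply: (@le_trans _ _ (\esum_(k1 in [set: K]) (a k1 * (B * G))%:E)%E); last first.
  under eq_esum do rewrite mulrC.
  by rewrite esZ// ?mulr_ge0// (mulrC A) (EFinM (B * G) A) lee_wpmul2l// lee_fin mulr_ge0.
apply: le_esum => k1 _.
apply: (@le_trans _ _ ((a k1)%:E * \esum_(k2 in [set: K]) (b k2 * G)%:E)%E); last first.
  under eq_esum do rewrite mulrC.
  by rewrite esZ// (EFinM (a k1)) (mulrC B) (EFinM G B) !lee_wpmul2l ?lee_fin.
rewrite -esumZl//; last by move=> k; rewrite lee_fin mulr_ge0.
apply: le_esum => k2 _.
rewrite -EFinM; under eq_esum do rewrite mulrA.
by rewrite esZ ?mulr_ge0// mulrA (EFinM (a k1 * b k2)) lee_wpmul2l ?lee_fin ?mulr_ge0.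
Qed.

Lemma addk3K k1 k2 k : k1 + k2 + (k - k1 - k2) = k.
Proof. by rewrite -[k - k1 - k2]addrA -opprD addrCA subrr addr0. Qed.

Lemma subk3K k1 k2 k3 : k1 + k2 + k3 - k1 - k2 = k3.
Proof. by rewrite -[_ - k1 - k2]addrA -opprD addrC addKr. Qed.

(** Trilinear Fourier multiplier; for [m = 1] these are the coefficients of a product of three
    functions. *)
Definition tri (m : K -> K -> K -> C) (a b c : K -> C) (k : K) : C :=
  csum (fun p : K * K =>
    m p.1 p.2 (k - p.1 - p.2) * (a p.1 * b p.2 * c (k - p.1 - p.2))).

(** By Tonelli the output frequency can be summed innermost; for fixed [k1] and [k2] the
    substitution [k = k1 + k2 + k3] then decouples the three inputs. The weight [h] stays at the
    output. *)
Lemma tri_majorant (m : K -> K -> K -> C) (a b c : K -> C) (h : K -> R) (al be ga : K -> R) L :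
  (forall k, 0 <= h k) -> 0 <= L ->
  (forall k, 0 <= al k) -> (forall k, 0 <= be k) -> (forall k, 0 <= ga k) ->
  (forall k1 k2 k3, h (k1 + k2 + k3) * (normc (m k1 k2 k3) *
     (normc (a k1) * normc (b k2) * normc (c k3))) <=
     L * (h (k1 + k2 + k3) * (al k1 * (be k2 * ga k3)))) ->
  (\esum_(k in [set: K]) ((h k)%:E * asum (fun p : K * K => (m p.1 p.2 (k - p.1 - p.2) *
      (a p.1 * b p.2 * c (k - p.1 - p.2)))%R) ) <=
   L%:E * \esum_(k1 in [set: K]) \esum_(k2 in [set: K]) \esum_(k3 in [set: K])
     (h (k1 + k2 + k3) * (al k1 * (be k2 * ga k3)))%:E)%E.
Proof.
move=> h0 L0 al0 be0 ga0 H.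
pose F (k k1 k2 : K) : R := h k * (al k1 * (be k2 * ga (k - k1 - k2))).
have F0 k k1 k2 : 0 <= F k k1 k2 by rewrite !mulr_ge0.
apply: (@le_trans _ _ (L%:E * \esum_(k in [set: K]) \esum_(p in [set: K * K])
    (F k p.1 p.2)%:E)%E).
  rewrite -esumZl//; last first.
    by move=> k; apply: es_ge0 => p; exact: F0.
  apply: le_esum => k _; rewrite /asum -!esZ//; last first.
    by move=> p; rewrite normc_ge0.
  apply: le_es => -[k1 k2] /=; have := H k1 k2 (k - k1 - k2).
  have -> : k1 + k2 + (k - k1 - k2) = k by exact: addk3K.
  by rewrite !normcM.
rewrite lee_wpmul2l// ?lee_fin//.
rewrite (esum_swap (a := fun k p => (F k p.1 p.2)%:E)); last first.
  by move=> i j; rewrite lee_fin.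
rewrite (esum_pair (a := fun k1 k2 => (\esum_(k in [set: K]) (F k k1 k2)%:E)%E)); last first.
  by move=> i j; apply: es_ge0 => k; exact: F0.
apply: le_esum => k1 _; apply: le_esum => k2 _.
rewrite -(@esum_reindex_bij R K K (fun k3 => k1 + k2 + k3) (fun k => k - k1 - k2)
  (fun k => (F k k1 k2)%:E)); first last.
- by move=> k; exact: addk3K.
- by move=> k; exact: subk3K.
apply: le_es => k3; rewrite /F.
by have -> : k1 + k2 + k3 - k1 - k2 = k3 by exact: subk3K.
Qed.

(** Algebra property. A test weight [b * rho] at the output splits by [rho (k1 + k2 + k3) <= rho k1
    + rho k2 + rho k3]; each of the three terms takes the H^1 norm of one factor and the l^1 norms
    of the other two, whence the factor 3. The extra weight [w] makes the lemma serve for stronger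
    norms as well. *)
Lemma XN_tri (m : K -> K -> K -> C) (a b c : K -> C) (w : K -> R) (al be ga : K -> R) L A B G :
  (forall k, 0 <= w k) -> 0 <= L ->
  (forall k, 0 <= al k) -> (forall k, 0 <= be k) -> (forall k, 0 <= ga k) ->
  (forall k1 k2 k3, w (k1 + k2 + k3) * (normc (m k1 k2 k3) *
     (normc (a k1) * normc (b k2) * normc (c k3))) <= L * (al k1 * (be k2 * ga k3))) ->
  XN al A -> XN be B -> XN ga G ->
  XN (fun k => w k * normc (tri m a b c k)) (3 * (L * (A * (B * G)))).
Proof.
move=> w0 L0 al0 be0 ga0 H HA HB HG g xg.
have g0 := xweight_ge0 xg.
pose m' k1 k2 k3 := (w (k1 + k2 + k3))%:C * m k1 k2 k3.
apply: (@le_trans _ _ (\esum_(k in [set: K]) ((g k)%:E * asum (fun p : K * K => (m' p.1 p.2 (k - p.1 - p.2) *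
      (a p.1 * b p.2 * c (k - p.1 - p.2)))%R) ))%E).
  apply: le_esum => k _; rewrite EFinM lee_wpmul2l ?lee_fin//.
  have -> : (w k * normc (tri m a b c k))%:E = ((w k)%:E * (normc (tri m a b c k))%:E)%E.
    by rewrite EFinM.
  apply: (@le_trans _ _ ((w k)%:E * asum (fun p : K * K => (m p.1 p.2 (k - p.1 - p.2) *
      (a p.1 * b p.2 * c (k - p.1 - p.2)))%R))%E).
    by rewrite lee_wpmul2l ?lee_fin//; exact: normc_csum.
  rewrite /asum -esZ//; last by move=> p; exact: normc_ge0.
  apply: le_es => -[k1 k2] /=; rewrite /m'.
  have -> : k1 + k2 + (k - k1 - k2) = k by exact: addk3K.
  by rewrite -mulrA !normcM normc_real ger0_norm// !mulrA.
have A0 := XN_ge0 al0 HA. have B0 := XN_ge0 be0 HB. have G0 := XN_ge0 ga0 HG.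
apply: le_trans (tri_majorant (al := al) (be := be) (ga := ga) (L := L) _ _ _ _ _ _) _ => //.
  move=> k1 k2 k3; rewrite [leRHS]mulrCA ler_wpM2l//.
  by apply: le_trans (H k1 k2 k3); rewrite !normcM normc_real ger0_norm// !mulrA.
rewrite mulrCA (EFinM L) lee_wpmul2l ?lee_fin//.
have sA := XN_sum HA; have sB := XN_sum HB; have sG := XN_sum HG.
case: xg => [g1|[b' b'1 gE]].
  under eq_esum do under eq_esum do under eq_esum do rewrite g1 mul1r.
  apply: le_trans (nest_le al0 be0 (fun _ _ => ga0) sA sB (fun _ _ => sG)) _.
  (* For the l^1 weight the constant is 1; it is weakened to 3 to agree with the H^1 case. *)
  by rewrite lee_fin ler_peMl ?mulr_ge0// ler1n.
have [b'0 _] := b'1.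
pose P1 (k1 k2 k3 : K) : R := b' (k1 + k2 + k3) * (rho k1 * al k1) .
pose P2 (k1 k2 k3 : K) : R := b' (k1 + k2 + k3) * (rho k2 * be k2).
pose P3 (k1 k2 k3 : K) : R := b' (k1 + k2 + k3) * (rho k3 * ga k3).
have P10 k1 k2 k3 : 0 <= P1 k1 k2 k3 by rewrite !mulr_ge0 ?rho_ge0.
have P20 k1 k2 k3 : 0 <= P2 k1 k2 k3 by rewrite !mulr_ge0 ?rho_ge0.
have P30 k1 k2 k3 : 0 <= P3 k1 k2 k3 by rewrite !mulr_ge0 ?rho_ge0.
have sP (f : K -> R) (Bf : R) l : XN f Bf ->
    (\esum_(k in [set: K]) (b' (l + k) * (rho k * f k))%:E <= Bf%:E)%E.
  move=> /(_ (fun k => b' (l + k) * rho k)) Hf.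
  under eq_esum do rewrite mulrA; apply: Hf; right; exists (fun k => b' (l + k)) => //.
  exact: l2unit_shift.
pose S3 (F : K -> K -> K -> R) := (\esum_(k1 in [set: K]) \esum_(k2 in [set: K]) 
   \esum_(k3 in [set: K]) (F k1 k2 k3)%:E)%E.
have S3D F F' : (forall k1 k2 k3, 0 <= F k1 k2 k3) -> (forall k1 k2 k3, 0 <= F' k1 k2 k3) ->
    S3 (fun k1 k2 k3 => F k1 k2 k3 + F' k1 k2 k3) = (S3 F + S3 F')%E.
  move=> F0 F'0; rewrite /S3 -esumD.
  - apply: eq_esum => k1 _; rewrite -esumD.
    + by apply: eq_esum => k2 _; rewrite esD.
    + by move=> k2 _; exact: es_ge0.
    + by move=> k2 _; exact: es_ge0.
  - by move=> k1 _; apply: esum_ge0 => k2 _; exact: es_ge0.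
  - by move=> k1 _; apply: esum_ge0 => k2 _; exact: es_ge0.
pose Q1 (k1 k2 k3 : K) : R := be k2 * (ga k3 * P1 k1 k2 k3).
pose Q2 (k1 k2 k3 : K) : R := al k1 * (ga k3 * P2 k1 k2 k3).
pose Q3 (k1 k2 k3 : K) : R := al k1 * (be k2 * P3 k1 k2 k3).
have Q10 k1 k2 k3 : 0 <= Q1 k1 k2 k3 by rewrite !mulr_ge0 ?rho_ge0.
have Q20 k1 k2 k3 : 0 <= Q2 k1 k2 k3 by rewrite !mulr_ge0 ?rho_ge0.
have Q30 k1 k2 k3 : 0 <= Q3 k1 k2 k3 by rewrite !mulr_ge0 ?rho_ge0.
apply: (@le_trans _ _ (S3 (fun k1 k2 k3 => (Q1 k1 k2 k3 + Q2 k1 k2 k3) + Q3 k1 k2 k3))).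
  apply: le_esum => k1 _; apply: le_esum => k2 _; apply: le_es => k3.
  rewrite gE /Q1 /Q2 /Q3 /P1 /P2 /P3 -mulrA.
  set bb := b' _; set r := rho _.
  have rr : r <= rho k1 + rho k2 + rho k3.
    by rewrite (le_trans (rhoD _ _))// lerD2r rhoD.
  have -> : be k2 * (ga k3 * (bb * (rho k1 * al k1))) +
    al k1 * (ga k3 * (bb * (rho k2 * be k2))) +
    al k1 * (be k2 * (bb * (rho k3 * ga k3))) =
    bb * ((rho k1 + rho k2 + rho k3) * (al k1 * (be k2 * ga k3))) by ring.
  by rewrite ler_wpM2l ?b'0// ler_wpM2r ?mulr_ge0.
rewrite !S3D//; last by move=> *; rewrite addr_ge0.
have -> : 3 * (A * (B * G)) = B * (G * A) + A * (G * B) + A * (B * G) by ring.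
rewrite !EFinD !leeD//.
(* The frequency carrying [rho] is moved innermost, where the sum becomes a pairing with a
   translated test sequence. *)
- rewrite /S3 esum_swap; last by move=> *; exact: es_ge0.
  under eq_esum do (rewrite esum_swap; last by move=> *; rewrite lee_fin).
  apply: (nest_le (f := fun k2 k3 k1 => P1 k1 k2 k3)) => // k2 k3; rewrite /P1.
  under eq_esum do (rewrite addrC [_ + k2]addrC addrA; rewrite /=).
  exact: sP.
- rewrite /S3.
  under eq_esum do (rewrite esum_swap; last by move=> *; rewrite lee_fin).
  apply: (nest_le (f := fun k1 k3 k2 => P2 k1 k2 k3)) => // k1 k3; rewrite /P2.
  under eq_esum do rewrite addrAC.
  exact: sP.
- apply: (nest_le (f := P3)) => // k1 k2; exact: sP.
Qed.

End Weights.

(** * Derivatives and continuity of complex-valued functions *)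

Section ComplexCalculus.
Context {R : realType}.
Local Notation C := R[i].
Implicit Types (f g : R -> C) (s t l : R) (z : C).

Definition is_cderive f s z : Prop :=
  is_derive s 1 (fun t => Re (f t)) (Re z) /\ is_derive s 1 (fun t => Im (f t)) (Im z).

Definition ccont {X : topologicalType} (f : X -> C) : Prop :=
  continuous (fun x => Re (f x)) /\ continuous (fun x => Im (f x)).

Lemma is_cderive_ext f g s z : f =1 g -> is_cderive f s z -> is_cderive g s z.
Proof. by move=> /funext ->. Qed.

Lemma is_cderive_eq f s z z' : z = z' -> is_cderive f s z -> is_cderive f s z'.
Proof. by move=> ->. Qed.

Lemma is_cderive_cst z s : is_cderive (fun=> z) s 0.
Proof. by split; exact: is_derive_cst. Qed.

Lemma is_cderiveD f g s z w : is_cderive f s z -> is_cderive g s w ->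
  is_cderive (fun t => f t + g t) s (z + w).
Proof.
move=> [f1 f2] [g1 g2]; split.
  under eq_fun do rewrite cReD.
  by rewrite cReD; exact: is_deriveD.
under eq_fun do rewrite cImD.
by rewrite cImD; exact: is_deriveD.
Qed.

Lemma is_cderiveN f s z : is_cderive f s z -> is_cderive (fun t => - f t) s (- z).
Proof.
move=> [f1 f2]; split.
  under eq_fun do rewrite cReN.
  by rewrite cReN; exact: is_deriveN.
under eq_fun do rewrite cImN.
by rewrite cImN; exact: is_deriveN.
Qed.

Lemma is_cderiveB f g s z w : is_cderive f s z -> is_cderive g s w ->
  is_cderive (fun t => f t - g t) s (z - w).
Proof. by move=> Df Dg; apply: is_cderiveD => //; exact: is_cderiveN. Qed.

Lemma is_cderiveM f g s z w : is_cderive f s z -> is_cderive g s w ->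
  is_cderive (fun t => f t * g t) s (z * g s + f s * w).
Proof.
move=> [f1 f2] [g1 g2]; split.
  under eq_fun do rewrite cReM.
  have H := is_deriveB (is_deriveM f1 g1) (is_deriveM f2 g2).
  apply: (is_derive_eq H); rewrite cReD !cReM /GRing.scale /=; ring.
under eq_fun do rewrite cImM.
have H := is_deriveD (is_deriveM f1 g2) (is_deriveM f2 g1).
apply: (is_derive_eq H); rewrite cImD !cImM /GRing.scale /=; ring.
Qed.

Lemma is_cderiveZ f s z w : is_cderive f s z -> is_cderive (fun t => w * f t) s (w * z).
Proof.
move=> Df; have := is_cderiveM (is_cderive_cst w s) Df.
by apply: is_cderive_eq; rewrite mul0r add0r.
Qed.

Lemma is_cderive_real (h : R -> R) s dh : is_derive s 1 h dh ->
  is_cderive (fun t => (h t)%:C) s dh%:C.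
Proof. by move=> hh; split => //=; exact: is_derive_cst. Qed.

Lemma is_cderive_comp f (h : R -> R) s dh z : is_derive s 1 h dh ->
  is_cderive f (h s) z -> is_cderive (fun t => f (h t)) s (dh%:C * z).
Proof.
move=> hh [f1 f2]; split.
  have H := is_derive1_comp (f := fun t => Re (f t)) (g := h) f1 hh.
  by apply: (is_derive_eq H); rewrite cReM /=; ring.
have H := is_derive1_comp (f := fun t => Im (f t)) (g := h) f2 hh.
by apply: (is_derive_eq H); rewrite cImM /=; ring.
Qed.

Lemma is_cderive_expi l s : is_cderive (fun t => expi (l * t)) s ('i%C * l%:C * expi (l * s)).
Proof.
have h : is_derive s 1 ( *%R l) l.
  have H := is_deriveZ (l) (is_derive_id s (1 : R)).
  by apply: (is_derive_eq H); rewrite /GRing.scale /= mulr1.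
have : is_cderive expi (l * s) ('i%C * expi (l * s)).
  split; rewrite ?cReM ?cImM /= ?mul0r ?mul1r ?add0r ?sub0r ?addr0;
  [exact: is_derive_cos|exact: is_derive_sin].
by move=> /(is_cderive_comp h); apply: is_cderive_eq; ring.
Qed.

Lemma ccont_cst {X : topologicalType} z : ccont (fun _ : X => z).
Proof. by split => s; exact: cst_continuous. Qed.

Lemma ccontD (X : topologicalType) (f g : X -> C) : ccont f -> ccont g -> ccont (fun x => f x + g x).
Proof.
move=> [f1 f2] [g1 g2]; split => s.
  under eq_fun do rewrite cReD.
  by rewrite ?cReD; apply: cvgD; [exact: f1|exact: g1].
under eq_fun do rewrite cImD.
by rewrite ?cImD; apply: cvgD; [exact: f2|exact: g2].
Qed.

Lemma ccontN (X : topologicalType) (f : X -> C) : ccont f -> ccont (fun x => - f x).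
Proof.
move=> [f1 f2]; split => s.
  under eq_fun do rewrite cReN.
  by rewrite ?cReN; apply: cvgN; exact: f1.
under eq_fun do rewrite cImN.
by rewrite ?cImN; apply: cvgN; exact: f2.
Qed.

Lemma ccontB (X : topologicalType) (f g : X -> C) : ccont f -> ccont g -> ccont (fun x => f x - g x).
Proof. by move=> cf cg; apply: ccontD => //; exact: ccontN. Qed.

Lemma ccontM (X : topologicalType) (f g : X -> C) : ccont f -> ccont g -> ccont (fun x => f x * g x).
Proof.
move=> [f1 f2] [g1 g2]; split => s.
  under eq_fun do rewrite cReM.
  by rewrite ?cReM; apply: cvgB; apply: cvgM; [exact: f1|exact: g1|exact: f2|exact: g2].
under eq_fun do rewrite cImM.
by rewrite ?cImM; apply: cvgD; apply: cvgM; [exact: f1|exact: g2|exact: f2|exact: g1].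
Qed.

Lemma ccont_comp (X Y : topologicalType) (f : Y -> C) (h : X -> Y) : continuous h -> ccont f -> ccont (fun x => f (h x)).
Proof.
move=> hh [f1 f2]; split => s.
  apply: (@continuous_comp _ _ _ h (fun x => Re (f x))); [exact: hh|exact: f1].
apply: (@continuous_comp _ _ _ h (fun x => Im (f x))); [exact: hh|exact: f2].
Qed.

Lemma is_cderive_ccont f : (forall s, exists z, is_cderive f s z) -> ccont f.
Proof.
move=> H; split => s; have [z [f1 f2]] := H s; apply: differentiable_continuous;
  apply/derivable1_diffP; [exact: (@ex_derive _ _ _ _ _ _ _ f1)|exact: (@ex_derive _ _ _ _ _ _ _ f2)].
Qed.

Lemma ccont_expi l : ccont (fun t => expi (l * t)).
Proof.
by apply: is_cderive_ccont => s; exists ('i%C * l%:C * expi (l * s)); exact: is_cderive_expi.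
Qed.

Lemma is_derive_bigsum (I : eqType) (r : seq I) (F : I -> R -> R) (dF : I -> R) (s : R) :
  (forall i, is_derive s 1 (F i) (dF i)) ->
  is_derive s 1 (fun t => \sum_(i <- r) F i t) (\sum_(i <- r) dF i).
Proof.
move=> H; elim: r => [|i r IH].
  under eq_fun do rewrite big_nil.
  by rewrite big_nil; exact: is_derive_cst.
under eq_fun do rewrite big_cons.
by rewrite big_cons; apply: is_deriveD.
Qed.

Lemma continuous_bigsum (I : eqType) (r : seq I) (F : I -> R -> R) :
  (forall i, continuous (F i)) -> continuous (fun t => \sum_(i <- r) F i t).
Proof.
move=> H; elim: r => [|i r IH] s.
  under eq_fun do rewrite big_nil.
  exact: cvg_cst.
under eq_fun do rewrite big_cons.
by rewrite ?big_cons; apply: cvgD; [exact: H|exact: IH].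
Qed.

End ComplexCalculus.

(** * Mean value inequality for time-dependent sequences *)

Section MeanValue.
Context {R : realType} {d : nat}.
Local Notation C := R[i].
Local Notation K := 'rV[int]_d.
Local Notation es f := (\esum_(i in [set: _]) (f i)%:E)%E.

(* Each finite weighted sum of moduli is turned into the increment of one
   real-valued function by rotating every coordinate. *)
Lemma XN_MVT (w : K -> R) (f f' : R -> K -> C) (a b B : R) : a < b ->
  (forall k, 0 <= w k) ->
  (forall k, ccont (fun s => f s k)) ->
  (forall s, a < s < b -> forall k, is_cderive (fun s => f s k) s (f' s k)) ->
  (forall s, a < s < b -> XN (fun k => w k * normc (f' s k)) B) ->
  XN (fun k => w k * normc (f b k - f a k)) ((b - a) * B).
Proof.
move=> ab w0 fc fD fB g xg.
apply: ge_ereal_sup => _ [X [finX _]] <-.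
rewrite fsbig_finite//= sumEFin lee_fin.
set r := (E in \sum_(k <- E) _).
have [e eP] := choice (fun k => normc_polar (f b k - f a k)).
pose F k (s : R) : R := g k * w k * Re (e k * f s k).
pose dF k (s : R) : R := g k * w k * Re (e k * f' s k).
have FD s : a < s < b -> is_derive s 1 (fun s => \sum_(k <- r) F k s) (\sum_(k <- r) dF k s).
  move=> asb; apply: is_derive_bigsum => k.
  have [D _] := is_cderiveZ (e k) (fD s asb k).
  exact: is_deriveZ.
have Fc : continuous (fun s => \sum_(k <- r) F k s).
  apply: continuous_bigsum => k s.
  have [c _] := ccontM (ccont_cst (e k)) (fc k).
  by apply: cvgM; [exact: cvg_cst|exact: c].
have [s] := MVT ab (fun s => FD s) (continuous_subspaceT Fc).
rewrite in_itv /= => asb E.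
have -> : \sum_(k <- r) g k * (w k * normc (f b k - f a k)) =
    \sum_(k <- r) F k b - \sum_(k <- r) F k a.
  rewrite -sumrB; apply: eq_bigr => k _; rewrite /F -mulrBr -mulrA; congr (_ * (_ * _)).
  have [_ <-] := eP k.
  by rewrite mulrBr cReD cReN.
rewrite E mulrC ler_wpM2l ?subr_ge0 ?(ltW ab)//.
have H := fB s asb g xg.
rewrite -lee_fin; apply: le_trans H.
apply: esum_ge; exists X; first by split.
rewrite fsbig_finite//= sumEFin lee_fin; apply: ler_sum => k _.
rewrite /dF -mulrA ler_wpM2l ?(xweight_ge0 xg)// ler_wpM2l//.
apply: le_trans (le_trans (ler_norm _) (normRe_le _)) _.
by have [ek _] := eP k; rewrite normcM ek mul1r.
Qed.

End MeanValue.

(** * The functions phi_1 and phi_2 *)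

Section ScalarSymbols.
Context {R : realType}.
Local Notation C := R[i].
Implicit Types (s t l y : R).

(** The increment is rotated onto the real axis, where the real mean value theorem applies. *)
Lemma normc_MVT (f f' : R -> C) (a b B : R) : a < b ->
  (forall s, is_cderive f s (f' s)) ->
  (forall s, a < s < b -> normc (f' s) <= B) ->
  normc (f b - f a) <= B * (b - a).
Proof.
move=> ab fD fB.
have [e [e1 <-]] := normc_polar (f b - f a).
have FD s : is_derive s 1 (fun s => Re (e * f s)) (Re (e * f' s)).
  by have [] := is_cderiveZ e (fD s).
have Fc : continuous (fun s => Re (e * f s)).
  by have [] := ccontM (ccont_cst e) (is_cderive_ccont (fun s => ex_intro _ _ (fD s))).
have [s] := MVT ab (fun s _ => FD s) (continuous_subspaceT Fc).
rewrite in_itv /= => asb E.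
rewrite mulrBr cReD cReN E ler_wpM2r ?subr_ge0 ?(ltW ab)//.
apply: le_trans (fB s asb).
by apply: le_trans (le_trans (ler_norm _) (normRe_le _)) _; rewrite normcM e1 mul1r.
Qed.

Lemma normc_expiB1 y : normc (expi y - 1) <= `|y|.
Proof.
have := @normc_MVT (fun s => expi (y * s)) (fun s => 'i%C * y%:C * expi (y * s)) 0 1 `|y| ltr01.
rewrite mulr0 mulr1 expi0 subr0 mulr1; apply.
  by move=> s; exact: is_cderive_expi.
by move=> s _; rewrite !normcM normc_expi normc_i normc_real mul1r mulr1.
Qed.

Lemma normc_expiB s t l : normc (expi (l * t) - expi (l * s)) <= `|l| * `|t - s|.
Proof.
have -> : expi (l * t) - expi (l * s) = expi (l * s) * (expi (l * (t - s)) - 1).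
  by rewrite mulrBr mulr1 -expiD; congr (expi _ - _); ring.
by rewrite normcM normc_expi mul1r -normrM normc_expiB1.
Qed.

Lemma is_cderive_id s : is_cderive (fun t => t%:C : C) s 1.
Proof.
have -> : (1 : C) = (1 : R)%:C by [].
by apply: is_cderive_real; exact: is_derive_id.
Qed.

Lemma normc_expiB2 y : normc (expi y - 1 - 'i%C * y%:C) <= y ^+ 2.
Proof.
have := @normc_MVT (fun s => expi (y * s) - 'i%C * y%:C * s%:C)
   (fun s => 'i%C * y%:C * expi (y * s) - 'i%C * y%:C * 1) 0 1 (y ^+ 2) ltr01.
rewrite mulr0 mulr1 expi0 subr0 mulr1 !mulr0 !mulr1 subr0 [_ - _ - 1]addrAC; apply.
  move=> s; apply: is_cderiveB; first exact: is_cderive_expi.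
  have H := is_cderiveZ ('i%C * y%:C) (is_cderive_id s).
  by apply: (is_cderive_eq _ H); rewrite mulr1.
move=> s /andP[s0 s1]; rewrite -[X in _ - X]mulr1 -mulrBr !normcM normc_i normc_real mul1r -real_normK ?num_real// expr2.
rewrite ler_wpM2l// (le_trans (normc_expiB1 _))// normrM ler_piMr//.
by rewrite ger0_norm ltW.
Qed.

(* [J1 l s] is the integral of [e^(i l r)] over [0, s], and [J2 l s] that of
   [r e^(i l r)]. *)
Definition J1 l s : C := if l == 0 then s%:C else (expi (l * s) - 1) / ('i%C * l%:C).
Definition J2 l s : C :=
  if l == 0 then (s ^+ 2 / 2)%:C else (s%:C * expi (l * s) - J1 l s) / ('i%C * l%:C).

Lemma il_neq0 l : l != 0 -> 'i%C * l%:C != 0 :> C.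
Proof.
by move=> l0; rewrite -normc_eq0 normcM normc_i normc_real mul1r normr_eq0.
Qed.

Lemma J1_0 l : J1 l 0 = 0.
Proof. by rewrite /J1; case: eqP => // _; rewrite mulr0 expi0 subrr mul0r. Qed.

Lemma J2_0 l : J2 l 0 = 0.
Proof.
by rewrite /J2 J1_0; case: eqP => // _; rewrite ?expr0n /= ?mul0r ?subrr ?mul0r.
Qed.

Lemma J1_derive l s : is_cderive (J1 l) s (expi (l * s)).
Proof.
rewrite /J1; case: eqVneq => [->|l0].
  by rewrite mul0r expi0; exact: is_cderive_id.
apply: (@is_cderive_ext _ (fun s => ('i%C * l%:C)^-1 * (expi (l * s) - 1))).
  by move=> t; rewrite mulrC.
have H := is_cderiveZ (('i%C * l%:C)^-1)
  (is_cderiveB (is_cderive_expi l s) (is_cderive_cst (1 : C) s)).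
apply: (is_cderive_eq _ H).
by rewrite subr0 mulrA mulVf ?mul1r// il_neq0.
Qed.

Lemma J2_derive l s : is_cderive (J2 l) s (s%:C * expi (l * s)).
Proof.
rewrite /J2; case: eqVneq => [->|l0].
  rewrite mul0r expi0 mulr1; apply: is_cderive_real.
  have H : is_derive s 1 (fun t : R => 2^-1 *: (t * t)) (2^-1 *: (s *: 1 + s *: 1)).
    exact: (is_deriveZ _ (is_deriveM (is_derive_id s (1 : R)) (is_derive_id s (1 : R)))).
  have E : (fun t : R => t ^+ 2 / 2) = (fun t : R => 2^-1 *: (t * t)).
    by apply/funext => t; rewrite /GRing.scale /= expr2 mulrC.
  by rewrite E; apply: (is_derive_eq H); rewrite /GRing.scale /=; lra.
apply: (@is_cderive_ext _ (fun s => ('i%C * l%:C)^-1 * (s%:C * expi (l * s) - J1 l s))).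
  by move=> t; rewrite mulrC.
have H := is_cderiveZ (('i%C * l%:C)^-1)
  (is_cderiveB (is_cderiveM (is_cderive_id s) (is_cderive_expi l s)) (J1_derive l s)).
apply: (is_cderive_eq _ H).
have -> : 1 * expi (l * s) + s%:C * ('i%C * l%:C * expi (l * s)) - expi (l * s) =
  ('i%C * l%:C) * (s%:C * expi (l * s)) by ring.
by rewrite mulrA mulVf ?mul1r// il_neq0.
Qed.

(** Together with the analogue for phi_2 this identifies the symbols of the scheme with exact
    integrals of an oscillation, free of the division by z. *)
Lemma J1_phi1 l s : 0 < s -> J1 l s = s%:C * phi1 ('i%C * (l * s)%:C).
Proof.
move=> s0; rewrite /J1 /phi1; case: eqVneq => [->|l0].
  by rewrite mul0r mulr0 eqxx mulr1.
have ls0 : l * s != 0 by rewrite mulf_neq0// gt_eqF.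
rewrite (negbTE (il_neq0 ls0)) expC_i.
have sC : s%:C != 0 :> C by rewrite -normc_eq0 normc_real normr_eq0 gt_eqF.
have il := il_neq0 l0.
rewrite rmorphM /= ['i%C * (_ * _)]mulrA (invfM ('i%C * l%:C)).
set P := expi _ - _; set q := ('i%C * l%:C)^-1.
have -> : s%:C * (P * (q / s%:C)) = (s%:C / s%:C) * (P * q) by ring.
by rewrite divff// mul1r.
Qed.

Lemma J2_phi2 l s : 0 < s -> J2 l s = s%:C ^+ 2 * phi2 ('i%C * (l * s)%:C).
Proof.
move=> s0; rewrite /J2 /phi2; case: eqVneq => [->|l0].
  rewrite mul0r mulr0 eqxx rmorphM rmorphXn /= fmorphV /= rmorph_nat.
  by rewrite mul1r.
have ls0 : l * s != 0 by rewrite mulf_neq0// gt_eqF.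
rewrite (negbTE (il_neq0 ls0)) expC_i J1_phi1//.
have sC : s%:C != 0 :> C by rewrite -normc_eq0 normc_real normr_eq0 gt_eqF.
have il := il_neq0 l0.
rewrite rmorphM /= -mulrBr ['i%C * (_ * _)]mulrA (invfM ('i%C * l%:C)).
set P := expi _ - _; set q := ('i%C * l%:C)^-1.
have -> : s%:C ^+ 2 * (P * (q / s%:C)) = (s%:C / s%:C) * (s%:C * P * q) by ring.
by rewrite divff// mul1r.
Qed.

Lemma phi1_J1 y : phi1 ('i%C * y%:C) = J1 y 1.
Proof. by rewrite J1_phi1// mul1r mulr1. Qed.

Lemma phi2_J2 y : phi2 ('i%C * y%:C) = J2 y 1.
Proof. by rewrite J2_phi2// expr1n mul1r mulr1. Qed.

(** On the imaginary axis phi_1 is the average over [0, 1] of unit numbers, and phi_2 that of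
    numbers of modulus at most 1. *)
Lemma normc_phi1 y : normc (phi1 ('i%C * y%:C)) <= 1.
Proof.
rewrite phi1_J1 -[J1 y 1]subr0 -(J1_0 y).
have := @normc_MVT (J1 y) (fun s => expi (y * s)) 0 1 1 ltr01 (J1_derive y).
by rewrite subr0 mulr1; apply => s _; rewrite normc_expi.
Qed.

Lemma normc_phi2 y : normc (phi2 ('i%C * y%:C)) <= 1.
Proof.
rewrite phi2_J2 -[J2 y 1]subr0 -(J2_0 y).
have := @normc_MVT (J2 y) (fun s => s%:C * expi (y * s)) 0 1 1 ltr01 (J2_derive y).
rewrite subr0 mulr1; apply => s /andP[s0 s1].
by rewrite normcM normc_expi mulr1 normc_real ger0_norm ltW.
Qed.

(** A quadratic remainder that grows only linearly in [l]: in this form it survives summation over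
    frequencies and lets time derivatives pass under the sum. The two orders of [s] and [t] are
    treated separately because the mean value bound is oriented. *)
Lemma J1_taylor l s t : normc (J1 l t - J1 l s - (t - s)%:C * expi (l * s)) <=
  `|l| * (t - s) ^+ 2.
Proof.
pose f r := J1 l r - r%:C * expi (l * s).
have fD r : is_cderive f r (expi (l * r) - expi (l * s)).
  apply: is_cderiveB; first exact: J1_derive.
  have H := is_cderiveM (is_cderive_id r) (is_cderive_cst (expi (l * s)) r).
  by apply: (is_cderive_eq _ H); rewrite mul1r mulr0 addr0.
have E : J1 l t - J1 l s - (t - s)%:C * expi (l * s) = f t - f s.
  by rewrite /f rmorphB /=; ring.
rewrite E; have [st|ts|->] := ltgtP s t; last by rewrite !subrr normc0 expr0n mulr0.
- rewrite expr2 mulrA; apply: (normc_MVT st fD) => r /andP[sr rt].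
  apply: le_trans (normc_expiB _ _ _) _; rewrite ler_wpM2l// ger0_norm ?subr_ge0 ?(ltW sr)//.
  by rewrite lerD2r ltW.
- rewrite -normcN (opprB (f t)) -sqrrN (opprB t) expr2 mulrA. apply: (normc_MVT ts fD) => r /andP[tr rs].
  apply: le_trans (normc_expiB _ _ _) _; rewrite ler_wpM2l// ler0_norm ?subr_le0 ?(ltW rs)//.
  by rewrite opprB lerD2l lerN2 ltW.
Qed.

(* Linear interpolation of [e^(i psi s)] between [s = 0] and [s = tau], with
   [e^(i l s)] kept exact. *)
Lemma quadrature (tau psi l : R) : 0 < tau ->
  normc (J1 (psi + l) tau - tau%:C * ((phi1 ('i%C * (l * tau)%:C) - phi2 ('i%C * (l * tau)%:C))
     + expi (tau * psi) * phi2 ('i%C * (l * tau)%:C))) <= 2 * (tau ^+ 3 * psi ^+ 2).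
Proof.
move=> t0; have tC : tau%:C != 0 :> C by rewrite -normc_eq0 normc_real normr_eq0 gt_eqF.
(* Slope of the chord of [e^(i psi s)] over [0, tau]; the integral of the interpolant [1 + z s]
   against [e^(i l s)] is [J1 + z J2]. *)
pose z := (tau%:C)^-1 * (expi (tau * psi) - 1).
pose f s := J1 (psi + l) s - J1 l s - z * J2 l s.
have fD s : is_cderive f s (expi ((psi + l) * s) - expi (l * s) - z * (s%:C * expi (l * s))).
  apply: is_cderiveB; last by apply: is_cderiveZ; exact: J2_derive.
  by apply: is_cderiveB; exact: J1_derive.
have E : J1 (psi + l) tau - tau%:C * ((phi1 ('i%C * (l * tau)%:C) - phi2 ('i%C * (l * tau)%:C))
     + expi (tau * psi) * phi2 ('i%C * (l * tau)%:C)) = f tau - f 0.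
  rewrite /f !J1_0 J2_0 mulr0 !subr0 (J1_phi1 l t0) (J2_phi2 l t0).
  have zt : z * tau%:C ^+ 2 = tau%:C * (expi (tau * psi) - 1).
    have -> : z * tau%:C ^+ 2 = (tau%:C^-1 * tau%:C) * (tau%:C * (expi (tau * psi) - 1)).
      by rewrite /z; ring.
    by rewrite mulVf// mul1r.
  by rewrite [z * (_ * _)]mulrA zt; ring.
rewrite E; have -> : 2 * (tau ^+ 3 * psi ^+ 2) = (2 * (tau * psi) ^+ 2) * (tau - 0) by ring.
apply: (normc_MVT t0 fD) => s /andP[s0 st].
(* The linear term [i psi s] is subtracted both from the function and from its chord. Two quadratic
   remainders are left, each at most [(tau psi)^2]. *)
have -> : expi ((psi + l) * s) - expi (l * s) - z * (s%:C * expi (l * s)) =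
  expi (l * s) * ((expi (psi * s) - 1 - 'i%C * (psi * s)%:C) -
   (s / tau)%:C * (expi (tau * psi) - 1 - 'i%C * (tau * psi)%:C)).
  have -> : expi ((psi + l) * s) = expi (psi * s) * expi (l * s) by rewrite -expiD mulrDl.
  have -> : (psi * s)%:C = ((s / tau) * (tau * psi))%:C :> C.
    by congr (_%:C); field; rewrite gt_eqF.
  rewrite /z !rmorphM /= fmorphV /=; ring.
rewrite normcM normc_expi mul1r (le_trans (normcB _ _))//.
have -> : 2 * (tau * psi) ^+ 2 = (tau * psi) ^+ 2 + (tau * psi) ^+ 2 by ring.
apply: lerD.
  apply: le_trans (normc_expiB2 _) _; rewrite !exprMn mulrC ler_wpM2r ?sqr_ge0//.
  by rewrite ler_pXn2r ?nnegrE ?ltW.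
rewrite normcM normc_real ger0_norm ?divr_ge0 ?(ltW s0) ?(ltW t0)//.
apply: le_trans (ler_wpM2l _ (normc_expiB2 _)) _; first by rewrite divr_ge0 ?ltW.
by rewrite ler_piMl ?sqr_ge0// ler_pdivrMr// mul1r ltW.
Qed.

Lemma conjC_sub (z w : C) : (z - w)^*%C = z^*%C - w^*%C.
Proof. by rewrite rmorphB. Qed.

Lemma conjC_mul (z w : C) : (z * w)^*%C = z^*%C * w^*%C.
Proof. by rewrite rmorphM. Qed.

Lemma conjC_inv (z : C) : (z^-1)^*%C = (z^*%C)^-1.
Proof. exact: conjc_inv. Qed.

Lemma expC_conj (z : C) : expC z^*%C = (expC z)^*%C.
Proof.
case: z => a b; rewrite -[LHS]/((expR a)%:C * expi (- b)) expiN.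
by rewrite -[expC _]/((expR a)%:C * expi b) conjC_mul conjc_real.
Qed.

Lemma phi1_conj (z : C) : phi1 z^*%C = (phi1 z)^*%C.
Proof.
rewrite /phi1 conjc_eq0; case: eqP => _; first by rewrite conjc1.
by rewrite conjC_mul conjC_sub conjC_inv conjc1 expC_conj.
Qed.

Lemma phi2_conj (z : C) : phi2 z^*%C = (phi2 z)^*%C.
Proof.
rewrite /phi2 conjc_eq0; case: eqP => _.
  by rewrite conjC_mul conjC_inv conjc1 conjc_nat.
by rewrite conjC_mul conjC_sub conjC_inv expC_conj phi1_conj.
Qed.

End ScalarSymbols.

(** * Coefficient sequences and differences of trilinear forms *)

Section Sequences.
Context {R : realType} {d : nat}.
Local Notation C := R[i].
Local Notation K := 'rV[int]_d.
Local Notation es f := (\esum_(i in [set: _]) (f i)%:E)%E.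
Implicit Types (a b c : K -> C) (m : K -> K -> K -> C) (k : K).

(** [Xb] is the norm in which errors are measured; [X2b] has two more derivatives and expresses the
    regularity of the exact solution. *)
Definition Xb a (B : R) := XN (fun k => normc (a k)) B.
Definition X2b a (B : R) := XN (fun k => rho k ^+ 2 * normc (a k)) B.
(** Fourier coefficients of the complex conjugate function. *)
Definition cflip a (k : K) : C := (a (- k))^*%C.
Definition tribound m (L : R) := forall k1 k2 k3, normc (m k1 k2 k3) <= L.
(** Symbols that cost up to two derivatives on each factor, such as [psi^2] and [phase]; the forms
    they define map [X2b] to [Xb]. *)
Definition tribound2 m (L : R) := forall k1 k2 k3,
  normc (m k1 k2 k3) <= L * (rho k1 * rho k2 * rho k3) ^+ 2.

Lemma rho2_ge1 k : 1 <= rho k ^+ 2 :> R.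
Proof. by rewrite expr_ge1// ?rho_ge1// rho_ge0. Qed.

Lemma rho2_ge0 k : 0 <= rho k ^+ 2 :> R.
Proof. exact: sqr_ge0. Qed.

Lemma rho2normc_ge0 a k : 0 <= rho k ^+ 2 * normc (a k).
Proof. by rewrite mulr_ge0 ?sqr_ge0 ?normc_ge0. Qed.

Lemma Xb_asum a B : Xb a B -> (asum a < +oo)%E.
Proof. by move=> h; apply: le_lt_trans (XN_sum h) _; rewrite ltry. Qed.

Lemma X2b_Xb a B : X2b a B -> Xb a B.
Proof. by apply: XN_le => k; rewrite ler_peMl ?rho2_ge1// normc_ge0. Qed.

Lemma Xb_ge0 a B : Xb a B -> 0 <= B.
Proof. by move=> h; apply: (XN_ge0 _ h) => k; exact: normc_ge0. Qed.

Lemma X2b_ge0 a B : X2b a B -> 0 <= B.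
Proof. by move=> h; apply: (XN_ge0 _ h) => k; exact: rho2normc_ge0. Qed.

Lemma Xb_cflip a B : Xb a B -> Xb (cflip a) B.
Proof.
by move/XN_opp; apply: XN_le => k; rewrite /cflip normc_conj.
Qed.

Lemma X2b_cflip a B : X2b a B -> X2b (cflip a) B.
Proof.
by move/XN_opp; apply: XN_le => k; rewrite /cflip normc_conj rhoN.
Qed.

Lemma Xb0 : Xb (fun=> 0) 0.
Proof. by move=> g _; rewrite esum1// => k _; rewrite normc0 mulr0. Qed.

Lemma X2b0 : X2b (fun=> 0) 0.
Proof. by move=> g _; rewrite esum1// => k _; rewrite normc0 !mulr0. Qed.

Lemma XbB a b A B : Xb a A -> Xb b B -> Xb (fun k => a k - b k) (A + B).
Proof.
move=> HA HB; apply: (XN_le (b := fun k => normc (a k) + normc (b k))) (XN_add (fun k => normc_ge0 (a k)) (fun k => normc_ge0 (b k)) HA HB) => k.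
exact: normcB.
Qed.

Lemma XbD a b A B : Xb a A -> Xb b B -> Xb (fun k => a k + b k) (A + B).
Proof.
move=> HA HB; apply: (XN_le (b := fun k => normc (a k) + normc (b k))) (XN_add (fun k => normc_ge0 (a k)) (fun k => normc_ge0 (b k)) HA HB) => k.
exact: normcD.
Qed.

Lemma Xb_mul a (z : K -> C) L A : 0 <= L -> (forall k, normc (z k) <= L) ->
  Xb a A -> Xb (fun k => z k * a k) (L * A).
Proof.
move=> L0 zL HA; apply: (XN_le (b := fun k => L * normc (a k))) (XN_scale L0 (fun k => normc_ge0 (a k)) HA) => k.
by rewrite normcM ler_wpM2r// normc_ge0.
Qed.

Lemma X2b_mul a (z : K -> C) L A : 0 <= L -> (forall k, normc (z k) <= L) ->
  X2b a A -> X2b (fun k => z k * a k) (L * A).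
Proof.
move=> L0 zL HA; apply: (XN_le (b := fun k => L * (rho k ^+ 2 * normc (a k)))) (XN_scale L0 (rho2normc_ge0 a) HA) => k.
by rewrite mulrCA ler_wpM2l ?rho2_ge0// normcM ler_wpM2r// normc_ge0.
Qed.

Lemma Xb_le a B B' : Xb a B -> B <= B' -> Xb a B'.
Proof. by move=> h BB; exact: XN_leB BB h. Qed.

Lemma X2b_le a B B' : X2b a B -> B <= B' -> X2b a B'.
Proof. by move=> h BB; exact: XN_leB BB h. Qed.

Lemma Xb_tri m a b c L A B G : 0 <= L -> tribound m L ->
  Xb a A -> Xb b B -> Xb c G -> Xb (tri m a b c) (3 * (L * (A * (B * G)))).
Proof.
move=> L0 mL HA HB HG.
have := XN_tri (w := fun=> 1) (fun=> ler01) L0 (fun k => normc_ge0 (a k))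
  (fun k => normc_ge0 (b k)) (fun k => normc_ge0 (c k)) _ HA HB HG.
move=> /(_ m a b c) H; apply: XN_le (H _) => [k|k1 k2 k3]; first by rewrite mul1r.
by rewrite mul1r -mulrA ler_wpM2r ?mulr_ge0 ?normc_ge0.
Qed.

(** The stronger norm is an algebra too: by submultiplicativity the weight [rho ^+ 2] at the output
    distributes over all three factors. *)
Lemma X2b_tri m a b c L A B G : 0 <= L -> tribound m L ->
  X2b a A -> X2b b B -> X2b c G -> X2b (tri m a b c) (3 * (L * (A * (B * G)))).
Proof.
move=> L0 mL HA HB HG.
have := XN_tri (w := fun k => rho k ^+ 2) rho2_ge0 L0 (rho2normc_ge0 a)
  (rho2normc_ge0 b) (rho2normc_ge0 c) _ HA HB HG.
move=> /(_ m a b c); apply=> k1 k2 k3.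
set x := normc (a _); set y := normc (b _); set z := normc (c _).
have -> : L * (rho k1 ^+ 2 * x * (rho k2 ^+ 2 * y * (rho k3 ^+ 2 * z))) =
  (rho k1 * rho k2 * rho k3) ^+ 2 * (L * (x * y * z)) by ring.
apply: ler_pM; rewrite ?sqr_ge0 ?mulr_ge0 ?normc_ge0//; last by rewrite ler_wpM2r ?mulr_ge0 ?normc_ge0.
rewrite ler_pXn2r ?nnegrE ?mulr_ge0 ?rho_ge0//.
by apply: le_trans (rhoM _ _) _; rewrite ler_wpM2r ?rho_ge0 ?rhoM.
Qed.

Lemma Xb_tri2 m a b c L A B G : 0 <= L -> tribound2 m L ->
  X2b a A -> X2b b B -> X2b c G -> Xb (tri m a b c) (3 * (L * (A * (B * G)))).
Proof.
move=> L0 mL HA HB HG.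
have := XN_tri (w := fun k => 1) (fun=> ler01) L0 (rho2normc_ge0 a)
  (rho2normc_ge0 b) (rho2normc_ge0 c) _ HA HB HG.
move=> /(_ m a b c) H; apply: XN_le (H _) => [k|k1 k2 k3]; first by rewrite mul1r.
rewrite mul1r; set x := normc (a _); set y := normc (b _); set z := normc (c _).
have -> : L * (rho k1 ^+ 2 * x * (rho k2 ^+ 2 * y * (rho k3 ^+ 2 * z))) =
  (L * (rho k1 * rho k2 * rho k3) ^+ 2) * (x * y * z) by ring.
by rewrite ler_wpM2r ?mulr_ge0 ?normc_ge0.
Qed.

Definition tri_term m a b c k (p : K * K) : C :=
  m p.1 p.2 (k - p.1 - p.2) * (a p.1 * b p.2 * c (k - p.1 - p.2)).

(** Summability jointly in the output frequency and the two free ones, which justifies linearity of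
    [tri] and the exchanges of sums. *)
Lemma asum_tri_le m a b c L (al be ga : K -> R) : 0 <= L ->
  (forall k, 0 <= al k) -> (forall k, 0 <= be k) -> (forall k, 0 <= ga k) ->
  (es al < +oo)%E -> (es be < +oo)%E -> (es ga < +oo)%E ->
  (forall k1 k2 k3, normc (m k1 k2 k3) *
     (normc (a k1) * normc (b k2) * normc (c k3)) <=
     L * (al k1 * (be k2 * ga k3))) ->
  (\esum_(k in [set: K]) asum (tri_term m a b c k) < +oo)%E.
Proof.
move=> L0 a0 b0 g0 sa sb sc H.
have H1 : (\esum_(k in [set: K]) (1%:E * asum (tri_term m a b c k)) <= L%:E *
   \esum_(k1 in [set: K]) \esum_(k2 in [set: K]) \esum_(k3 in [set: K])
     (1 * (al k1 * (be k2 * ga k3)))%:E)%E.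
  apply: (@tri_majorant R d m a b c (fun=> 1)) => // k1 k2 k3; by rewrite !mul1r.
apply: (@le_lt_trans _ _ (L%:E * (fine (es al) * (fine (es be) * fine (es ga)))%:E)%E).
  apply: (le_trans (y := _) _ (le_trans H1 _)).
    by apply: le_esum => k _; rewrite mul1e.
  rewrite lee_wpmul2l ?lee_fin//.
  under eq_esum do under eq_esum do under eq_esum do rewrite mul1r.
  by apply: nest_le => //; rewrite ?fineK_es// => *; rewrite fineK_es.
by rewrite -EFinM ltry.
Qed.

Lemma tri_fin m a b c L k : tribound m L ->
  (asum a < +oo)%E -> (asum b < +oo)%E -> (asum c < +oo)%E ->
  (asum (tri_term m a b c k) < +oo)%E.
Proof.
move=> mL sa sb sc.
have L0 : 0 <= L by apply: le_trans (normc_ge0 _) (mL 0 0 0).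
apply: le_lt_trans (@asum_tri_le m a b c L (fun k => normc (a k)) (fun k => normc (b k))
  (fun k => normc (c k)) L0 (fun k => normc_ge0 (a k)) (fun k => normc_ge0 (b k))
  (fun k => normc_ge0 (c k)) sa sb sc _) => //; last first.
  by move=> k1 k2 k3; rewrite -!mulrA; apply: ler_wpM2r; rewrite ?mulr_ge0 ?normc_ge0.
by apply: (@esum_ub R K (fun k => asum (tri_term m a b c k))) => i; exact: asum_ge0.
Qed.

Definition l1 a := (asum a < +oo)%E.

Lemma l1B a b : l1 a -> l1 b -> l1 (fun k => a k - b k).
Proof.
by move=> la lb; apply: (@asumD_fin R K a (fun k => - b k)) => //; rewrite asumN.
Qed.

Lemma l1_cflip a : l1 a -> l1 (cflip a).
Proof.
apply: le_lt_trans; rewrite /asum -[leRHS]esum_opp; apply: le_es => k.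
by rewrite /cflip normc_conj.
Qed.

Lemma cflipB a b : cflip (fun k => a k - b k) = (fun k => cflip a k - cflip b k).
Proof. by apply/funext => k; rewrite /cflip rmorphB. Qed.

Lemma tri_subl m L a a' b c k : tribound m L -> l1 a -> l1 a' -> l1 b -> l1 c ->
  tri m (fun k => a k - a' k) b c k = tri m a b c k - tri m a' b c k.
Proof.
move=> mL la la' lb lc; rewrite /tri -csumB; [|exact: (tri_fin _ mL)..].
by congr csum; apply/funext => p; ring.
Qed.

Lemma tri_subm m L a b b' c k : tribound m L -> l1 a -> l1 b -> l1 b' -> l1 c ->
  tri m a (fun k => b k - b' k) c k = tri m a b c k - tri m a b' c k.
Proof.
move=> mL la lb lb' lc; rewrite /tri -csumB; [|exact: (tri_fin _ mL)..].
by congr csum; apply/funext => p; ring.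
Qed.

Lemma tri_subr m L a b c c' k : tribound m L -> l1 a -> l1 b -> l1 c -> l1 c' ->
  tri m a b (fun k => c k - c' k) k = tri m a b c k - tri m a b c' k.
Proof.
move=> mL la lb lc lc'; rewrite /tri -csumB; [|exact: (tri_fin _ mL)..].
by congr csum; apply/funext => p; ring.
Qed.

Lemma tri_subsym m m' L L' a b c k : tribound m L -> tribound m' L' -> l1 a -> l1 b -> l1 c ->
  tri (fun k1 k2 k3 => m k1 k2 k3 - m' k1 k2 k3) a b c k = tri m a b c k - tri m' a b c k.
Proof.
move=> mL mL' la lb lc; rewrite /tri -csumB; [|exact: (tri_fin _ mL)|exact: (tri_fin _ mL')].
by congr csum; apply/funext => p; ring.
Qed.

Lemma tri_addsym m m' L L' a b c k : tribound m L -> tribound m' L' -> l1 a -> l1 b -> l1 c ->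
  tri (fun k1 k2 k3 => m k1 k2 k3 + m' k1 k2 k3) a b c k = tri m a b c k + tri m' a b c k.
Proof.
move=> mL mL' la lb lc; rewrite /tri -csumD; [|exact: (tri_fin _ mL)|exact: (tri_fin _ mL')].
by congr csum; apply/funext => p; ring.
Qed.

Lemma tri_scale m L z a b c k : tribound m L -> l1 a -> l1 b -> l1 c ->
  tri (fun k1 k2 k3 => z * m k1 k2 k3) a b c k = z * tri m a b c k.
Proof.
move=> mL la lb lc; rewrite /tri -csumZ; last exact: (tri_fin _ mL).
by congr csum; apply/funext => p; ring.
Qed.

Lemma tri_outer m L (z : K -> C) a b c k : tribound m L -> l1 a -> l1 b -> l1 c ->
  tri (fun k1 k2 k3 => z (k1 + k2 + k3) * m k1 k2 k3) a b c k = z k * tri m a b c k.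
Proof.
move=> mL la lb lc; rewrite /tri -csumZ; last exact: (tri_fin _ mL).
by congr csum; apply/funext => -[k1 k2] /=; rewrite addk3K; ring.
Qed.

Lemma tri_inner m (x y z : K -> C) a b c k :
  tri m (fun k => x k * a k) (fun k => y k * b k) (fun k => z k * c k) k =
  tri (fun k1 k2 k3 => m k1 k2 k3 * (x k1 * y k2 * z k3)) a b c k.
Proof. by congr csum; apply/funext => p; ring. Qed.

Lemma tri_eqsym m m' : (forall k1 k2 k3, m k1 k2 k3 = m' k1 k2 k3) -> tri m = tri m'.
Proof.
by move=> E; congr tri; apply/funext => k1; apply/funext => k2; apply/funext => k3.
Qed.

Lemma tribound1 : tribound (fun _ _ _ => 1) 1.
Proof. by move=> *; rewrite normc1. Qed.

Lemma l1_tri m L a b c : tribound m L -> l1 a -> l1 b -> l1 c -> l1 (tri m a b c).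
Proof.
move=> mL la lb lc; have L0 : 0 <= L by apply: le_trans (normc_ge0 _) (mL 0 0 0).
apply: le_lt_trans (@asum_tri_le m a b c L (fun k => normc (a k)) (fun k => normc (b k))
  (fun k => normc (c k)) L0 (fun k => normc_ge0 _) (fun k => normc_ge0 _) (fun k => normc_ge0 _) la lb lc _).
  by apply: le_esum => k _; exact: normc_csum.
by move=> k1 k2 k3; rewrite -!mulrA; apply: ler_wpM2r; rewrite ?mulr_ge0 ?normc_ge0.
Qed.

Local Notation cubic m a := (tri m a a (cflip a)).

(** Telescoping: one of the three arguments is replaced at a time. *)
Lemma cubic_sub m L a b k : tribound m L -> l1 a -> l1 b ->
  cubic m a k - cubic m b k =
  tri m (fun k => a k - b k) a (cflip a) k + tri m b (fun k => a k - b k) (cflip a) k +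
  tri m b b (fun k => cflip a k - cflip b k) k.
Proof.
move=> mL la lb; have lca := l1_cflip la; have lcb := l1_cflip lb.
by rewrite (tri_subl _ mL) // (tri_subm _ mL)// (tri_subr _ mL)//; ring.
Qed.

Lemma Xb_cubic_sub m L a b B D : 0 <= L -> tribound m L -> Xb a B -> Xb b B ->
  Xb (fun k => a k - b k) D ->
  Xb (fun k => cubic m a k - cubic m b k) (9 * (L * (B ^+ 2 * D))).
Proof.
move=> L0 mL HA HB HD.
have HD' : Xb (fun k => cflip a k - cflip b k) D by rewrite -cflipB; exact: Xb_cflip.
rewrite (funext (fun k => cubic_sub k mL (Xb_asum HA) (Xb_asum HB))).
have H := (XbD (XbD (Xb_tri L0 mL HD HA (Xb_cflip HA)) (Xb_tri L0 mL HB HD (Xb_cflip HA)))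
  (Xb_tri L0 mL HB HB HD')).
apply: (Xb_le H).
by apply: le_of_eq; ring.
Qed.

End Sequences.

(** * Differentiation under an infinite sum *)

Section TaylorDerivatives.
Context {R : realType}.
Local Notation C := R[i].
Local Notation es f := (\esum_(i in [set: _]) (f i)%:E)%E.

Lemma is_derive_taylor (h : R -> R) (s l M : R) :
  (forall t, `|h t - h s - (t - s) * l| <= M * (t - s) ^+ 2) -> is_derive s 1 h l.
Proof.
move=> H.
have M0 : 0 <= M.
  have := H (s + 1); rewrite (_ : s + 1 - s = 1); last by ring.
  by rewrite expr1n mulr1; apply: le_trans.
have cv : (fun r : R => r^-1 *: ((h \o shift s) (r *: 1) - h s)) @ 0^' --> l.
  apply/cvgrPdist_le => e e0; near=> r.
  have r0 : r != 0 by near: r; exact: nbhs_dnbhs_neq.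
  have re : `|r| <= e / (M + 1).
    by near: r; apply: dnbhs0_le; rewrite divr_gt0// ltr_wpDl.
  have := H (r + s); rewrite addrK => Hr.
  rewrite /= /GRing.scale /= mulr1.
  have -> : l - r^-1 * (h (r + s) - h s) = - (r^-1 * (h (r + s) - h s - r * l)).
    by field.
  rewrite normrN normrM normfV ler_pdivrMl ?normr_gt0//.
  apply: le_trans Hr _; rewrite -real_normK ?num_real// expr2 mulrCA ler_wpM2l//.
  apply: le_trans (_ : (M + 1) * `|r| <= _); first by rewrite ler_wpM2r// lerDl.
  by rewrite mulrC -ler_pdivlMr// ltr_wpDl.
have dh : derivable h s 1 by apply/cvg_ex; exists l.
by apply: DeriveDef => //; exact/cvg_lim.
Unshelve. all: by end_near.
Qed.

(** A summable quadratic remainder stands in for uniform convergence of the derivatives: the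
    remainder bound passes to the sum, and a quadratic remainder forces differentiability. *)
Lemma csum_derive (T : choiceType) (F : R -> T -> C) (F' : T -> C) (M : T -> R) (s : R) :
  (forall t, (asum (F t) < +oo)%E) -> (asum F' < +oo)%E ->
  (forall i, 0 <= M i) -> (es M < +oo)%E ->
  (forall t i, normc (F t i - F s i - (t - s)%:C * F' i) <= M i * (t - s) ^+ 2) ->
  is_cderive (fun t => csum (F t)) s (csum F').
Proof.
move=> sF sF' M0 sM H.
have key t : normc (csum (F t) - csum (F s) - (t - s)%:C * csum F') <= fine (es M) * (t - s) ^+ 2.
  have sN (f : T -> C) : (asum f < +oo)%E -> (asum (fun i => - f i)%R < +oo)%E by rewrite asumN.
  have sB : (asum (fun i => F t i - F s i)%R < +oo)%E by apply: asumD_fin; [exact: sF|exact/sN/sF].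
  rewrite -(csumZ (t - s)%:C sF') -(csumB (sF t) (sF s)) -(csumB sB (asumZ_fin _ sF')).
  rewrite -lee_fin; apply: le_trans (normc_csum _) _.
  rewrite mulrC EFinM fineK_es// -esZ ?sqr_ge0//.
  by apply: le_es => i; rewrite [leRHS]mulrC.
split; apply: (@is_derive_taylor _ _ _ (fine (es M))) => t; apply: le_trans (key t).
  apply: le_trans (normRe_le _); rewrite !cReD !cReN cReM /=.
  by rewrite mul0r subr0.
apply: le_trans (normIm_le _); rewrite !cImD !cImN cImM /=.
by rewrite mul0r addr0.
Qed.

End TaylorDerivatives.

(** * Time derivatives and second differences of trilinear forms *)

Section TrilinearEstimates.
Context {R : realType} {d : nat}.
Local Notation C := R[i].
Local Notation K := 'rV[int]_d.
Implicit Types (a b c v : K -> C) (m : K -> K -> K -> C) (k : K).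
Local Notation cubic m a := (tri m a a (cflip a)).

Lemma X2b_fin a B : X2b a B -> (\esum_(k in [set: K]) (rho k ^+ 2 * normc (a k))%:E < +oo)%E.
Proof. by move=> h; apply: le_lt_trans (XN_sum h) _; rewrite ltry. Qed.

Lemma tri_derive (Q : R -> K -> K -> K -> C) (Q' : K -> K -> K -> C) a b c A B G L L' s k :
  0 <= L -> (forall t, exists Lt, tribound (Q t) Lt) -> tribound Q' L' ->
  X2b a A -> X2b b B -> X2b c G ->
  (forall t k1 k2 k3, normc (Q t k1 k2 k3 - Q s k1 k2 k3 - (t - s)%:C * Q' k1 k2 k3) <=
     L * (rho k1 * rho k2 * rho k3) ^+ 2 * (t - s) ^+ 2) ->
  is_cderive (fun t => tri (Q t) a b c k) s (tri Q' a b c k).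
Proof.
move=> L0 Qb Q'b HA HB HG HQ.
have la := Xb_asum (X2b_Xb HA); have lb := Xb_asum (X2b_Xb HB); have lc := Xb_asum (X2b_Xb HG).
pose m k1 k2 k3 : C := (L * (rho k1 * rho k2 * rho k3) ^+ 2)%:C.
have nm k1 k2 k3 : normc (m k1 k2 k3) = L * (rho k1 * rho k2 * rho k3) ^+ 2.
  by rewrite normc_real ger0_norm// mulr_ge0// sqr_ge0.
apply: (csum_derive (F := fun t => tri_term (Q t) a b c k) (F' := tri_term Q' a b c k)
  (M := fun p => normc (tri_term m a b c k p))).
- by move=> t; have [Lt Ht] := Qb t; exact: tri_fin Ht _ _ _.
- exact: tri_fin Q'b _ _ _.
- by move=> p; exact: normc_ge0.
- have := @asum_tri_le R d m a b c L (fun k => rho k ^+ 2 * normc (a k))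
    (fun k => rho k ^+ 2 * normc (b k)) (fun k => rho k ^+ 2 * normc (c k)) L0
    (rho2normc_ge0 a) (rho2normc_ge0 b) (rho2normc_ge0 c) (X2b_fin HA) (X2b_fin HB) (X2b_fin HG).
  move=> H; apply: le_lt_trans (H _).
    by apply: (@esum_ub R K (fun k => asum (tri_term m a b c k))) => i; exact: asum_ge0.
  by move=> k1 k2 k3; rewrite nm; apply: le_of_eq; ring.
- move=> t [k1 k2]; rewrite /tri_term /=.
  set k3 := k - k1 - k2; set x := a k1 * b k2 * c k3.
  have -> : Q t k1 k2 k3 * x - Q s k1 k2 k3 * x - (t - s)%:C * (Q' k1 k2 k3 * x) =
    (Q t k1 k2 k3 - Q s k1 k2 k3 - (t - s)%:C * Q' k1 k2 k3) * x by ring.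
  rewrite normcM [normc (_ * x)]normcM nm [leRHS]mulrAC.
  by rewrite ler_wpM2r// normc_ge0.
Qed.

(** Second difference of the cubic term along [b], [v], [a]. Terms linear in the increments combine
    into the second difference of the arguments, of size [P]; the others contain at least two
    increments, whence [D ^+ 2]. The factors 9 and 18 stand for three and six trilinear terms, with
    3 from the algebra property. *)
Lemma Xb_cubic_second m L a b v B D P : 0 <= L -> tribound m L ->
  Xb a B -> Xb b B -> Xb v B ->
  Xb (fun k => a k - v k) D -> Xb (fun k => b k - v k) D ->
  Xb (fun k => (a k - v k) - (v k - b k)) P ->
  Xb (fun k => (cubic m a k - cubic m v k) - (cubic m v k - cubic m b k))
    (L * (9 * (P * B ^+ 2) + 18 * (D ^+ 2 * B))).
Proof.
move=> L0 mL HA HB HV HDa HDb HP.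
have la := Xb_asum HA; have lb := Xb_asum HB; have lv := Xb_asum HV.
have lca := l1_cflip la; have lcb := l1_cflip lb; have lcv := l1_cflip lv.
pose al k := a k - v k; pose be k := b k - v k; pose p k := (a k - v k) - (v k - b k).
have lal : l1 al by exact: l1B.
have lbe : l1 be by exact: l1B.
have lvb : l1 (fun k => v k - b k) by exact: l1B.
have lcvb : l1 (fun k => cflip v k - cflip b k) by exact: l1B.
have lcal : l1 (fun k => cflip a k - cflip v k) by exact: l1B.
have cal : cflip al = fun k => cflip a k - cflip v k by exact: cflipB.
have cbe : cflip be = fun k => cflip b k - cflip v k by exact: cflipB.
have cp : cflip p = fun k => (cflip a k - cflip v k) - (cflip v k - cflip b k).
  by rewrite /p cflipB !cflipB.
(* The terms of degree two and three in [de = w - v]; writing [w] instead of [v] in the first one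
   absorbs the term of degree three. *)
pose q (de w : K -> C) k := tri m de de (cflip w) k + tri m de v (cflip de) k + tri m v de (cflip de) k.
have E k : (cubic m a k - cubic m v k) - (cubic m v k - cubic m b k) =
  (tri m p v (cflip v) k + tri m v p (cflip v) k + tri m v v (cflip p) k) + (q al a k + q be b k).
  rewrite /q cp cal cbe.
  rewrite /p !(tri_subl _ mL, tri_subm _ mL, tri_subr _ mL)//; ring.
rewrite (funext E).
have Hq de w : Xb de D -> Xb w B -> Xb (q de w) (9 * (L * (D ^+ 2 * B))).
  move=> Hde Hw.
  have H := XbD (XbD (Xb_tri L0 mL Hde Hde (Xb_cflip Hw)) (Xb_tri L0 mL Hde HV (Xb_cflip Hde)))
   (Xb_tri L0 mL HV Hde (Xb_cflip Hde)).
  by apply: (Xb_le H); apply: le_of_eq; ring.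
have H := XbD (XbD (XbD (Xb_tri L0 mL HP HV (Xb_cflip HV)) (Xb_tri L0 mL HV HP (Xb_cflip HV)))
  (Xb_tri L0 mL HV HV (Xb_cflip HP))) (XbD (Hq _ _ HDa HA) (Hq _ _ HDb HB)).
by apply: (Xb_le H); apply: le_of_eq; ring.
Qed.

End TrilinearEstimates.

(** * Local error *)

Section LocalError.
Context {R : realType} {d : nat} (mu : R).
Local Notation C := R[i].
Local Notation K := 'rV[int]_d.
Implicit Types (a b c v : K -> C) (m : K -> K -> K -> C) (k : K).
Local Notation cubic m a := (tri m a a (cflip a)).
Local Notation nu := (`|mu|).

Definition psi k1 k2 k3 : R :=
  freq_sq (k1 + k2 + k3) - freq_sq k1 - freq_sq k2 - freq_sq k3.
(** This is |k|^2 - |k1|^2 - |k2|^2 + |k3|^2 with [k = k1 + k2 + k3], the phase of the nonlinearity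
    in the interaction picture; the last sign comes from the conjugated factor. *)
Definition phase k1 k2 k3 : R := psi k1 k2 k3 + 2 * freq_sq k3.
Definition osc (s : R) k1 k2 k3 : C := expi (phase k1 k2 k3 * s).

Lemma psiE k1 k2 k3 : psi k1 k2 k3 = 2 * (dotk k1 k2 + dotk k1 k3 + dotk k2 k3).
Proof. by rewrite /psi !freq_sqD dotkDl; ring. Qed.

Lemma norm_psi k1 k2 k3 : `|psi k1 k2 k3| <= 6 * (rho k1 * rho k2 * rho k3).
Proof.
rewrite psiE normrM ger0_norm//.
have H1 := @norm_dotk R d k1 k2; have H2 := @norm_dotk R d k1 k3; have H3 := @norm_dotk R d k2 k3.
have r1 := @rho_ge1 R d k1; have r2 := @rho_ge1 R d k2; have r3 := @rho_ge1 R d k3.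
have := ler_normD (dotk k1 k2 + dotk k1 k3) (dotk k2 k3 : R).
have := ler_normD (dotk k1 k2) (dotk k1 k3 : R).
have A1 : rho k1 * rho k2 <= rho k1 * rho k2 * rho k3 :> R.
  by rewrite ler_peMr// mulr_ge0 ?rho_ge0.
have A2 : rho k1 * rho k3 <= rho k1 * rho k2 * rho k3 :> R.
  by rewrite mulrAC ler_peMr// mulr_ge0 ?rho_ge0.
have A3 : rho k2 * rho k3 <= rho k1 * rho k2 * rho k3 :> R.
  by rewrite -mulrA ler_peMl// mulr_ge0 ?rho_ge0.
lra.
Qed.

Lemma rho3_ge1 k1 k2 k3 : 1 <= rho k1 * rho k2 * rho k3 :> R.
Proof. by rewrite !mulr_ege1// rho_ge1. Qed.

Lemma sqr_psi k1 k2 k3 : psi k1 k2 k3 ^+ 2 <= 36 * (rho k1 * rho k2 * rho k3) ^+ 2.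
Proof.
rewrite -real_normK ?num_real//.
have -> : 36 * (rho k1 * rho k2 * rho k3) ^+ 2 = (6 * (rho k1 * rho k2 * rho k3)) ^+ 2 :> R by ring.
by rewrite ler_pXn2r ?nnegrE ?mulr_ge0 ?rho_ge0// norm_psi.
Qed.

(** The constant is [6 + 2]: the part [psi] is linear in the product of the three [rho], and only
    [2 |k3|^2] requires its square. *)
Lemma norm_phase k1 k2 k3 : `|phase k1 k2 k3| <= 8 * (rho k1 * rho k2 * rho k3) ^+ 2.
Proof.
have H1 := norm_psi k1 k2 k3; have H0 := rho3_ge1 k1 k2 k3.
have H2 : freq_sq k3 <= (rho k1 * rho k2 * rho k3) ^+ 2 :> R.
  apply: le_trans (freq_sq_le k3) _; rewrite ler_pXn2r ?nnegrE ?mulr_ge0 ?rho_ge0//.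
  by rewrite ler_peMl ?rho_ge0// mulr_ege1// rho_ge1.
have H3 := @freq_sq_ge0 R d k3.
apply: le_trans (ler_normD _ _) _; rewrite [`|2 * _|]ger0_norm ?mulr_ge0//.
set x := rho k1 * _ * _ in H0 H1 H2 *; have : x <= x ^+ 2 by rewrite expr2 ler_peMl// (le_trans _ H0).
lra.
Qed.

Lemma tribound_osc s : tribound (osc s) 1.
Proof. by move=> k1 k2 k3; rewrite normc_expi. Qed.

Lemma tribound2_osc s t : tribound2 (fun k1 k2 k3 => osc s k1 k2 k3 - osc t k1 k2 k3) (8 * `|s - t|).
Proof.
move=> k1 k2 k3; apply: le_trans (normc_expiB _ _ _) _.
by rewrite mulrAC ler_wpM2r// norm_phase.
Qed.

(* [W] is the interaction picture [s |-> e^(- i sg s Delta) u(t + sg s)] of the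
   exact solution, run forward ([sg = 1]) or backward ([sg = -1]). *)
Definition halfflow (sg B tau : R) (W : R -> K -> C) : Prop :=
  [/\ forall k, ccont (fun s => W s k),
      forall s, 0 <= s <= tau -> X2b (W s) B &
      forall s, 0 < s < tau -> forall k, is_cderive (fun s => W s k) s
        (- 'i%C * (sg * mu)%:C * cubic (osc (sg * s)) (W s) k)].

Lemma normc_imu sg : `|sg| = 1 -> normc (- 'i%C * (sg * mu)%:C : C) = nu.
Proof. by move=> sg1; rewrite normcM normcN normc_i normc_real normrM sg1 !mul1r. Qed.

Definition lip_cst (B : R) := nu * (3 * B ^+ 3).

(** The symbol [osc] has modulus 1, so the algebra property bounds the velocity of [W] in the strong
    norm: the interaction picture is Lipschitz in time without loss of derivatives. *)
Lemma halfflow_lip sg B tau W s : `|sg| = 1 -> halfflow sg B tau W -> 0 <= s <= tau ->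
  X2b (fun k => W s k - W 0 k) (s * lip_cst B).
Proof.
move=> sg1 [Wc WB WD] /andP[]; rewrite le_eqVlt => /predU1P[<-|s0] st.
  rewrite mul0r; have -> : (fun k => W 0 k - W 0 k) = fun=> 0.
    by apply/funext => k; rewrite subrr.
  exact: X2b0.
have := XN_MVT (w := fun k => rho k ^+ 2) (f := W)
  (f' := fun s k => - 'i%C * (sg * mu)%:C * cubic (osc (sg * s)) (W s) k) (B := lip_cst B) s0
  (@rho2_ge0 R d) Wc.
rewrite subr0; apply => r /andP[r0 rs]; first by apply: WD; rewrite r0 (lt_le_trans rs st).
have rt : 0 <= r <= tau by rewrite (ltW r0) (ltW (lt_le_trans rs st)).
have H := X2b_tri ler01 (tribound_osc (sg * r)) (WB r rt) (WB r rt) (X2b_cflip (WB r rt)).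
have := X2b_mul (normr_ge0 mu) (fun k => _) H => /(_ (fun=> - 'i%C * (sg * mu)%:C)).
move=> /(_ (fun _ => _))/X2b_le; apply; last by rewrite /lip_cst; lra.
by rewrite normc_imu.
Qed.

(** Here [48 = 3 * 8 * 2] comes from the change of [osc] between [r] and [- r], and [18 = 9 * 2]
    from the distance between the two half flows. *)
Definition symm_cst (B : R) := nu * (48 * B ^+ 3 + 18 * (B ^+ 2 * lip_cst B)).

Lemma halfflow_B_ge0 sg B tau W : 0 <= tau -> halfflow sg B tau W -> 0 <= B.
Proof.
by move=> t0 [_ WB _]; apply: (X2b_ge0 (a := W 0)); apply: WB; rewrite lexx.
Qed.

(** Both half flows start from the same state with opposite velocities, so the derivative of
    [Wp + Wm] is a difference of nonlinearities that vanishes at time 0 and is O(r). A single phase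
    difference is paid for in derivatives, and [W] is never differentiated twice in time. *)
Lemma halfflow_symm B tau Wp Wm s : halfflow 1 B tau Wp -> halfflow (-1) B tau Wm ->
  Wp 0 = Wm 0 -> 0 < s <= tau ->
  Xb (fun k => (Wp s k - Wp 0 k) - (Wp 0 k - Wm s k)) (s * (s * symm_cst B)).
Proof.
move=> Hp Hm W0 /andP[s0 st].
have [Pc PB PD] := Hp; have [Mc MB MD] := Hm.
have B0 : 0 <= B by apply: halfflow_B_ge0 Hp; exact: le_trans (ltW s0) st.
pose f r k := Wp r k + Wm r k.
have -> : (fun k => (Wp s k - Wp 0 k) - (Wp 0 k - Wm s k)) = (fun k => f s k - f 0 k).
  by apply/funext => k; rewrite /f -W0; ring.
have := XN_MVT (w := fun k => 1) (f := f)
  (f' := fun r k => - 'i%C * (1 * mu)%:C * cubic (osc (1 * r)) (Wp r) k +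
     - 'i%C * (-1 * mu)%:C * cubic (osc (-1 * r)) (Wm r) k) (B := s * symm_cst B) s0
  (fun=> ler01).
rewrite subr0 => H; apply: XN_le (H _ _ _); first by move=> k; rewrite mul1r.
- by move=> k; exact: ccontD (Pc k) (Mc k).
- move=> r /andP[r0 rs] k; have rt : 0 < r < tau by rewrite r0 (lt_le_trans rs st).
  by apply: is_cderiveD; [exact: PD|exact: MD].
move=> r /andP[r0 rs].
have rt : 0 <= r <= tau by rewrite (ltW r0) (ltW (lt_le_trans rs st)).
have XP := PB r rt; have XM := MB r rt.
have lP := Xb_asum (X2b_Xb XP); have lcP := l1_cflip lP.
pose mm k1 k2 k3 := osc r k1 k2 k3 - osc (- r) k1 k2 k3.
(* Change of symbol at fixed argument, plus change of argument at fixed symbol. *)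
have E k : - 'i%C * (1 * mu)%:C * cubic (osc (1 * r)) (Wp r) k +
     - 'i%C * (-1 * mu)%:C * cubic (osc (-1 * r)) (Wm r) k =
   (- 'i%C * (1 * mu)%:C) * (cubic mm (Wp r) k +
      (cubic (osc (- r)) (Wp r) k - cubic (osc (- r)) (Wm r) k)).
  rewrite mul1r mulN1r (tri_subsym _ (tribound_osc _) (tribound_osc _))//.
  rewrite mul1r mulN1r rmorphN /=; ring.
have := Xb_tri2 _ (tribound2_osc r (- r)) XP XP (X2b_cflip XP).
rewrite mulr_ge0// opprK => /(_ isT) H1.
have HD : Xb (fun k => Wp r k - Wm r k) (r * lip_cst B + r * lip_cst B).
  have -> : (fun k => Wp r k - Wm r k) = fun k => (Wp r k - Wp 0 k) - (Wm r k - Wm 0 k).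
    by apply/funext => k; rewrite -W0; ring.
  apply: XbB; apply: X2b_Xb; first by apply: halfflow_lip Hp rt; rewrite normr1.
  by apply: halfflow_lip Hm rt; rewrite normrN1.
have H2 := Xb_cubic_sub ler01 (tribound_osc (- r)) (X2b_Xb XP) (X2b_Xb XM) HD.
have H3 := Xb_mul (z := fun=> - 'i%C * (1 * mu)%:C) (normr_ge0 mu) _ (XbD H1 H2).
apply: XN_le (Xb_le (H3 _) _) => [k||].
- by rewrite mul1r E.
- by move=> k; rewrite normc_imu// normr1.
have D10 : 0 <= lip_cst B by rewrite mulr_ge0// mulr_ge0// exprn_ge0.
rewrite [`|r + r|]ger0_norm ?addr_ge0 ?(ltW r0)//.
apply: le_trans (_ : r * symm_cst B <= _).
  by apply: le_of_eq; rewrite /symm_cst; ring.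
rewrite ler_wpM2r ?(ltW rs)//.
by rewrite /symm_cst mulr_ge0// addr_ge0 ?mulr_ge0 ?exprn_ge0.
Qed.

End LocalError.

Section LocalErrorSteps.
Context {R : realType} {d : nat} (mu : R).
Local Notation C := R[i].
Local Notation K := 'rV[int]_d.
Implicit Types (a b c v : K -> C) (m : K -> K -> K -> C) (k : K).
Local Notation cubic m a := (tri m a a (cflip a)).
Local Notation nu := (`|mu|).
Local Notation lip_cst := (lip_cst mu).
Local Notation symm_cst := (symm_cst mu).

Lemma normc_J1 (l t : R) : 0 < t -> normc (J1 l t) <= t.
Proof.
move=> t0; rewrite -[J1 l t]subr0 -(J1_0 l) -[leRHS]mul1r -[t in leRHS]subr0.
by apply: (normc_MVT t0 (J1_derive l)) => s _; rewrite normc_expi.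
Qed.

Lemma normc_J1_abs (l t : R) : normc (J1 l t) <= `|t|.
Proof.
have [t0|t0|->] := ltgtP t 0.
- rewrite -normcN -[- J1 l t]add0r -{1}(J1_0 l) ltr0_norm// -[leRHS]mul1r -[- t]add0r.
  by apply: (normc_MVT t0 (J1_derive l)) => s _; rewrite normc_expi.
- by rewrite gtr0_norm// normc_J1.
- by rewrite J1_0 normc0 normr0.
Qed.

Lemma Xb2_cubic_sub m L L' a b B D : 0 <= L -> tribound m L' -> tribound2 m L ->
  X2b a B -> X2b b B -> X2b (fun k => a k - b k) D ->
  Xb (fun k => cubic m a k - cubic m b k) (9 * (L * (B ^+ 2 * D))).
Proof.
move=> L0 mL' mL HA HB HD.
have HD' : X2b (fun k => cflip a k - cflip b k) D by rewrite -cflipB; exact: X2b_cflip.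
rewrite (funext (fun k => cubic_sub k mL' (Xb_asum (X2b_Xb HA)) (Xb_asum (X2b_Xb HB)))).
have H := (XbD (XbD (Xb_tri2 L0 mL HD HA (X2b_cflip HA)) (Xb_tri2 L0 mL HB HD (X2b_cflip HA)))
  (Xb_tri2 L0 mL HB HB HD')).
apply: (Xb_le H).
by apply: le_of_eq; ring.
Qed.

Lemma tri_zero a b c k : tri (fun _ _ _ => 0) a b c k = 0.
Proof.
rewrite /tri (_ : (fun p : K * K => _) = fun=> 0).
  by rewrite (csum_finite (F := [::])) ?big_nil.
by apply/funext => p; rewrite mul0r.
Qed.

Lemma tri_J1_0 (sg : R) a b c k :
  tri (fun k1 k2 k3 => J1 (sg * phase k1 k2 k3) 0) a b c k = 0.
Proof.
rewrite (@tri_eqsym R d _ (fun _ _ _ => 0)); first exact: tri_zero.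
by move=> k1 k2 k3; rewrite J1_0.
Qed.

(* Symbol of one half of the integrator: [sg = 1] for the quadrature over
   [0, tau], [sg = -1] for the one over [- tau, 0]. *)
Definition quad_symbol (sg tau : R) (k1 k2 k3 : K) : C :=
  let z : C := 'i%C * (sg * (2 * freq_sq k3) * tau)%:C in
  phi1 z - phi2 z + expi (tau * (sg * psi k1 k2 k3)) * phi2 z.

Lemma tribound_quad sg tau : tribound (quad_symbol sg tau) 3.
Proof.
move=> k1 k2 k3; rewrite /quad_symbol; set x := sg * _ * _.
apply: le_trans (normcD _ _) _; rewrite normcM normc_expi mul1r.
have := normcB (phi1 ('i%C * x%:C)) (phi2 ('i%C * x%:C)).
have := normc_phi1 x; have := normc_phi2 x; lra.
Qed.

Lemma quad_symbol_error sg tau : `|sg| = 1 -> 0 < tau ->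
  tribound2 (fun k1 k2 k3 => J1 (sg * phase k1 k2 k3) tau - tau%:C * quad_symbol sg tau k1 k2 k3)
    (72 * tau ^+ 3).
Proof.
move=> sg1 t0 k1 k2 k3; rewrite /phase mulrDr.
apply: le_trans (quadrature _ _ t0) _.
rewrite exprMn -(real_normK (num_real sg)) sg1 expr1n mul1r.
have := ler_wpM2l (_ : 0 <= 2 * tau ^+ 3) (sqr_psi k1 k2 k3 : psi k1 k2 k3 ^+ 2 <= _ :> R).
move=> H; apply: le_trans (_ : 2 * tau ^+ 3 * psi k1 k2 k3 ^+ 2 <= _); first by rewrite mulrA.
by apply: le_trans (H _) _; [rewrite mulr_ge0// exprn_ge0// ltW|apply: le_of_eq; ring].
Qed.

Lemma tribound_J1 (sg t : R) : tribound (fun k1 k2 k3 : K => J1 (sg * phase k1 k2 k3) t) `|t|.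
Proof. by move=> k1 k2 k3; exact: normc_J1_abs. Qed.

(** Replacing [osc] by its antiderivative gives the exact time integral of the nonlinearity frozen
    at [v], the quantity that the quadrature approximates. *)
Lemma tri_J1_derive sg v B s k : `|sg| = 1 -> X2b v B ->
  is_cderive (fun t => cubic (fun k1 k2 k3 => J1 (sg * phase k1 k2 k3) t) v k) s
    (cubic (osc (sg * s)) v k).
Proof.
move=> sg1 HV.
have := @tri_derive R d (fun t k1 k2 k3 => J1 (sg * phase k1 k2 k3) t) (osc (sg * s))
  v v (cflip v) B B B 8 1 s k.
move=> H; apply: (H _ _ _ HV HV (X2b_cflip HV)) => {H}//.
- by move=> t; exists `|t|; exact: tribound_J1.
- exact: tribound_osc.
move=> t k1 k2 k3; rewrite /osc mulrA [phase _ _ _ * sg]mulrC.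
apply: le_trans (J1_taylor _ _ _) _.
by rewrite ler_wpM2r ?sqr_ge0// normrM sg1 mul1r norm_phase.
Qed.

Lemma cubic_scale_quad sg tau (z : C) v k : l1 v ->
  cubic (fun k1 k2 k3 => z * quad_symbol sg tau k1 k2 k3) v k = z * cubic (quad_symbol sg tau) v k.
Proof. by move=> lv; rewrite (tri_scale _ _ (@tribound_quad sg tau))//; exact: l1_cflip. Qed.

Lemma Xb_quad_error sg tau v B : `|sg| = 1 -> 0 < tau -> X2b v B ->
  Xb (fun k => cubic (fun k1 k2 k3 => J1 (sg * phase k1 k2 k3) tau) v k
      - tau%:C * cubic (quad_symbol sg tau) v k) (tau ^+ 3 * (216 * B ^+ 3)).
Proof.
move=> sg1 t0 HV; have lv := Xb_asum (X2b_Xb HV); have lcv := l1_cflip lv.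
have H := Xb_tri2 _ (quad_symbol_error sg1 t0) HV HV (X2b_cflip HV).
apply: XN_le (Xb_le (H _) _) => [k||].
- rewrite (tri_subsym (L := `|tau|) (L' := `|tau| * 3))//.
  + by rewrite -cubic_scale_quad.
  + exact: tribound_J1.
  + by move=> k1 k2 k3; rewrite normcM normc_real ler_wpM2l// tribound_quad.
- by rewrite mulr_ge0// exprn_ge0// ltW.
- by apply: le_of_eq; ring.
Qed.

(** Here [144 = 2 * 9 * 8] comes from replacing [osc] by 1 on the two half steps; the terms with 9
    and 18 come from the second difference of the cubic term. *)
Definition defect_cst (B : R) := nu * (144 * (B ^+ 2 * lip_cst B) + 9 * (symm_cst B * B ^+ 2) + 18 * (lip_cst B ^+ 2 * B)).
(** Here [432 = 2 * 3 * 72] collects the quadrature errors of the two halves. *)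
Definition step_cst (B : R) := defect_cst B + nu * (432 * B ^+ 3).
Definition start_cst (B : R) := nu * (9 * (B ^+ 2 * lip_cst B) + 216 * B ^+ 3).

Lemma lip_cst_ge0 B : 0 <= B -> 0 <= lip_cst B.
Proof. by move=> B0; rewrite mulr_ge0// mulr_ge0// exprn_ge0. Qed.

Lemma symm_cst_ge0 B : 0 <= B -> 0 <= symm_cst B.
Proof.
move=> B0; have p := exprn_ge0 3 B0.
have p1 : 0 <= B ^+ 2 * lip_cst B by apply: mulr_ge0 (sqr_ge0 B) (lip_cst_ge0 B0).
by apply: mulr_ge0 (normr_ge0 mu) _; move: p p1; move: (B ^+ 2 * _) (B ^+ 3) => x y; lra.
Qed.

Lemma defect_cst_ge0 B : 0 <= B -> 0 <= defect_cst B.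
Proof.
move=> B0; have d1 := lip_cst_ge0 B0; have d2 := symm_cst_ge0 B0.
have p1 := mulr_ge0 (sqr_ge0 B) d1; have p2 := mulr_ge0 d2 (sqr_ge0 B).
have p3 := mulr_ge0 (sqr_ge0 (lip_cst B)) B0.
by apply: mulr_ge0 (normr_ge0 mu) _; move: p1 p2 p3; move: (B ^+ 2 * _) (_ * B ^+ 2) (_ * B) => x y z; lra.
Qed.

Lemma step_cst_ge0 B : 0 <= B -> 0 <= step_cst B.
Proof.
move=> B0; have d3 := defect_cst_ge0 B0.
have p := mulr_ge0 (normr_ge0 mu) (exprn_ge0 3 B0); rewrite /step_cst; lra.
Qed.

Lemma start_cst_ge0 B : 0 <= B -> 0 <= start_cst B.
Proof.
move=> B0; have p := exprn_ge0 3 B0.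
have p1 : 0 <= B ^+ 2 * lip_cst B by apply: mulr_ge0 (sqr_ge0 B) (lip_cst_ge0 B0).
by apply: mulr_ge0 (normr_ge0 mu) _; move: p p1; move: (B ^+ 2 * _) (B ^+ 3) => x y; lra.
Qed.

Lemma tribound2_osc1 (s : R) : tribound2 (fun k1 k2 k3 : K => osc s k1 k2 k3 - 1) (8 * `|s|).
Proof.
move=> k1 k2 k3; have := tribound2_osc s 0 k1 k2 k3.
by rewrite /osc mulr0 expi0 subr0.
Qed.

Lemma tribound_osc1 (s : R) : tribound (fun k1 k2 k3 : K => osc s k1 k2 k3 - 1) 2.
Proof.
by move=> k1 k2 k3; apply: le_trans (normcB _ _) _; rewrite normc_expi normc1.
Qed.

Lemma local_error_symm B tau Wp Wm : halfflow mu 1 B tau Wp -> halfflow mu (-1) B tau Wm ->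
  Wp 0 = Wm 0 -> 0 < tau ->
  Xb (fun k => Wp tau k - Wm tau k + 'i%C * (mu * tau)%:C *
     (cubic (quad_symbol 1 tau) (Wp 0) k + cubic (quad_symbol (-1) tau) (Wp 0) k))
    (tau ^+ 3 * step_cst B).
Proof.
move=> Hp Hm W0 t0.
have [Pc PB PD] := Hp; have [Mc MB MD] := Hm.
have B0 : 0 <= B by apply: halfflow_B_ge0 Hp; exact: ltW.
set v := Wp 0.
have HV : X2b v B by apply: PB; rewrite lexx ltW.
have lv := Xb_asum (X2b_Xb HV); have lcv := l1_cflip lv.
pose j sg t k := cubic (fun k1 k2 k3 => J1 (sg * phase k1 k2 k3) t) v k.
pose f s k := Wp s k - Wm s k + 'i%C * mu%:C * (j 1 s k + j (-1) s k).
have j0 sg k : j sg 0 k = 0.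
  exact: tri_J1_0.
have main : Xb (fun k => f tau k - f 0 k) (tau * (tau ^+ 2 * defect_cst B)).
  have := XN_MVT (w := fun k => 1) (f := f)
    (f' := fun r k => - 'i%C * (1 * mu)%:C * cubic (osc (1 * r)) (Wp r) k -
       - 'i%C * (-1 * mu)%:C * cubic (osc (-1 * r)) (Wm r) k +
       'i%C * mu%:C * (cubic (osc (1 * r)) v k + cubic (osc (-1 * r)) v k)) (B := tau ^+ 2 * defect_cst B) t0
    (fun=> ler01).
  rewrite subr0 => H; apply: XN_le (H _ _ _); first by move=> k; rewrite mul1r.
  - move=> k; apply: ccontD; first exact: ccontB (Pc k) (Mc k).
    apply: ccontM; first exact: ccont_cst.
    apply: is_cderive_ccont => s; eexists; apply: is_cderiveD.
      by apply: tri_J1_derive HV; rewrite normr1.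
    by apply: tri_J1_derive HV; rewrite normrN1.
  - move=> r rt k; apply: is_cderiveD.
      by apply: is_cderiveB; [exact: PD|exact: MD].
    apply: is_cderiveZ; apply: is_cderiveD.
      by apply: tri_J1_derive HV; rewrite normr1.
    by apply: tri_J1_derive HV; rewrite normrN1.
  move=> r /andP[r0 rs].
  have rt : 0 <= r <= tau by rewrite !ltW.
  have XP := PB r rt; have XM := MB r rt.
  have lP := Xb_asum (X2b_Xb XP); have lcP := l1_cflip lP.
  have lM := Xb_asum (X2b_Xb XM); have lcM := l1_cflip lM.
  have LP : X2b (fun k => Wp r k - v k) (r * lip_cst B) by apply: halfflow_lip Hp rt; rewrite normr1.
  have LM : X2b (fun k => Wm r k - v k) (r * lip_cst B).
    by rewrite /v W0; apply: halfflow_lip Hm rt; rewrite normrN1.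
  have LS : Xb (fun k => (Wp r k - v k) - (v k - Wm r k)) (r * (r * symm_cst B)).
    by apply: (halfflow_symm Hp Hm) => //; rewrite r0 ltW.
  (* Writing [osc = (osc - 1) + 1] yields the O(r^2): [osc - 1] is O(r) and acts on increments of
     size r, while the symbol 1 leaves a second difference of the cubic term along the symmetric
     flow. *)
  have E k : - 'i%C * (1 * mu)%:C * cubic (osc (1 * r)) (Wp r) k -
       - 'i%C * (-1 * mu)%:C * cubic (osc (-1 * r)) (Wm r) k +
       'i%C * mu%:C * (cubic (osc (1 * r)) v k + cubic (osc (-1 * r)) v k) =
     - 'i%C * (1 * mu)%:C * (
       (cubic (fun k1 k2 k3 => osc r k1 k2 k3 - 1) (Wp r) k - cubic (fun k1 k2 k3 => osc r k1 k2 k3 - 1) v k) +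
       (cubic (fun k1 k2 k3 => osc (- r) k1 k2 k3 - 1) (Wm r) k - cubic (fun k1 k2 k3 => osc (- r) k1 k2 k3 - 1) v k) +
       ((cubic (fun _ _ _ => 1) (Wp r) k - cubic (fun _ _ _ => 1) v k) -
        (cubic (fun _ _ _ => 1) v k - cubic (fun _ _ _ => 1) (Wm r) k))).
    rewrite !(tri_subsym _ (tribound_osc _) tribound1)//.
    rewrite !mul1r !mulN1r rmorphN /=; ring.
  have H1 := Xb2_cubic_sub _ (tribound_osc1 r) (tribound2_osc1 r) XP HV LP.
  have H2 := Xb2_cubic_sub _ (tribound_osc1 (- r)) (tribound2_osc1 (- r)) XM HV LM.
  have H3 := Xb_cubic_second ler01 tribound1 (X2b_Xb XP) (X2b_Xb XM) (X2b_Xb HV) (X2b_Xb LP) (X2b_Xb LM) LS.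
  have H4 := Xb_mul (z := fun=> - 'i%C * (1 * mu)%:C) (normr_ge0 mu) _ (XbD (XbD (H1 _) (H2 _)) H3).
  apply: XN_le (Xb_le (H4 _ _ _) _) => [k||||].
  - by rewrite mul1r E.
  - by move=> k; rewrite normc_imu// normr1.
  - by rewrite mulr_ge0.
  - by rewrite mulr_ge0.
  rewrite normrN [`|r|]ger0_norm ?(ltW r0)//.
  apply: le_trans (_ : r ^+ 2 * defect_cst B <= _).
    by apply: le_of_eq; rewrite /defect_cst; ring.
  by rewrite ler_wpM2r ?defect_cst_ge0// ler_pXn2r ?nnegrE ?(ltW r0) ?(ltW t0) ?(ltW rs).
have Q1 := Xb_quad_error (normr1 _) t0 HV.
have Q2 := Xb_quad_error (normrN1 _) t0 HV.
have Q3 := Xb_mul (z := fun=> - 'i%C * (1 * mu)%:C) (normr_ge0 mu) _ (XbD Q1 Q2).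
have Q4 := XbD main (Q3 _).
apply: XN_le (Xb_le (Q4 _) _) => [k||].
- apply: le_of_eq; congr normc.
  rewrite /f !j0 /j -W0 -/v mul1r [(mu * tau)%:C]rmorphM /=; ring.
- by move=> k; rewrite normc_imu// normr1.
by rewrite /step_cst; apply: le_of_eq; ring.
Qed.

(** Without a backward half there is no cancellation and the derivative of the comparison is only
    O(r). The assumption [tau <= 1] absorbs the quadrature error [tau ^+ 3] into [tau ^+ 2]. *)
Lemma local_error_start B tau W : halfflow mu 1 B tau W -> 0 < tau <= 1 ->
  Xb (fun k => W tau k - W 0 k + 'i%C * (mu * tau)%:C * cubic (quad_symbol 1 tau) (W 0) k)
    (tau ^+ 2 * start_cst B).
Proof.
move=> Hp /andP[t0 t1].
have [Pc PB PD] := Hp.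
have B0 : 0 <= B by apply: halfflow_B_ge0 Hp; exact: ltW.
have s1 : `|1| = 1 :> R by exact: normr1.
set v := W 0.
have HV : X2b v B by apply: PB; rewrite lexx ltW.
have lv := Xb_asum (X2b_Xb HV); have lcv := l1_cflip lv.
pose j t k := cubic (fun k1 k2 k3 => J1 (1 * phase k1 k2 k3) t) v k.
pose f s k := W s k + 'i%C * mu%:C * j s k.
have j0 k : j 0 k = 0.
  exact: tri_J1_0.
have main : Xb (fun k => f tau k - f 0 k) (tau * (tau * (nu * (9 * (B ^+ 2 * lip_cst B))))).
  have := XN_MVT (w := fun k => 1) (f := f)
    (f' := fun r k => - 'i%C * (1 * mu)%:C * cubic (osc (1 * r)) (W r) k +
       'i%C * mu%:C * cubic (osc (1 * r)) v k) (B := tau * (nu * (9 * (B ^+ 2 * lip_cst B)))) t0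
    (fun=> ler01).
  rewrite subr0 => H; apply: XN_le (H _ _ _); first by move=> k; rewrite mul1r.
  - move=> k; apply: ccontD; first exact: Pc.
    apply: ccontM; first exact: ccont_cst.
    by apply: is_cderive_ccont => s; eexists; exact: tri_J1_derive s1 HV.
  - move=> r rt k; apply: is_cderiveD; first exact: PD.
    by apply: is_cderiveZ; exact: tri_J1_derive s1 HV.
  move=> r /andP[r0 rs].
  have rt : 0 <= r <= tau by rewrite !ltW.
  have XP := PB r rt.
  have LP : X2b (fun k => W r k - v k) (r * lip_cst B) by exact: halfflow_lip s1 Hp rt.
  have E k : - 'i%C * (1 * mu)%:C * cubic (osc (1 * r)) (W r) k +
       'i%C * mu%:C * cubic (osc (1 * r)) v k =
     - 'i%C * (1 * mu)%:C * (cubic (osc (1 * r)) (W r) k - cubic (osc (1 * r)) v k).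
    by rewrite [1 * mu]mul1r; ring.
  have H1 := Xb_cubic_sub ler01 (tribound_osc (1 * r)) (X2b_Xb XP) (X2b_Xb HV) (X2b_Xb LP).
  have H4 := Xb_mul (z := fun=> - 'i%C * (1 * mu)%:C) (normr_ge0 mu) _ H1.
  apply: XN_le (Xb_le (H4 _) _) => [k||].
  - by rewrite mul1r E.
  - by move=> k; rewrite normc_imu.
  apply: le_trans (_ : r * (nu * (9 * (B ^+ 2 * lip_cst B))) <= _).
    by apply: le_of_eq; ring.
  by rewrite ler_wpM2r ?(ltW rs)// !mulr_ge0 ?exprn_ge0 ?lip_cst_ge0.
have Q1 := Xb_quad_error s1 t0 HV.
have Q3 := Xb_mul (z := fun=> - 'i%C * (1 * mu)%:C) (normr_ge0 mu) _ Q1.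
have Q4 := XbD main (Q3 _).
apply: XN_le (Xb_le (Q4 _) _) => [k||].
- apply: le_of_eq; congr normc.
  rewrite /f !j0 /j -/v [1 * mu]mul1r [(mu * tau)%:C]rmorphM /=; ring.
- by move=> k; rewrite normc_imu.
have t32 : tau ^+ 3 <= tau ^+ 2 by rewrite exprS ler_piMl ?sqr_ge0.
have N0 : 0 <= nu * (216 * B ^+ 3).
  exact: mulr_ge0 (normr_ge0 mu) (mulr_ge0 (ler0n R 216) (exprn_ge0 3 B0)).
have H := ler_wpM2r N0 t32; clear - H.
by rewrite /start_cst; lra.
Qed.

End LocalErrorSteps.

(** * Stability *)

Section Stability.
Context {R : realType} {d : nat} (mu : R).
Local Notation C := R[i].
Local Notation K := 'rV[int]_d.
Implicit Types (v : K -> C) (k : K).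
Local Notation cubic m a := (tri m a a (cflip a)).
Local Notation nu := (`|mu|).
Local Notation step_cst := (step_cst mu).
Local Notation start_cst := (start_cst mu).

Definition free (t : R) k : C := expi (- (t * freq_sq k)).

Definition quad2 (tau : R) v k : C :=
  cubic (quad_symbol 1 tau) v k + cubic (quad_symbol (-1) tau) v k.

(** Coefficients of |u|^4 u, factored as u times its conjugate times |u|^2 u so that [tri] can be
    reused. *)
Definition quintic v : K -> C :=
  tri (fun _ _ _ => 1) v (cflip v) (cubic (fun _ _ _ => 1) v).

(* The scheme acting on Fourier coefficients; both halves of [quad2] together
   make up the three nonlinear terms of one two-step update. *)
Fixpoint coefs (tau : R) v (n : nat) : K -> C :=
  match n with
  | 0 => v
  | p.+1 => match p with
    | 0 => fun k => free tau k * (v k - 'i%C * (mu * tau)%:C * cubic (quad_symbol 1 tau) v k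
             - (mu ^+ 2 * (tau ^+ 2 / 2))%:C * quintic v k)
    | m.+1 => fun k => free (2 * tau) k * coefs tau v m k
             - 'i%C * (mu * tau)%:C * (free tau k * quad2 tau (coefs tau v p) k)
    end
  end.

Lemma normc_free t k : normc (free t k) = 1.
Proof. exact: normc_expi. Qed.

Lemma Xb_free t v B : Xb v B -> Xb (fun k => free t k * v k) B.
Proof.
by move=> H; rewrite -[B]mul1r; apply: Xb_mul => // k; rewrite normc_free.
Qed.

Lemma Xb_quintic v B : Xb v B -> Xb (quintic v) (9 * B ^+ 5).
Proof.
move=> H; have H3 := Xb_tri ler01 tribound1 H H (Xb_cflip H).
have H5 := Xb_tri ler01 tribound1 H (Xb_cflip H) H3.
by apply: (Xb_le H5); apply: le_of_eq; ring.
Qed.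

Lemma Xb_quad2 tau v B : Xb v B -> Xb (quad2 tau v) (18 * B ^+ 3).
Proof.
move=> H; have := XbD (Xb_tri (ler0n _ _) (@tribound_quad R d 1 tau) H H (Xb_cflip H))
  (Xb_tri (ler0n _ _) (@tribound_quad R d (-1) tau) H H (Xb_cflip H)).
by move/Xb_le; apply; apply: le_of_eq; ring.
Qed.

Lemma Xb_quad2_sub tau v w B D : Xb v B -> Xb w B -> Xb (fun k => v k - w k) D ->
  Xb (fun k => quad2 tau v k - quad2 tau w k) (54 * (B ^+ 2 * D)).
Proof.
move=> Hv Hw HD.
have := XbD (Xb_cubic_sub (ler0n _ _) (@tribound_quad R d 1 tau) Hv Hw HD)
  (Xb_cubic_sub (ler0n _ _) (@tribound_quad R d (-1) tau) Hv Hw HD).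
move=> H; apply: XN_le (Xb_le H _) => [k|].
  by rewrite /quad2 opprD addrACA.
by apply: le_of_eq; ring.
Qed.

(** Purely qualitative, with a bound depending on [n] and [tau]: it provides the summability under
    which the scheme can be transferred to coefficients at all. *)
Lemma coefs_Xb tau v B n : Xb v B -> exists B', Xb (coefs tau v n) B'.
Proof.
move=> Hv.
suff [] : (exists B', Xb (coefs tau v n) B') /\ (exists B', Xb (coefs tau v n.+1) B') by [].
elim: n => [|n [[B1 H1] [B2 H2]]].
  split; first by exists B.
  eexists; apply: Xb_free; apply: XbB; first apply: XbB; first exact: Hv.
    apply: (Xb_mul (L := normc ('i%C * (mu * tau)%:C))); [exact: normc_ge0|by []|].
    exact: (Xb_tri (ler0n _ _) (@tribound_quad R d 1 tau) Hv Hv (Xb_cflip Hv)).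
  apply: (Xb_mul (L := normc (mu ^+ 2 * (tau ^+ 2 / 2))%:C)); [exact: normc_ge0|by []|].
  exact: Xb_quintic Hv.
split; first by exists B2.
eexists; apply: XbB; first exact: Xb_free H1.
apply: (Xb_mul (L := normc ('i%C * (mu * tau)%:C))); [exact: normc_ge0|by []|].
by apply: Xb_free; exact: Xb_quad2 H2.
Qed.

(** Lipschitz constant of the nonlinear increment on the ball of radius [B + 1], which is to contain
    both solutions; [54 = 2 * 9 * 3]. *)
Definition growth_cst (B : R) := nu * (54 * (B + 1) ^+ 2).
(** The quintic term of the starting step is matched against nothing: being itself O(tau^2), it is
    counted as part of the error. *)
Definition init_cst (B : R) := start_cst B + mu ^+ 2 / 2 * (9 * B ^+ 5).
Definition error_cst (T B : R) := (init_cst B + T * step_cst B) * expR (T * growth_cst B).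

Lemma growth_cst_ge0 B : 0 <= growth_cst B.
Proof. by rewrite /growth_cst mulr_ge0// mulr_ge0// sqr_ge0. Qed.

Lemma init_cst_ge0 B : 0 <= B -> 0 <= init_cst B.
Proof.
move=> B0; have := start_cst_ge0 mu B0.
have := mulr_ge0 (sqr_ge0 mu) (exprn_ge0 5 B0); rewrite /init_cst; lra.
Qed.

Lemma error_cst_ge0 T B : 0 <= T -> 0 <= B -> 0 <= error_cst T B.
Proof.
move=> T0 B0; rewrite /error_cst mulr_ge0 ?expR_ge0// addr_ge0 ?init_cst_ge0//.
by rewrite mulr_ge0// step_cst_ge0.
Qed.

Lemma stability (tau T B : R) (N : nat) (a : nat -> K -> C) :
  0 < tau -> 0 <= T -> tau ^+ 2 * error_cst T B <= 1 -> N%:R * tau <= T ->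
  (forall n, (n <= N)%N -> Xb (a n) B) ->
  ((1 <= N)%N -> Xb (fun k => a 1 k - free tau k * (a 0 k -
     'i%C * (mu * tau)%:C * cubic (quad_symbol 1 tau) (a 0) k)) (tau ^+ 2 * start_cst B)) ->
  (forall n, (n.+2 <= N)%N -> Xb (fun k => a n.+2 k - (free (2 * tau) k * a n k -
     'i%C * (mu * tau)%:C * (free tau k * quad2 tau (a n.+1) k))) (tau ^+ 3 * step_cst B)) ->
  forall n, (n <= N)%N -> Xb (fun k => a n k - coefs tau (a 0) n k) (tau ^+ 2 * error_cst T B).
Proof.
move=> t0 T0 tC NT aB start step.
have B0 : 0 <= B by exact: Xb_ge0 (aB 0 isT).
have L0 := growth_cst_ge0 B; have d4 := step_cst_ge0 mu B0; have G0 := init_cst_ge0 B0.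
have C0 := error_cst_ge0 T0 B0.
(* Majorant of the recursion [y -> (1 + tau * growth_cst B) * y + tau * step_cst B]: every local
   error is simply given the full growth factor, which keeps the formula closed. *)
pose Y (n : nat) : R := (init_cst B + (n%:R * tau) * step_cst B) * (1 + tau * growth_cst B) ^+ n.
have tL : 1 <= 1 + tau * growth_cst B by rewrite lerDl mulr_ge0// ltW.
have pw n : 1 <= (1 + tau * growth_cst B) ^+ n by exact: exprn_ege1.
have S0 n : 0 <= init_cst B + (n%:R * tau) * step_cst B.
  by rewrite addr_ge0// mulr_ge0// mulr_ge0// ltW.
have YS n : (1 + tau * growth_cst B) * Y n + tau * step_cst B <= Y n.+1.
  rewrite /Y exprS -natr1.
  set p := (1 + tau * growth_cst B) ^+ n; set q := 1 + tau * growth_cst B.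
  have -> : (init_cst B + (n%:R + 1) * tau * step_cst B) * (q * p) =
    q * ((init_cst B + n%:R * tau * step_cst B) * p) + tau * step_cst B * (q * p) by ring.
  by rewrite lerD2l ler_peMr ?mulr_ege1 ?pw// mulr_ge0// ltW.
have Y0 n : 0 <= Y n by rewrite mulr_ge0// (le_trans _ (pw n)).
have Ymono n : Y n <= Y n.+1.
  apply: le_trans (YS n); rewrite -[leLHS]addr0 lerD//; last by rewrite mulr_ge0// ltW.
  by rewrite ler_peMl.
have YC n : (n <= N)%N -> Y n <= error_cst T B.
  move=> nN; have nT : n%:R * tau <= T.
    by apply: le_trans NT; rewrite ler_wpM2r ?(ltW t0)// ler_nat.
  apply: ler_pM => //; first by rewrite (le_trans _ (pw n)).
    by rewrite lerD2l ler_wpM2r.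
  apply: (@le_trans _ _ (expR (tau * growth_cst B) ^+ n)).
    by rewrite lerXn2r ?nnegrE ?expR_ge0 ?(le_trans _ tL)// expR_ge1Dx.
  by rewrite -expRM_natl ler_expR mulrA ler_wpM2r.
(* One value [Y n] bounds the errors at [n] and at [n.+1], because the two-step recursion needs
   control of both. *)
have key n : (n.+1 <= N)%N ->
  Xb (fun k => a n k - coefs tau (a 0) n k) (tau ^+ 2 * Y n) /\
  Xb (fun k => a n.+1 k - coefs tau (a 0) n.+1 k) (tau ^+ 2 * Y n).
  elim: n => [N1|n IH nN].
    have Y00 : Y 0 = init_cst B by rewrite /Y mul0r mul0r addr0 expr0 mulr1.
    split.
      apply: Xb_le (_ : Xb _ 0) _; last by rewrite mulr_ge0 ?sqr_ge0.
      by rewrite (_ : (fun k => _) = fun=> 0); [exact: Xb0|apply/funext => k; rewrite subrr].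
    rewrite Y00.
    have H := Xb_quintic (aB 0 isT).
    have H1 := Xb_free tau (Xb_mul (z := fun=> (mu ^+ 2 * (tau ^+ 2 / 2))%:C)
      (normc_ge0 _) (fun=> lexx _) H).
    have H2 := XbD (start N1) H1.
    apply: XN_le (Xb_le H2 _) => [k|].
      apply: le_of_eq; congr normc; rewrite /=; ring.
    rewrite normc_real ger0_norm; last by rewrite mulr_ge0 ?sqr_ge0// divr_ge0 ?sqr_ge0.
    by rewrite /init_cst; apply: le_of_eq; ring.
  have [IH1 IH2] := IH (ltnW nN).
  split; first by apply: Xb_le IH2 _; rewrite ler_wpM2l ?sqr_ge0.
  set c := coefs tau (a 0) in IH1 IH2 *.
  (* With an error of at most 1 the numerical solution stays in the ball of radius [B + 1], and
     [growth_cst] applies to the next step. *)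
  have r1 : tau ^+ 2 * Y n <= 1.
    by apply: le_trans tC; rewrite ler_wpM2l ?sqr_ge0// YC// ltnW// ltnW.
  have HA : Xb (a n.+1) (B + 1) by apply: Xb_le (aB _ (ltnW nN)) _; rewrite lerDl.
  have HC : Xb (c n.+1) (B + 1).
    have := XbB (aB _ (ltnW nN)) IH2.
    move=> /Xb_le/(_ (_ : _ <= B + 1)) H; apply: XN_le (H _) => [k|]; last by rewrite lerD2l.
    by rewrite opprB addrC subrK.
  have HQ := Xb_mul (z := fun=> 'i%C * (mu * tau)%:C) (normc_ge0 _) (fun=> lexx _)
     (Xb_free tau (Xb_quad2_sub tau HA HC IH2)).
  have H := XbD (XbB (Xb_free (2 * tau) IH1) HQ) (step n nN).
  apply: XN_le (Xb_le H _) => [k|].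
    apply: le_of_eq; congr normc; rewrite /c /= -/c; ring.
  rewrite normcM normc_i normc_real mul1r normrM (gtr0_norm t0).
  apply: (@le_trans _ _ (tau ^+ 2 * ((1 + tau * growth_cst B) * Y n + tau * step_cst B))).
    by rewrite /growth_cst; apply: le_of_eq; ring.
  by rewrite ler_wpM2l ?sqr_ge0.
move=> [_|n nN].
  apply: Xb_le (_ : Xb _ 0) _; last by rewrite mulr_ge0 ?sqr_ge0.
  by rewrite (_ : (fun k => _) = fun=> 0); [exact: Xb0|apply/funext => k; rewrite subrr].
have [_ H] := key n nN.
by apply: Xb_le H _; rewrite ler_wpM2l ?sqr_ge0// YC// ltnW.
Qed.

End Stability.

(** * Fourier series on the torus *)

Section Cube.
Context {R : realType}.
Local Notation I2 := (`[0, 2 * pi]%classic : set R).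
Local Notation leb := (@lebesgue_measure R).

Lemma cont_cst (X : topologicalType) (r : R) : continuous (fun _ : X => r).
Proof. by move=> x; exact: cst_continuous. Qed.

Lemma contD (X : topologicalType) (f g : X -> R) : continuous f -> continuous g ->
  continuous (fun x => f x + g x).
Proof. by move=> cf cg x; apply: cvgD; [exact: cf|exact: cg]. Qed.

Lemma contM (X : topologicalType) (f g : X -> R) : continuous f -> continuous g ->
  continuous (fun x => f x * g x).
Proof. by move=> cf cg x; apply: cvgM; [exact: cf|exact: cg]. Qed.

Lemma contZ (X : topologicalType) r (f : X -> R) : continuous f ->
  continuous (fun x => r * f x).
Proof. by move=> cf; apply: contM => //; exact: cont_cst. Qed.

Lemma twopi_gt0 : 0 < 2 * pi :> R.
Proof. by rewrite mulr_gt0// pi_gt0. Qed.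

Definition rint (g : R -> R) : R := \int[leb]_(s in I2) g s.

Lemma cont_integrable (g : R -> R) : continuous g -> leb.-integrable I2 (EFin \o g).
Proof.
move=> cg; apply: continuous_compact_integrable; first exact: segment_compact.
exact: continuous_subspaceT.
Qed.

Lemma rintD (f g : R -> R) : continuous f -> continuous g ->
  rint (fun s => f s + g s) = rint f + rint g.
Proof. by move=> cf cg; apply: RintegralD => //; exact: cont_integrable. Qed.

Lemma rintZ r (g : R -> R) : continuous g -> rint (fun s => r * g s) = r * rint g.
Proof. by move=> cg; apply: RintegralZl => //; exact: cont_integrable. Qed.

Lemma measure_I2 : leb I2 = (2 * pi)%:E.
Proof.
by rewrite lebesgue_measure_itv /= lte_fin twopi_gt0 oppr0 addr0.
Qed.

Lemma rint_le (f g : R -> R) : continuous f -> continuous g ->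
  (forall s, 0 <= s <= 2 * pi -> f s <= g s) -> rint f <= rint g.
Proof.
move=> cf cg fg; apply: (le_Rintegral _ (cont_integrable cf) (cont_integrable cg)) => //.
Qed.

Lemma rint_cst (r : R) : rint (fun=> r) = 2 * pi * r.
Proof. by rewrite /rint Rintegral_cst//= measure_I2 /= mulrC. Qed.

Lemma rint_bound (g : R -> R) M : continuous g -> (forall s, 0 <= s <= 2 * pi -> `|g s| <= M) ->
  `|rint g| <= 2 * pi * M.
Proof.
move=> cg gM; have cN : continuous (fun s => -1 * g s).
  by move=> s; apply: cvgM; [exact: cvg_cst|exact: cg].
have cc (r : R) : continuous (fun _ : R => r) by move=> s; exact: cvg_cst.
rewrite ler_norml; apply/andP; split.
  rewrite -mulrN -rint_cst; apply: rint_le => // s sI.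
  by have := gM s sI; rewrite ler_norml => /andP[].
rewrite -rint_cst; apply: rint_le => // s sI.
by have := gM s sI; rewrite ler_norml => /andP[].
Qed.

Lemma rint_FTC (g G : R -> R) : continuous g -> (forall s : R, is_derive s 1 G (g s)) ->
  rint g = G (2 * pi) - G 0.
Proof.
move=> cg GD.
have cG : continuous G.
  move=> s; apply: differentiable_continuous; apply/derivable1_diffP.
  exact: (@ex_derive _ _ _ _ _ _ _ (GD s)).
rewrite /rint /Rintegral (@continuous_FTC2 R g G)//; first exact: twopi_gt0.
- exact: continuous_subspaceT.
- split; first by move=> s _; exact: (@ex_derive _ _ _ _ _ _ _ (GD s)).
  + by apply: cvg_at_right_filter; exact: cG.
  + by apply: cvg_at_left_filter; exact: cG.
by move=> s _; rewrite derive1E; exact: (@derive_val _ _ _ _ _ _ _ (GD s)).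
Qed.

Definition cube d : set 'rV[R]_d := [set y | forall j, 0 <= y 0 j <= 2 * pi].

Lemma compact_cube d : compact (@cube d).
Proof.
have -> : @cube d = [set v : 'rV[R]_d | forall j, I2 (v ord0 j)].
  by apply/seteqP; split => v H j; have := H j; rewrite /= in_itv.
by apply: (@rV_compact _ _ (fun=> I2)) => j; exact: segment_compact.
Qed.

(** Compactness of the cube turns joint continuity along the slice at [t0] into closeness that is
    uniform over the cube. *)
Lemma tube d (T : topologicalType) (f : T -> 'rV[R]_d -> R) (t0 : T) :
  (forall y, {for (t0, y), continuous (fun p : T * 'rV[R]_d => f p.1 p.2)}) ->
  forall e, 0 < e -> \forall t \near t0, forall y, cube y -> `|f t y - f t0 y| <= e.
Proof.
move=> fc e e0.
have /compact_near_coveringP H := @compact_cube d.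
apply: (H T (nbhs t0) (fun t y => `|f t y - f t0 y| <= e)) => x _.
have e2 : 0 < e / 2 by rewrite divr_gt0.
have /cvgrPdist_le/(_ _ e2)[[/= U V] [/= Ut Vx] UV] := fc x.
exists (V, U) => //= -[y t] /= [Vy Ut'].
have H1 := UV (t, y) (conj Ut' Vy).
have H2 := UV (t0, y) (conj (nbhs_singleton Ut) Vy).
rewrite /= in H1 H2.
have -> : f t y - f t0 y = (f t0 x - f t0 y) - (f t0 x - f t y) by ring.
apply: le_trans (ler_normB _ _) _; lra.
Qed.

Lemma cvg_mx_coord (T : topologicalType) d (g : T -> 'rV[R]_d) (t0 : T) :
  (forall j, (fun t => g t 0 j) @ t0 --> g t0 0 j) -> {for t0, continuous g}.
Proof.
move=> gc A [P P0 PA]; rewrite nbhs_filterE /= /fmap /=.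
have : \forall t \near t0, forall j, P 0 j (g t 0 j).
  apply: filter_forall => j; exact: (gc j _ (P0 0 j)).
by apply: filterS => t Ht; apply: PA => i j; rewrite ord1.
Qed.

Definition consr d (s : R) (y : 'rV[R]_d) : 'rV[R]_d.+1 := row_mx (s%:M : 'rV[R]_1) y.

Lemma consr0 d s (y : 'rV[R]_d) : consr s y 0 ord0 = s.
Proof.
have E : (ord0 : 'I_d.+1) = lshift d (ord0 : 'I_1) by apply: val_inj.
rewrite E; apply: (etrans (row_mxEl (s%:M : 'rV[R]_1) y 0 ord0)).
by rewrite mxE eqxx.
Qed.

Lemma consrS d s (y : 'rV[R]_d) j : consr s y 0 (lift ord0 j) = y 0 j.
Proof.
have E : lift (ord0 : 'I_d.+1) j = rshift 1 j by apply: val_inj.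
rewrite E; exact: (row_mxEr (s%:M : 'rV[R]_1) y 0 j).
Qed.

Lemma consr_cont d : continuous (fun p : R * 'rV[R]_d => consr p.1 p.2).
Proof.
move=> [s y]; apply: cvg_mx_coord => j.
have [i ->|->] := unliftP ord0 j.
  under eq_fun do rewrite consrS.
  rewrite consrS.
  apply: (@continuous_comp _ _ _ snd (fun y : 'rV[R]_d => y 0 i)); first exact: cvg_snd.
  exact: coord_continuous.
under eq_fun do rewrite consr0.
rewrite consr0.
exact: cvg_fst.
Qed.

Lemma cube_consr d s (y : 'rV[R]_d) : 0 <= s <= 2 * pi -> cube y -> cube (consr s y).
Proof.
move=> sI yI j; have [i ->|->] := unliftP ord0 j; first by rewrite consrS.
by rewrite consr0.
Qed.

Lemma continuous_slice d (f : 'rV[R]_d.+1 -> R) s : continuous f ->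
  continuous (fun y => f (consr s y)).
Proof.
move=> fc y; apply: (@continuous_comp _ _ _ (consr s) f); last exact: fc.
apply: (@continuous_comp _ _ _ (fun y => (s, y)) (fun p => consr p.1 p.2)).
  by apply: (@cvg_pair _ _ _ (nbhs y) (nbhs s) (nbhs y) _ _ _ (fun=> s) id); [exact: cvg_cst|exact: cvg_id].
exact: consr_cont.
Qed.

(** The three properties go through one induction: integrating over a further coordinate requires
    continuity of the inner integral in it, and this continuity uses linearity and the bound in the
    lower dimension. *)
Definition cube_spec d := [/\
  forall f g : 'rV[R]_d -> R, continuous f -> continuous g ->
    cube_integral (fun y => f y + g y) = cube_integral f + cube_integral g,
  forall r (f : 'rV[R]_d -> R), continuous f ->
    cube_integral (fun y => r * f y) = r * cube_integral f &
  forall (f : 'rV[R]_d -> R) M, continuous f -> (forall y, cube y -> `|f y| <= M) ->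
    `|cube_integral f| <= (2 * pi) ^+ d * M].

Lemma cube_spec_param d (T : topologicalType) (f : T -> 'rV[R]_d -> R) (t0 : T) :
  cube_spec d ->
  (forall y, {for (t0, y), continuous (fun p : T * 'rV[R]_d => f p.1 p.2)}) ->
  (\forall t \near t0, continuous (f t)) ->
  {for t0, continuous (fun t => cube_integral (f t))}.
Proof.
move=> [cD cZ cB] fc fcont.
have f0 : continuous (f t0) by exact: nbhs_singleton fcont.
apply/cvgrPdist_le => e e0.
have p0 : 0 < (2 * pi) ^+ d :> R by rewrite exprn_gt0// twopi_gt0.
have e1 : 0 < e / (2 * pi) ^+ d by rewrite divr_gt0.
have H := tube fc e1.
near=> t.
have ft : continuous (f t) by near: t.
have Ht : forall y, cube y -> `|f t y - f t0 y| <= e / (2 * pi) ^+ d by near: t.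
have cN : continuous (fun y => -1 * f t y).
  exact: contZ.
have -> : cube_integral (f t0) - cube_integral (f t) = cube_integral (fun y => f t0 y + -1 * f t y).
  by rewrite cD// cZ//; ring.
have -> : e = (2 * pi) ^+ d * (e / (2 * pi) ^+ d) by rewrite mulrC divfK// gt_eqF.
apply: cB => [|y yc].
  exact: contD.
by have := Ht y yc; rewrite mulN1r distrC.
Unshelve. all: by end_near.
Qed.

Lemma slice_param d (f : 'rV[R]_d.+1 -> R) : cube_spec d -> continuous f ->
  continuous (fun s => cube_integral (fun y => f (consr s y))).
Proof.
move=> H fc s; apply: (cube_spec_param (f := fun s y => f (consr s y))) => //.
  move=> y; apply: (@continuous_comp _ _ _ (fun p => consr p.1 p.2) f); last exact: fc.
  exact: consr_cont.
by near=> t; exact: continuous_slice.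
Unshelve. all: by end_near.
Qed.

Lemma cube_specP d : cube_spec d.
Proof.
elim: d => [|d IH]; first by split => // f M _ H; rewrite /= expr0 mul1r; apply: H => -[].
have [cD cZ cB] := IH.
have slice := continuous_slice; have par := fun f => @slice_param d f IH.
split => [f g fc gc|r f fc|f M fc fM] /=.
- rewrite -[RHS]rintD; [|exact: par..].
  by congr fine; apply: eq_integral => s _; rewrite cD//; exact: slice.
- rewrite -[RHS]rintZ; last exact: par.
  by congr fine; apply: eq_integral => s _; rewrite cZ//; exact: slice.
- rewrite exprS -mulrA; apply: rint_bound; first exact: par.
  move=> s sI; apply: cB; first exact: slice.
  by move=> y yc; apply: fM; exact: cube_consr.
Qed.

Lemma cubeD d (f g : 'rV[R]_d -> R) : continuous f -> continuous g ->
    cube_integral (fun y => f y + g y) = cube_integral f + cube_integral g.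
Proof. by have [h _ _] := cube_specP d; exact: h. Qed.

Lemma cubeZ d r (f : 'rV[R]_d -> R) : continuous f ->
    cube_integral (fun y => r * f y) = r * cube_integral f.
Proof. by have [_ h _] := cube_specP d; exact: h. Qed.

Lemma cube_bound d (f : 'rV[R]_d -> R) M : continuous f -> (forall y, cube y -> `|f y| <= M) ->
    `|cube_integral f| <= (2 * pi) ^+ d * M.
Proof. by have [_ _ h] := cube_specP d; exact: h. Qed.

Lemma cube_param d (T : topologicalType) (f : T -> 'rV[R]_d -> R) (t0 : T) :
  (forall y, {for (t0, y), continuous (fun p : T * 'rV[R]_d => f p.1 p.2)}) ->
  (\forall t \near t0, continuous (f t)) ->
  {for t0, continuous (fun t => cube_integral (f t))}.
Proof. exact: cube_spec_param (cube_specP d). Qed.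

(** By the mean value theorem the difference quotient equals [D] at an intermediate time, which the
    tube argument keeps close to [D t0] uniformly on the cube. The hypotheses are local in time
    because the solution is differentiable at interior times only. *)
Lemma cube_derive d (F D : R -> 'rV[R]_d -> R) (t0 : R) :
  (\forall t \near t0, forall y, is_derive (t : R) 1 (F ^~ y) (D t y)) ->
  (forall y, {for (t0, y), continuous (fun p : R * 'rV[R]_d => D p.1 p.2)}) ->
  (\forall t \near t0, continuous (F t)) -> continuous (D t0) ->
  is_derive t0 1 (fun t => cube_integral (F t)) (cube_integral (D t0)).
Proof.
move=> FD Dc Fc D0.
have F0 : continuous (F t0) by exact: nbhs_singleton Fc.
have p0 : 0 < (2 * pi) ^+ d :> R by rewrite exprn_gt0// twopi_gt0.
have cv : (fun r : R => r^-1 *: (((fun t => cube_integral (F t)) \o shift t0) (r *: 1)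
     - cube_integral (F t0))) @ 0^' --> cube_integral (D t0).
  apply/cvgrPdist_le => e e0.
  have e1 : 0 < e / (2 * pi) ^+ d by rewrite divr_gt0.
  have H := tube Dc e1.
  have [del del0 Hdel] : exists2 del, 0 < del & forall t : R, `|t - t0| < del ->
      [/\ forall y, is_derive (t : R) 1 (F ^~ y) (D t y), continuous (F t) &
       forall y, cube y -> `|D t y - D t0 y| <= e / (2 * pi) ^+ d].
    have : \forall t \near t0, [/\ forall y, is_derive (t : R) 1 (F ^~ y) (D t y), continuous (F t) &
       forall y, cube y -> `|D t y - D t0 y| <= e / (2 * pi) ^+ d].
      by near=> t; split; near: t.
    by move=> /nbhs_ballP[del /= del0 Hd]; exists del => // t td; apply: Hd; rewrite /ball /= distrC.
  near=> r.
  have r0 : r != 0 by near: r; exact: nbhs_dnbhs_neq.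
  have rd : `|r| < del by near: r; exact: dnbhs0_lt.
  rewrite /= /GRing.scale /= mulr1.
  have [_ Fr _] : [/\ forall y, is_derive (r + t0) 1 (F ^~ y) (D (r + t0) y), continuous (F (r + t0)) &
       forall y, cube y -> `|D (r + t0) y - D t0 y| <= e / (2 * pi) ^+ d].
    by apply: Hdel; rewrite addrK.
  have c1 : continuous (fun y => - r^-1 * F (r + t0) y).
    exact: contZ.
  have c2 : continuous (fun y => r^-1 * F t0 y).
    exact: contZ.
  have c3 : continuous (fun y => D t0 y + - r^-1 * F (r + t0) y).
    exact: contD.
  have -> : cube_integral (D t0) - r^-1 * (cube_integral (F (r + t0)) - cube_integral (F t0)) =
     cube_integral (fun y => (D t0 y + - r^-1 * F (r + t0) y) + r^-1 * F t0 y).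
    by rewrite !cubeD// !cubeZ//; ring.
  have -> : e = (2 * pi) ^+ d * (e / (2 * pi) ^+ d) by rewrite mulrC divfK// gt_eqF.
  apply: cube_bound => [|y yc].
    exact: contD.
  have [c cr E] : exists2 c, `|c - t0| < del & F (r + t0) y - F t0 y = D c y * r.
    have sub c : t0 - `|r| <= c <= t0 + `|r| -> `|c - t0| < del.
      move=> /andP[h1 h2]; apply: le_lt_trans rd; rewrite ler_norml; apply/andP; split; lra.
    have Dv c : t0 - `|r| <= c <= t0 + `|r| -> is_derive (c : R) 1 (F ^~ y) (D c y).
      by move=> /sub /Hdel[].
    have Cv c : t0 - `|r| <= c <= t0 + `|r| -> {for c, continuous (F ^~ y)}.
      move=> /Dv Fc'; apply: differentiable_continuous; apply/derivable1_diffP.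
      exact: (@ex_derive _ _ _ _ _ _ _ Fc').
    have [rp|rn|/eqP] := ltgtP 0 r; last by rewrite eq_sym (negbTE r0).
    - have rr : `|r| = r by rewrite gtr0_norm.
      have [|c||c] := @MVT R (F ^~ y) (D ^~ y) t0 (r + t0).
      + by rewrite ltrDr.
      + by rewrite in_itv /= => /andP[? ?]; apply: Dv; rewrite rr; apply/andP; split; lra.
      + apply: continuous_in_subspaceT => c; rewrite inE /= in_itv /= => /andP[? ?].
        by apply: Cv; rewrite rr; apply/andP; split; lra.
      + rewrite in_itv /= => /andP[? ?] E; exists c; last by rewrite E addrK.
        by apply: sub; rewrite rr; apply/andP; split; lra.
    - have rr : `|r| = - r by rewrite ltr0_norm.
      have [|c||c] := @MVT R (F ^~ y) (D ^~ y) (r + t0) t0.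
      + by rewrite -subr_gt0 opprD addrCA subrr addr0 oppr_gt0.
      + by rewrite in_itv /= => /andP[? ?]; apply: Dv; rewrite rr; apply/andP; split; lra.
      + apply: continuous_in_subspaceT => c; rewrite inE /= in_itv /= => /andP[? ?].
        by apply: Cv; rewrite rr; apply/andP; split; lra.
      + rewrite in_itv /= => /andP[? ?] E; exists c.
          by apply: sub; rewrite rr; apply/andP; split; lra.
        by rewrite -opprB E; ring.
  have [_ _ /(_ y yc)] := Hdel c cr.
  have -> : D t0 y + - r^-1 * F (r + t0) y + r^-1 * F t0 y = D t0 y - r^-1 * (F (r + t0) y - F t0 y) by ring.
  by rewrite E [D c y * r]mulrC mulKf// distrC.
have dh : derivable (fun t => cube_integral (F t)) t0 1.
  by apply/cvg_ex; exists (cube_integral (D t0)).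
by apply: DeriveDef => //; exact/cvg_lim.
Unshelve. all: by end_near.
Qed.

End Cube.

(** * Complex-valued integrals *)

Section ComplexIntegrals.
Context {R : realType}.
Local Notation C := R[i].

Definition cint (f : R -> C) : C := rint (fun s => Re (f s)) +i* rint (fun s => Im (f s)).

Definition ccube d (f : 'rV[R]_d -> C) : C :=
  cube_integral (fun x => Re (f x)) +i* cube_integral (fun x => Im (f x)).

Lemma ccubeD d (f g : 'rV[R]_d -> C) : ccont f -> ccont g ->
  ccube (fun x => f x + g x) = ccube f + ccube g.
Proof.
move=> [f1 f2] [g1 g2]; apply: complex_eqP; rewrite ?cReD ?cImD /= -cubeD//; congr cube_integral;
  by apply/funext => x; rewrite ?cReD ?cImD.
Qed.

Lemma ccubeZ d z (f : 'rV[R]_d -> C) : ccont f -> ccube (fun x => z * f x) = z * ccube f.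
Proof.
move=> [f1 f2]; apply: complex_eqP; rewrite ?cReM ?cImM /= -!cubeZ//.
  rewrite -mulN1r -cubeZ; last exact: contZ.
  rewrite -cubeD; [|exact: contZ|by apply: contZ; exact: contZ].
  by congr cube_integral; apply/funext => x; rewrite cReM mulN1r.
rewrite -cubeD; [|exact: contZ..].
by congr cube_integral; apply/funext => x; rewrite cImM.
Qed.

Lemma ccube_bound d (f : 'rV[R]_d -> C) M : ccont f -> (forall y, cube y -> normc (f y) <= M) ->
  normc (ccube f) <= 2 * ((2 * pi) ^+ d * M).
Proof.
move=> [f1 f2] fM; apply: le_trans (normc_le_add _) _; rewrite mulrDl mul1r.
by apply: lerD; apply: cube_bound => // y yc; apply: le_trans (fM y yc);
  [exact: normRe_le|exact: normIm_le].
Qed.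

Lemma cintD (f g : R -> C) : ccont f -> ccont g ->
  cint (fun x => f x + g x) = cint f + cint g.
Proof.
move=> [f1 f2] [g1 g2]; apply: complex_eqP; rewrite ?cReD ?cImD /= -rintD//; congr rint;
  by apply/funext => x; rewrite ?cReD ?cImD.
Qed.

Lemma cintZ z (f : R -> C) : ccont f -> cint (fun x => z * f x) = z * cint f.
Proof.
move=> [f1 f2]; apply: complex_eqP; rewrite ?cReM ?cImM /= -!rintZ//.
  rewrite -mulN1r -rintZ; last exact: contZ.
  rewrite -rintD; [|exact: contZ|by apply: contZ; exact: contZ].
  by congr rint; apply/funext => x; rewrite cReM mulN1r.
rewrite -rintD; [|exact: contZ..].
by congr rint; apply/funext => x; rewrite cImM.
Qed.

Lemma cint_FTC (f F : R -> C) : ccont f -> (forall s, is_cderive F s (f s)) ->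
  cint f = F (2 * pi) - F 0.
Proof.
move=> [c1 c2] FD; apply: complex_eqP; rewrite ?cReD ?cImD ?cReN ?cImN /=.
  by apply: (@rint_FTC R _ (fun s => Re (F s))) => // s; have [] := FD s.
by apply: (@rint_FTC R _ (fun s => Im (F s))) => // s; have [] := FD s.
Qed.

Lemma cos_sin_2npi (n : nat) : cos (n%:R * (2 * pi)) = 1 :> R /\ sin (n%:R * (2 * pi)) = 0 :> R.
Proof.
elim: n => [|n [IH1 IH2]]; first by rewrite mul0r cos0 sin0.
rewrite -natr1 mulrDl mul1r cosD sinD IH1 IH2.
have -> : 2 * pi = pi *+ 2 :> R by rewrite mulr_natl.
by rewrite cos2pi sin2pi; split; ring.
Qed.

Lemma expi_int (n : int) : expi (n%:~R * (2 * pi)) = 1 :> C.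
Proof.
have H (m : nat) : expi (m%:R * (2 * pi)) = 1 :> C.
  by rewrite /expi; have [-> ->] := cos_sin_2npi m.
case: n => n; first exact: H.
by rewrite NegzE mulrNz mulNr expiN H conjc1.
Qed.

Lemma cint_expi (n : int) : cint (fun s => expi (n%:~R * s)) = if n == 0 then (2 * pi)%:C else 0.
Proof.
rewrite (cint_FTC (ccont_expi n%:~R) (J1_derive n%:~R)) J1_0 subr0 /J1 intr_eq0.
by case: eqP => // _; rewrite expi_int subrr mul0r.
Qed.

(** A uniform limit argument, which passes continuity from trigonometric polynomials to absolutely
    convergent series. *)
Lemma ccont_unif (X : topologicalType) (f : X -> C) :
  (forall e : R, 0 < e -> exists2 g : X -> C, ccont g & forall x, normc (f x - g x) <= e) -> ccont f.
Proof.
move=> H.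
have key (P : C -> R) : (forall z w, P z - P w = P (z - w)) -> (forall z, `|P z| <= normc z) ->
  (forall g : X -> C, ccont g -> continuous (fun x => P (g x))) -> continuous (fun x => P (f x)).
  move=> PB Pn Pc x; apply/cvgrPdist_le => e e0.
  have e3 : 0 < e / 3 by rewrite divr_gt0.
  have [g gc fg] := H _ e3.
  have /cvgrPdist_le/(_ _ e3) := Pc g gc x.
  apply: filterS => y Hy.
  have -> : P (f x) - P (f y) = P (f x - g x) + (P (g x) - P (g y)) - P (f y - g y).
    by rewrite -!PB; ring.
  have h1 := le_trans (Pn _) (fg x); have h2 := le_trans (Pn _) (fg y).
  apply: le_trans (ler_normB _ _) _.
  have := ler_normD (P (f x - g x)) (P (g x) - P (g y)).
  lra.
split; apply: key => [z w|z|g []//].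
- by rewrite cReD cReN.
- exact: normRe_le.
- by rewrite cImD cImN.
- exact: normIm_le.
Qed.

Lemma ccont_sum (X : topologicalType) (I : Type) (r : seq I) (F : I -> X -> C) :
  (forall i, ccont (F i)) -> ccont (fun x => \sum_(i <- r) F i x).
Proof.
move=> H; elim: r => [|i r IH].
  by under eq_fun do rewrite big_nil; exact: ccont_cst.
by under eq_fun do rewrite big_cons; exact: ccontD.
Qed.

End ComplexIntegrals.

(** * Exponentials and their orthogonality *)

Section Waves.
Context {R : realType} {d : nat}.
Local Notation C := R[i].
Local Notation K := 'rV[int]_d.
Local Notation X := 'rV[R]_d.
Implicit Types (k l : K) (x : X) (a b c : K -> C).

Lemma waveE k x : wave k x = expi (freq_dot k x).
Proof. exact: expC_i. Qed.

Lemma freq_dotD k l x : freq_dot (k + l) x = freq_dot k x + freq_dot l x.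
Proof.
by rewrite /freq_dot -big_split /=; apply: eq_bigr => j _; rewrite mxE rmorphD /= mulrDl.
Qed.

Lemma freq_dotN k x : freq_dot (- k) x = - freq_dot k x.
Proof.
by rewrite /freq_dot -sumrN; apply: eq_bigr => j _; rewrite mxE rmorphN /= mulNr.
Qed.

Lemma waveD k l x : wave (k + l) x = wave k x * wave l x.
Proof. by rewrite !waveE freq_dotD expiD. Qed.

Lemma waveN k x : wave (- k) x = (wave k x)^*%C.
Proof. by rewrite !waveE freq_dotN expiN. Qed.

Lemma wave0 x : wave 0 x = 1.
Proof.
rewrite waveE -expi0; congr expi; rewrite /freq_dot big1// => j _.
by rewrite mxE mul0r.
Qed.

Lemma normc_wave k x : normc (wave k x) = 1.
Proof. by rewrite waveE normc_expi. Qed.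

Lemma freq_dot_cont k : continuous (freq_dot k : X -> R).
Proof.
rewrite /freq_dot; elim: (index_enum _) => [|j r IH].
  by under [X in continuous X]eq_fun do rewrite big_nil; exact: cont_cst.
under [X in continuous X]eq_fun do rewrite big_cons.
by apply: contD => //; apply: contZ; exact: coord_continuous.
Qed.

Lemma ccont_wave k : ccont (wave k : X -> C).
Proof.
have -> : wave k = (fun x => expi (1 * freq_dot k x)) :> (X -> C).
  by apply/funext => x; rewrite waveE mul1r.
exact: (ccont_comp (@freq_dot_cont k) (ccont_expi 1)).
Qed.

End Waves.

Section Orthogonality.
Context {R : realType}.
Local Notation C := R[i].

Definition tailz d (k : 'rV[int]_d.+1) : 'rV[int]_d := \row_j k 0 (lift ord0 j).

Lemma freq_dot_consr d (k : 'rV[int]_d.+1) s (y : 'rV[R]_d) :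
  freq_dot k (consr s y) = (k 0 ord0)%:~R * s + freq_dot (tailz k) y.
Proof.
rewrite /freq_dot big_ord_recl consr0; congr (_ + _); apply: eq_bigr => j _.
by rewrite consrS mxE.
Qed.

Lemma wave_consr d (k : 'rV[int]_d.+1) s (y : 'rV[R]_d) :
  wave k (consr s y) = expi ((k 0 ord0)%:~R * s) * wave (tailz k) y.
Proof. by rewrite !waveE freq_dot_consr expiD. Qed.

Lemma tailz_eq0 d (k : 'rV[int]_d.+1) : (k == 0) = (k 0 ord0 == 0) && (tailz k == 0).
Proof.
apply/eqP/andP => [->|[/eqP k0 /eqP tk]].
  by rewrite mxE eqxx; split => //; apply/eqP/rowP => j; rewrite !mxE.
apply/rowP => j; rewrite mxE; have [i ->|->] := unliftP ord0 j; last by rewrite k0.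
by have := congr1 (fun m : 'rV[int]_d => m 0 i) tk; rewrite !mxE.
Qed.

Lemma ccube_consr d (f : 'rV[R]_d.+1 -> C) :
  ccube f = cint (fun s => ccube (fun y => f (consr s y))).
Proof. by []. Qed.

Lemma ccube_wave d (k : 'rV[int]_d) :
  ccube (wave k) = if k == 0 then ((2 * pi) ^+ d)%:C else 0 :> C.
Proof.
elim: d k => [|d IH] k.
  have -> : k = 0 by apply/rowP => -[].
  by rewrite eqxx -[LHS]/(Re (wave 0 0) +i* Im (wave 0 0)) wave0 expr0.
rewrite ccube_consr.
have -> : (fun s => ccube (fun y => wave k (consr s y))) =
  (fun s => ccube (wave (tailz k)) * expi ((k 0 ord0)%:~R * s)) :> (R -> C).
  apply/funext => s; under [X in ccube X]eq_fun do rewrite wave_consr.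
  by rewrite ccubeZ 1?mulrC//; exact: ccont_wave.
rewrite cintZ; last exact: ccont_expi.
rewrite cint_expi IH tailz_eq0 [X in _ = if X then _ else _]andbC.
by case: eqP => _ /=; case: eqP => _ /=; rewrite ?mulr0 ?mul0r// -rmorphM /= -exprSr.
Qed.

End Orthogonality.

(** * Absolutely convergent Fourier series and Fourier multipliers *)

Section Synthesis.
Context {R : realType} {d : nat}.
Local Notation C := R[i].
Local Notation K := 'rV[int]_d.
Local Notation X := 'rV[R]_d.
Implicit Types (k l : K) (x : X) (a b c : K -> C) (f g : X -> C).
Local Notation es f := (\esum_(i in [set: _]) (f i)%:E)%E.

Definition synth a x : C := csum (fun k => a k * wave k x).

Lemma asum_wave a x : asum (fun k => a k * wave k x) = asum a.
Proof. by apply: eq_esum => k _; rewrite normcM normc_wave mulr1. Qed.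

Lemma l1_wave a x : l1 a -> (asum (fun k => (a k * wave k x)%R) < +oo)%E.
Proof. by rewrite asum_wave. Qed.

Lemma normc_synth a x : ((normc (synth a x))%:E <= asum a)%E.
Proof. by apply: le_trans (normc_csum _) _; rewrite asum_wave. Qed.

Lemma synthB a b x : l1 a -> l1 b -> synth (fun k => a k - b k) x = synth a x - synth b x.
Proof.
move=> la lb; rewrite /synth -csumB; [|exact: l1_wave..].
by congr csum; apply/funext => k; rewrite mulrBl.
Qed.

Lemma synthZ z a x : l1 a -> synth (fun k => z * a k) x = z * synth a x.
Proof.
move=> la; rewrite /synth -csumZ; last exact: l1_wave.
by congr csum; apply/funext => k; rewrite mulrA.
Qed.

Definition trunc (F : seq K) a k : C := if k \in F then a k else 0.

(** The estimate is stated for all larger finite sets because summation over growing boxes needs it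
    there. *)
Lemma l1_trunc a (e : R) : l1 a -> 0 < e ->
  exists2 F : seq K, uniq F & forall G : seq K, {subset F <= G} ->
    (asum (fun k => (a k - trunc G a k)%R) <= e%:E)%E.
Proof.
move=> la e0.
have fa : (asum a \is a fin_num)%E by rewrite ge0_fin_numE ?asum_ge0.
have /ub_ereal_sup_adherent : (asum a \is a fin_num)%E by [].
move=> /(_ _ e0)[_ [A [finA _] <-]] HA.
exists (finmap.enum_fset (fset_set A)); first exact: finmap.fset_uniq.
move=> G AG.
have E : asum a = (asum (trunc G a) + asum (fun k => (a k - trunc G a k)%R))%E.
  rewrite /asum -esD; [|by move=> k; exact: normc_ge0..].
  apply: eq_esum => k _; rewrite /trunc; case: ifP => _.
    by rewrite subrr normc0 addr0.
  by rewrite subr0 normc0 add0r.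
have H1 : (\sum_(k \in A) (normc (a k))%:E <= asum (trunc G a))%E.
  apply: esum_ge; exists A; first by split.
  apply: lee_fsum => // k kA; rewrite /trunc AG//.
  by rewrite in_fset_set// inE.
have ft : (asum (trunc G a) \is a fin_num)%E.
  rewrite ge0_fin_numE ?asum_ge0//; apply: le_lt_trans la.
  by rewrite E leeDl// asum_ge0.
have H2 : (asum a - e%:E < asum (trunc G a))%E by exact: lt_le_trans HA H1.
have fr : (asum (fun k => (a k - trunc G a k)%R) \is a fin_num)%E.
  rewrite ge0_fin_numE ?asum_ge0//; apply: le_lt_trans la.
  by rewrite E leeDr// asum_ge0.
move: H2; rewrite E -(fineK ft) -(fineK fr) -EFinD lte_fin lee_fin; lra.
Qed.

Lemma synth_trunc F a x : uniq F -> synth (trunc F a) x = \sum_(k <- F) a k * wave k x.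
Proof.
move=> uF; rewrite /synth (csum_finite uF).
  by apply: eq_big_seq => k kF; rewrite /trunc kF.
by move=> k kF; rewrite /trunc (negbTE kF) mul0r.
Qed.

Lemma l1_truncf F a : l1 a -> l1 (trunc F a).
Proof.
apply: le_lt_trans; apply: le_es => k; rewrite /trunc; case: ifP => // _.
by rewrite normc0 normc_ge0.
Qed.

Lemma synth_approx a (e : R) : l1 a -> 0 < e ->
  exists2 F : seq K, uniq F & (forall x, normc (synth a x - \sum_(k <- F) a k * wave k x) <= e)
    /\ forall k, normc (a k - trunc F a k) <= e.
Proof.
move=> la e0; have [F uF HF] := l1_trunc la e0; exists F => //.
have {}HF := HF F (fun _ h => h).
split=> [x|k].
  rewrite -synth_trunc// -synthB//; last exact: l1_truncf.
  by rewrite -lee_fin; apply: le_trans (normc_synth _ _) HF.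
rewrite -lee_fin; apply: le_trans HF.
by apply: (@esum_ub R K (fun k => (normc (a k - trunc F a k))%:E)) => i; rewrite lee_fin normc_ge0.
Qed.

Lemma ccont_synth a : l1 a -> ccont (synth a).
Proof.
move=> la; apply: ccont_unif => e e0; have [F uF [HF _]] := synth_approx la e0.
exists (fun x => \sum_(k <- F) a k * wave k x) => //.
by apply: ccont_sum => k; apply: ccontM; [exact: ccont_cst|exact: ccont_wave].
Qed.

Lemma fourier_coefE f k :
  fourier_coef f k = ((2 * pi) ^- d)%:C * ccube (fun x => f x * wave (- k) x).
Proof. by []. Qed.

Lemma ccont_fw f k : ccont f -> ccont (fun x => f x * wave k x).
Proof. by move=> fc; apply: ccontM => //; exact: ccont_wave. Qed.

Lemma fourier_coefD f g k : ccont f -> ccont g ->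
  fourier_coef (fun x => f x + g x) k = fourier_coef f k + fourier_coef g k.
Proof.
move=> fc gc; rewrite !fourier_coefE -mulrDr -ccubeD; [|exact: ccont_fw..].
by congr (_ * ccube _); apply/funext => x; rewrite mulrDl.
Qed.

Lemma fourier_coefZ z f k : ccont f ->
  fourier_coef (fun x => z * f x) k = z * fourier_coef f k.
Proof.
move=> fc; rewrite !fourier_coefE mulrCA -(ccubeZ z (ccont_fw (- k) fc)).
by congr (_ * ccube _); apply/funext => x; rewrite mulrA.
Qed.

Lemma fourier_coefB f g k : ccont f -> ccont g ->
  fourier_coef (fun x => f x - g x) k = fourier_coef f k - fourier_coef g k.
Proof.
move=> fc gc; have -> : (fun x => f x - g x) = (fun x => f x + -1 * g x).
  by apply/funext => x; rewrite mulN1r.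
rewrite fourier_coefD//; last by apply: ccontM => //; exact: ccont_cst.
by rewrite fourier_coefZ// mulN1r.
Qed.

Lemma fourier_coef_bound f k M : ccont f -> (forall x, normc (f x) <= M) ->
  normc (fourier_coef f k) <= 2 * M.
Proof.
move=> fc fM; rewrite fourier_coefE normcM normc_real.
have p0 : 0 < (2 * pi) ^+ d :> R by rewrite exprn_gt0// twopi_gt0.
rewrite ger0_norm ?invr_ge0 ?(ltW p0)// ler_pdivrMl//.
rewrite mulrCA; apply: ccube_bound; first exact: ccont_fw.
by move=> y _; rewrite normcM normc_wave mulr1.
Qed.

Lemma fourier_coef_wave k l : fourier_coef (wave l) k = (l == k)%:R :> C.
Proof.
rewrite fourier_coefE; have -> : (fun x => wave l x * wave (- k) x) = (wave (l - k) : X -> C).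
  by apply/funext => x; rewrite waveD.
rewrite ccube_wave subr_eq0; case: eqP => _; last by rewrite mulr0.
by rewrite -rmorphM /= mulVf ?rmorph1// expf_neq0// gt_eqF// twopi_gt0.
Qed.

Lemma fourier_coef_sum F a k : uniq F ->
  fourier_coef (fun x => \sum_(l <- F) a l * wave l x) k = trunc F a k.
Proof.
elim: F => [_|l F IH /= /andP[lF uF]].
  under [Y in fourier_coef Y]eq_fun do rewrite big_nil.
  have -> : (fun _ : X => 0 : C) = (fun x => 0 * wave 0 x) by apply/funext => x; rewrite mul0r.
  by rewrite fourier_coefZ ?mul0r//; exact: ccont_wave.
under [Y in fourier_coef Y]eq_fun do rewrite big_cons.
rewrite fourier_coefD; first last.
- by apply: ccont_sum => j; apply: ccontM; [exact: ccont_cst|exact: ccont_wave].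
- by apply: ccontM; [exact: ccont_cst|exact: ccont_wave].
rewrite fourier_coefZ ?IH//; last exact: ccont_wave.
rewrite fourier_coef_wave /trunc in_cons eq_sym; case: eqP => [->|_] /=.
  by rewrite (negbTE lF) mulr1 addr0.
by rewrite mulr0 add0r.
Qed.

(** Orthogonality settles trigonometric polynomials. The truncation error enters with factor 2
    through the integral and with factor 1 through the coefficient, whence the tolerance [e / 3]. *)
Lemma fourier_coef_synth a k : l1 a -> fourier_coef (synth a) k = a k.
Proof.
move=> la; apply/eqP; rewrite -subr_eq0 -normc_eq0 eq_le normc_ge0 andbT.
apply/ler_addgt0Pr => e e0; rewrite add0r.
have e3 : 0 < e / 3 by rewrite divr_gt0.
have [F uF [HF HF']] := synth_approx la e3.
have cF : ccont (fun x => \sum_(l <- F) a l * wave l x).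
  by apply: ccont_sum => j; apply: ccontM; [exact: ccont_cst|exact: ccont_wave].
have cS := ccont_synth la.
have := @fourier_coef_bound (fun x => synth a x - \sum_(l <- F) a l * wave l x) k (e / 3)
  (ccontB cS cF) HF.
rewrite fourier_coefB// fourier_coef_sum// => H.
have -> : fourier_coef (synth a) k - a k =
  (fourier_coef (synth a) k - trunc F a k) - (a k - trunc F a k) by ring.
apply: le_trans (normcB _ _) _; have := HF' k; lra.
Qed.

Lemma conj_csum (T : choiceType) (c : T -> C) : (csum c)^*%C = csum (fun i => (c i)^*%C).
Proof.
rewrite /csum; apply: complex_eqP => /=.
  by congr rsum; apply/funext => i; case: (c i).
by rewrite -rsumN; congr rsum; apply/funext => i; case: (c i).
Qed.

Lemma synth_conj a x : (synth a x)^*%C = synth (cflip a) x.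
Proof.
rewrite /synth conj_csum -(@csum_reindex R _ _ (fun k => - k) (fun k => - k)
   (fun k => cflip a k * wave k x)); [|by move=> k; rewrite opprK..].
by congr csum; apply/funext => k; rewrite /cflip opprK waveN rmorphM.
Qed.

(** Cauchy product: the exponential of the output frequency factors over the three inputs, and after
    exchanging sums the inner sum over [k] is a translate of the series of [c]. *)
Lemma synth_tri a b c x : l1 a -> l1 b -> l1 c ->
  synth (tri (fun _ _ _ => 1) a b c) x = synth a x * synth b x * synth c x.
Proof.
move=> la lb lc.
pose G k (p : K * K) : C := (a p.1 * wave p.1 x) * (b p.2 * wave p.2 x) *
  (c (k - p.1 - p.2) * wave (k - p.1 - p.2) x).
have GE k p : tri_term (fun _ _ _ => 1) a b c k p * wave k x = G k p.
  rewrite /tri_term /G -[in LHS](addk3K p.1 p.2 k) !waveD addk3K; ring.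
have nG k : asum (G k) = asum (tri_term (fun _ _ _ => 1) a b c k).
  by apply: eq_esum => p _; rewrite -GE normcM normc_wave mulr1.
have sG : (\esum_(k in [set: K]) asum (G k) < +oo)%E.
  under eq_esum do rewrite nG.
  apply: (@asum_tri_le _ _ _ a b c 1 (fun k => normc (a k)) (fun k => normc (b k))
    (fun k => normc (c k))) => //; try by move=> k; exact: normc_ge0.
  by move=> k1 k2 k3; rewrite normc1 !mul1r mulrA.
have -> : synth (tri (fun _ _ _ => 1) a b c) x = csum (fun k => csum (G k)).
  congr csum; apply/funext => k; rewrite mulrC -csumZ; last exact: (tri_fin _ tribound1).
  by congr csum; apply/funext => p; rewrite -GE mulrC.
rewrite csum_swap//.
have -> : (fun p => csum (fun k => G k p)) =
  (fun p : K * K => synth c x * ((a p.1 * wave p.1 x) * (b p.2 * wave p.2 x))).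
  apply/funext => p; rewrite /G csumZ.
    rewrite mulrC; congr (_ * _).
    rewrite /synth -(@csum_reindex R _ _ (fun k => k - p.1 - p.2) (fun k => p.1 + p.2 + k)
      (fun k => c k * wave k x))//.
      by move=> k; exact: addk3K.
    by move=> k; exact: subk3K.
  rewrite (_ : asum _ = asum (fun k => c k * wave k x)); first exact: l1_wave.
  rewrite /asum -(@esum_reindex_bij R K K (fun k => k - p.1 - p.2) (fun k => p.1 + p.2 + k)
    (fun k => (normc (c k * wave k x))%:E))//.
    by move=> k; exact: addk3K.
  by move=> k; exact: subk3K.
have sAB : (\esum_(i in [set: K]) asum (fun j => (a i * wave i x * (b j * wave j x))%R) < +oo)%E.
  under eq_esum do rewrite asumZ asum_wave normcM normc_wave mulr1 -(fineK_asum lb) -EFinM mulrC.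
  rewrite esZ//; [|by rewrite fine_ge0// asum_ge0|by move=> k; exact: normc_ge0].
  by rewrite -[X in (_ * X)%E]/(asum a) -(fineK_asum la) -EFinM ltry.
rewrite csumZ.
  rewrite (csum_pair (G := fun i j => a i * wave i x * (b j * wave j x)))//.
  rewrite mulrC; congr (_ * _).
  under [Y in csum Y]eq_fun do rewrite csumZ ?l1_wave// mulrC.
  by rewrite csumZ ?l1_wave// mulrC.
rewrite /asum (esum_pair (a := fun i j => (normc (a i * wave i x * (b j * wave j x)))%:E))//.
by move=> i j; rewrite lee_fin normc_ge0.
Qed.

Lemma finite_freq_box N : finite_set (@freq_box d N).
Proof.
pose f (m : 'rV['I_(N + N).+1]_d) : K := \row_j ((m 0 j : nat)%:Z - N%:Z).
apply: (@sub_finite_set _ _ (f @` [set: 'rV['I_(N + N).+1]_d])); last first.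
  by apply: finite_image; exact: finite_finset.
move=> k kN; exists (\row_j inord (absz (k 0 j + N%:Z))) => //.
apply/rowP => j; rewrite !mxE.
have := kN j; rewrite /= ler_norml => /andP[h1 h2].
have h3 : 0 <= k 0 j + N%:Z by rewrite -lerBlDr sub0r.
rewrite inordK ?gez0_abs// ?addrK//.
by rewrite ltnS -lez_nat gez0_abs// PoszD lerD2r.
Qed.

(** Bridge from the limit over boxes, in which Fourier multipliers are defined, to unordered sums:
    the boxes eventually contain any finite set that carries the family up to a small remainder. *)
Lemma freq_sum_csum c : l1 c -> freq_sum c = csum c.
Proof.
move=> lc.
have cv (e : R) : 0 < e -> \forall N \near \oo,
    normc (csum c - \sum_(k \in freq_box N) c k) <= e.
  move=> e0; have [F uF HF] := l1_trunc lc e0.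
  (* Largest coordinate occurring in [F]: all boxes of at least this size contain [F]. *)
  pose M := (\max_(k <- F) \max_(j < d) absz (k 0%R j))%N.
  near=> N.
  have MN : (M <= N)%N by near: N; exact: nbhs_infty_ge.
  have fin := finite_freq_box N.
  pose B : seq K := finmap.enum_fset (fset_set (@freq_box d N)).
  have FN : {subset F <= B}.
    move=> k kF; rewrite in_fset_set// inE => j /=.
    rewrite -abszE lez_nat; apply: leq_trans MN.
    rewrite /M (big_rem k)//= leq_max; apply/orP; left.
    exact: (leq_bigmax j).
  rewrite fsbig_finite//.
  rewrite (_ : \sum_(k <- B) c k = csum (trunc B c)); last first.
    rewrite (csum_finite (F := B)) ?finmap.fset_uniq//.
      by apply: eq_big_seq => k kF; rewrite /trunc kF.
    by move=> k kF; rewrite /trunc (negbTE kF).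
  rewrite -csumB//; last exact: l1_truncf.
  by rewrite -lee_fin; apply: le_trans (normc_csum _) (HF _ FN).
have P (h : C -> R) : (forall z w, h z - h w = h (z - w)) -> (forall z, `|h z| <= normc z) ->
  lim (h (\sum_(k \in freq_box N) c k) @[N --> \oo]) = h (csum c).
  move=> hB hn; apply/cvg_lim => //; apply/cvgrPdist_le => e e0.
  have := cv e e0; apply: filterS => N; apply: le_trans.
  by rewrite hB.
rewrite /freq_sum P.
- rewrite P; first by case: (csum c).
  + by move=> z w; rewrite cImD cImN.
  + exact: normIm_le.
- by move=> z w; rewrite cReD cReN.
- exact: normRe_le.
Unshelve. all: by end_near.
Qed.

Lemma fmult_synth (m : R -> C) (L : R) a : (forall r, normc (m r) <= L) -> l1 a ->
  fmult m (synth a) = synth (fun k => m (- freq_sq k) * a k).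
Proof.
move=> mL la; apply/funext => x; rewrite /fmult freq_sum_csum.
  by congr csum; apply/funext => k; rewrite fourier_coef_synth.
have L0 : 0 <= L by apply: le_trans (normc_ge0 _) (mL 0).
apply: (@le_lt_trans _ _ (L%:E * asum a)%E); last first.
  by rewrite -(fineK_asum la) -EFinM ltry.
rewrite /asum -esZ//; last by move=> k; exact: normc_ge0.
apply: le_es => k; rewrite normcM normc_wave mulr1 normcM fourier_coef_synth//.
by rewrite ler_wpM2r ?normc_ge0.
Qed.

End Synthesis.

(** * A continuous function is determined by its Fourier coefficients *)

Section Completeness.
Context {R : realType}.
Local Notation C := R[i].
Local Notation leb := (@lebesgue_measure R).

Lemma rint_ge_sub (phi : R -> R) (a b c : R) : continuous phi -> 0 <= a -> a <= b -> b <= 2 * pi ->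
  (forall s, 0 <= s <= 2 * pi -> 0 <= phi s) -> (forall s, a <= s <= b -> c <= phi s) ->
  (b - a) * c <= rint phi.
Proof.
move=> pc a0 ab b2 p0 pcc.
have int1 : leb.-integrable `[a, b] (EFin \o phi).
  apply: continuous_compact_integrable; first exact: segment_compact.
  exact: continuous_subspaceT.
have int2 := cont_integrable pc.
have sub : `[a, b] `<=` `[0, 2 * pi].
  by move=> s; rewrite /= !in_itv /= => /andP[h1 h2]; apply/andP; split; lra.
apply: (@le_trans _ _ (\int[leb]_(s in `[a, b]) phi s)).
  have -> : (b - a) * c = \int[leb]_(s in `[a, b]) c.
    rewrite Rintegral_cst//= lebesgue_measure_itv /= mulrC; case: ltP => [_|h] /=.
      by rewrite mulrC.
    have -> : b = a by apply/eqP; rewrite eq_le ab andbT -lee_fin.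
    by rewrite subrr mulr0.
  have int0 : leb.-integrable `[a, b] (EFin \o (fun=> c)).
    apply: continuous_compact_integrable; first exact: segment_compact.
    by apply: continuous_subspaceT; exact: cont_cst.
  exact: (le_Rintegral _ int0 int1).
rewrite /rint /Rintegral fine_le//.
- exact: integrable_fin_num.
- exact: integrable_fin_num.
apply: ge0_subset_integral => //.
by case/integrableP : int2.
Qed.

(** Cosine decreases on [0, pi]; distances beyond pi are reflected by [t -> 2 * pi - t], and the
    reflected distance is still at least [del]. *)
Lemma cos_far (x0 s del : R) : 0 < del -> del <= x0 -> del <= 2 * pi - x0 ->
  0 <= s <= 2 * pi -> del <= `|s - x0| -> cos (s - x0) <= cos del.
Proof.
move=> d0 d1 d2 /andP[s0 s1] dd.
have p0 := pi_gt0 R.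
have E : cos (s - x0) = cos `|s - x0|.
  by have [h|h] := lerP 0 (s - x0); [rewrite ger0_norm|rewrite ltr0_norm// cosN].
have up : `|s - x0| <= 2 * pi - del by rewrite ler_norml; apply/andP; split; lra.
have dpi : del <= pi by lra.
rewrite E; move: `|_| dd up => t dt t2.
have mono u : del <= u -> u <= pi -> cos u <= cos del.
  move=> du upi; have [->//|ne] := eqVneq u del.
  apply: ltW; rewrite ltr_cos ?in_itv /=; [|lra..].
  by rewrite lt_neqAle eq_sym ne.
have [tp|tp] := lerP t pi; first exact: mono.
have -> : cos t = cos (2 * pi - t).
  by rewrite mulr_natl cosB cos2pi sin2pi mul1r mul0r addr0.
apply: mono; lra.
Qed.

Lemma cvg0_small (q p A B : R) : 0 <= q -> q < p -> 0 < B ->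
  exists m : nat, A * q ^+ m < B * p ^+ m.
Proof.
move=> q0 qp B0; have p0 : 0 < p by exact: le_lt_trans qp.
have [A0|A0] := lerP A 0.
  by exists 0%N; rewrite !expr0 !mulr1; exact: le_lt_trans A0 B0.
have r1 : `|q / p| < 1.
  by rewrite ger0_norm ?divr_ge0 ?(ltW p0)// ltr_pdivrMr// mul1r.
have := cvg_expr r1; move=> /cvgrPdist_lt/(_ (B / A)).
rewrite divr_gt0// => /(_ isT)[m _ /(_ m (leqnn m))] /=.
rewrite sub0r normrN normrX ger0_norm ?divr_ge0 ?(ltW p0)// => h.
exists m; move: h; rewrite expr_div_n ltr_pdivlMr// mulrC mulrA ltr_pdivrMr ?exprn_gt0//.
Qed.

Lemma cont_kernel (x0 : R) (m : nat) : continuous (fun s => (1 + cos (s - x0)) ^+ m).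
Proof.
move=> s; apply: (@continuous_comp _ _ _ (fun s => 1 + cos (s - x0)) (fun r : R => r ^+ m)); last exact: exprn_continuous.
apply: contD; first exact: cont_cst.
move=> t; apply: (@continuous_comp _ _ _ (fun s => s - x0) cos); last exact: continuous_cos.
by apply: contD; [by move=> u; exact: cvg_id|exact: cont_cst].
Qed.

(* The trigonometric polynomials [(1 + cos (s - x0)) ^+ m] concentrate at [x0],
   as a Fejer kernel would. *)
Lemma kernel_concentration (h : R -> R) (x0 : R) : continuous h -> 0 < x0 < 2 * pi ->
  (forall m : nat, rint (fun s => h s * (1 + cos (s - x0)) ^+ m) = 0) -> h x0 <= 0.
Proof.
move=> hc /andP[x00 x01] H; rewrite leNgt; apply/negP => hx.
have e0 : 0 < h x0 / 2 by rewrite divr_gt0.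
have /cvgrPdist_le/(_ _ e0)/nbhs_ballP[r /= r0 Hr] := hc x0.
have [del [d0 d1 d2 dr]] : exists del, [/\ 0 < del, del <= x0, del <= 2 * pi - x0 & del < r].
  exists (Num.min (r / 2) (Num.min x0 (2 * pi - x0))); split.
  - by rewrite !lt_min divr_gt0//= x00 subr_gt0.
  - by rewrite !ge_min lexx orbT.
  - by rewrite !ge_min lexx !orbT.
  - apply: (@le_lt_trans _ _ (r / 2)); first by rewrite ge_min lexx.
    by rewrite ltr_pdivrMr// ltr_pMr// ltr1n.
have near s : `|s - x0| <= del -> h x0 / 2 <= h s.
  move=> sd; have /Hr : ball x0 r s by rewrite /ball /= distrC; exact: le_lt_trans sd dr.
  by rewrite /= ler_norml => /andP[_]; lra.
have [M M0 HM] : exists2 M, 0 <= M & forall s, 0 <= s <= 2 * pi -> `|h s| <= M.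
  have [|c _ Hc] := @EVT_max R (fun s => `|h s|) 0 (2 * pi) (ltW twopi_gt0).
    by apply: continuous_subspaceT => s; apply: (@continuous_comp _ _ _ h (fun r : R => `|r|)); [exact: hc|exact: norm_continuous].
  by exists `|h c| => // s sI; apply: Hc; rewrite in_itv.
have p0 := pi_gt0 R.
have dpi : del <= pi by lra.
have cKm m := @cont_kernel x0 m.
(* At distance more than [del] from [x0] the kernel is at most [q ^+ m], and within [del / 2] it is
   at least [p ^+ m]. Since [q < p], the neighbourhood of [x0] wins for large [m]. *)
pose q := 1 + cos del; pose p := 1 + cos (del / 2).
have K0 s : 0 <= 1 + cos s :> R by have := cos_geN1 s; lra.
have qp : q < p.
  by rewrite ltrD2l ltr_cos ?in_itv /=; [lra|apply/andP; split; lra|apply/andP; split; lra].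
have [m Hm] := @cvg0_small q p (2 * pi * M) (del * (h x0 / 2)) (K0 _) qp (mulr_gt0 d0 e0).
have qm0 : 0 <= q ^+ m by rewrite exprn_ge0// K0.
have pm0 : 0 <= p ^+ m by rewrite exprn_ge0// K0.
(* Adding [M * q ^+ m] makes the integrand nonnegative on the whole period, so its integral over the
   small interval is a lower bound. *)
have cphi : continuous (fun s => h s * (1 + cos (s - x0)) ^+ m + M * q ^+ m).
  by apply: contD; [exact: contM|exact: cont_cst].
have cosabs s : cos (s - x0) = cos `|s - x0|.
  by have [g|g] := lerP 0 (s - x0); [rewrite ger0_norm|rewrite ltr0_norm// cosN].
have phi0 s : 0 <= s <= 2 * pi -> 0 <= h s * (1 + cos (s - x0)) ^+ m + M * q ^+ m.
  move=> sI; have [sd|sd] := lerP `|s - x0| del.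
    rewrite addr_ge0// ?mulr_ge0// ?exprn_ge0//.
    by apply: le_trans (near s sd); exact: ltW.
  have Kq : (1 + cos (s - x0)) ^+ m <= q ^+ m.
    by rewrite lerXn2r ?nnegrE ?K0// lerD2l cos_far// ltW.
  have hM : - M <= h s by have := HM s sI; rewrite ler_norml => /andP[].
  have := ler_wpM2l M0 Kq; have := ler_wpM2r (exprn_ge0 m (K0 (s - x0))) hM.
  by rewrite mulNr; lra.
have phip s : x0 - del / 2 <= s <= x0 + del / 2 ->
    h x0 / 2 * p ^+ m <= h s * (1 + cos (s - x0)) ^+ m + M * q ^+ m.
  move=> /andP[s1 s2]; have sd : `|s - x0| <= del / 2 by rewrite ler_norml; apply/andP; split; lra.
  have h1 : h x0 / 2 <= h s by apply: near; lra.
  have Kp : p ^+ m <= (1 + cos (s - x0)) ^+ m.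
    rewrite lerXn2r ?nnegrE ?K0// lerD2l cosabs.
    have [->//|ne] := eqVneq `|s - x0| (del / 2).
    have n0 := normr_ge0 (s - x0); apply: ltW; rewrite ltr_cos ?in_itv /=.
    - by rewrite lt_neqAle ne.
    - by apply/andP; split; lra.
    - by apply/andP; split; lra.
  rewrite -[leLHS]addr0 lerD ?mulr_ge0//.
  by apply: ler_pM => //; exact: ltW.
have g1 : 0 <= x0 - del / 2 by lra.
have g2 : x0 - del / 2 <= x0 + del / 2 by lra.
have g3 : x0 + del / 2 <= 2 * pi by lra.
have := rint_ge_sub cphi g1 g2 g3 phi0 phip.
rewrite rintD ?H ?add0r ?rint_cst//; [|exact: contM|exact: cont_cst].
rewrite (_ : x0 + del / 2 - (x0 - del / 2) = del); last by field.
by rewrite !mulrA in Hm *; rewrite leNgt Hm.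
Qed.

(** Multiplication by [1 + cos (s - x0)] only mixes a frequency with its two neighbours, so the
    vanishing of all Fourier integrals is preserved. *)
Lemma cint_kernel (g : R -> C) (x0 : R) (m : nat) : ccont g ->
  (forall n : int, cint (fun s => g s * expi (n%:~R * s)) = 0) ->
  forall n : int, cint (fun s => g s * ((1 + cos (s - x0)) ^+ m)%:C * expi (n%:~R * s)) = 0.
Proof.
move=> gc H; elim: m => [|m IH] n.
  by under [X in cint X]eq_fun do rewrite expr0 mulr1; exact: H.
pose G s := g s * ((1 + cos (s - x0)) ^+ m)%:C.
have cG : ccont G.
  apply: ccontM => //; split => /=; last exact: cont_cst.
  exact: cont_kernel.
have ce (l : int) : ccont (fun s => G s * expi (l%:~R * s)) by apply: ccontM => //; exact: ccont_expi.
have E s : G s * (1 + cos (s - x0))%:C * expi (n%:~R * s) =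
   G s * expi (n%:~R * s) + (expi (- x0) / 2 * (G s * expi ((n + 1)%:~R * s)) +
     expi x0 / 2 * (G s * expi ((n - 1)%:~R * s))).
  rewrite [(1 + _)%:C]rmorphD /=; have -> : (cos (s - x0))%:C = (expi (s - x0) + expi (x0 - s)) / 2 :> C.
    have -> : x0 - s = - (s - x0) by rewrite opprB.
    rewrite expiN; apply: (canRL (mulfK _)); first by rewrite pnatr_eq0.
    by apply: complex_eqP; rewrite ?cReM ?cImM ?cReD ?cImD /=; ring.
  rewrite !intrD !mulrDl mul1r mulN1r !expiD rmorph1 /=; ring.
have -> : (fun s => g s * ((1 + cos (s - x0)) ^+ m.+1)%:C * expi (n%:~R * s)) =
   (fun s => G s * expi (n%:~R * s) + (expi (- x0) / 2 * (G s * expi ((n + 1)%:~R * s)) +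
     expi x0 / 2 * (G s * expi ((n - 1)%:~R * s)))).
  by apply/funext => s; rewrite -E /G exprSr rmorphM /=; ring.
rewrite cintD//; last by apply: ccontD; apply: ccontM => //; exact: ccont_cst.
rewrite cintD; [|by apply: ccontM => //; exact: ccont_cst..].
by rewrite !cintZ// !IH !mulr0 !addr0.
Qed.

Lemma fourier_unique1 (g : R -> C) (x0 : R) : ccont g -> 0 < x0 < 2 * pi ->
  (forall n : int, cint (fun s => g s * expi (n%:~R * s)) = 0) -> g x0 = 0.
Proof.
move=> gc x0I H; apply/eqP; rewrite -normc_eq0 eq_le normc_ge0 andbT.
have [e [_ <-]] := normc_polar (g x0).
have [c1 c2] : ccont (fun s => e * g s) by apply: ccontM => //; exact: ccont_cst.
apply: (kernel_concentration c1 x0I) => m.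
have cK : ccont (fun s => ((1 + cos (s - x0)) ^+ m)%:C : C).
  split => /=; last exact: cont_cst.
  exact: cont_kernel.
have := cint_kernel x0 m gc H 0.
under [X in cint X]eq_fun do rewrite mulr0z mul0r expi0 mulr1.
move=> /(congr1 (fun z => e * z)); rewrite mulr0 -cintZ; last exact: ccontM.
move=> /(congr1 (@complex.Re R)) /= <-; congr rint; apply/funext => s.
by rewrite mulrA [in RHS]cReM /= mulr0 subr0.
Qed.

Definition consz d (n : int) (k : 'rV[int]_d) : 'rV[int]_d.+1 :=
  \row_j (if unlift ord0 j is Some i then k 0 i else n).

Lemma consz0 d n (k : 'rV[int]_d) : consz n k 0 ord0 = n.
Proof. by rewrite mxE unlift_none. Qed.

Lemma tailz_consz d n (k : 'rV[int]_d) : tailz (consz n k) = k.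
Proof. by apply/rowP => j; rewrite !mxE liftK. Qed.

Lemma consz_tailz d (k : 'rV[int]_d.+1) : consz (k 0 ord0) (tailz k) = k.
Proof.
by apply/rowP => j; rewrite mxE; have [i ->|->] := unliftP ord0 j; rewrite ?mxE.
Qed.

Lemma ccont_slice d (f : 'rV[R]_d.+1 -> C) s : ccont f -> ccont (fun y => f (consr s y)).
Proof.
by move=> [f1 f2]; split; [exact: (@continuous_slice R d _ s f1)|exact: (@continuous_slice R d _ s f2)].
Qed.

Lemma ccont_param d (f : 'rV[R]_d.+1 -> C) : ccont f ->
  ccont (fun s => ccube (fun y => f (consr s y))).
Proof.
by move=> [f1 f2]; split; [exact: (@slice_param R d _ (@cube_specP R d) f1)|exact: (@slice_param R d _ (@cube_specP R d) f2)].
Qed.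

(** Induction on the dimension: integrating [f * wave k] over all but the first coordinate gives a
    function of one variable with vanishing Fourier integrals. It is zero at each interior point,
    and the slice there satisfies the induction hypothesis. *)
Lemma fourier_unique_interior d (f : 'rV[R]_d -> C) : ccont f ->
  (forall k : 'rV[int]_d, ccube (fun x => f x * wave k x) = 0) ->
  forall x : 'rV[R]_d, (forall j, 0 < x 0 j < 2 * pi) -> f x = 0.
Proof.
elim: d f => [|d IH] f fc H x xI.
  have := H 0; rewrite -[ccube _]/(Re (f 0 * wave 0 0) +i* Im (f 0 * wave 0 0)) wave0 mulr1.
  have -> : x = 0 by apply/rowP => -[].
  by case: (f 0).
pose y : 'rV[R]_d := \row_j x 0 (lift ord0 j).
have xE : x = consr (x 0 ord0) y.
  by apply/rowP => j; have [i ->|->] := unliftP ord0 j; rewrite ?consrS ?consr0 ?mxE.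
rewrite xE; apply: (IH (fun y => f (consr (x 0 ord0) y))).
- exact: ccont_slice.
- move=> k.
  have fk : ccont (fun z : 'rV[R]_d.+1 => f z * wave (consz 0 k) z) by exact: ccont_fw.
  have gE s : ccube (fun y => f (consr s y) * wave k y) =
      ccube (fun y => f (consr s y) * wave (consz 0 k) (consr s y)).
    congr ccube; apply/funext => z.
    by rewrite wave_consr consz0 tailz_consz mulr0z mul0r expi0 mul1r.
  rewrite gE; apply: (fourier_unique1 (g := fun s => ccube (fun y => f (consr s y) * wave (consz 0 k) (consr s y)))).
  + exact: (ccont_param fk).
  + exact: xI.
  move=> n; rewrite -[RHS](H (consz n k)) ccube_consr; congr cint; apply/funext => s.
  rewrite mulrC -ccubeZ; last exact: (ccont_slice s fk).
  congr ccube; apply/funext => z.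
  by rewrite !wave_consr !consz0 !tailz_consz mulr0z mul0r expi0 mul1r; ring.
by move=> j; rewrite mxE; exact: xI.
Qed.

End Completeness.

(** * Fourier inversion for periodic functions *)

Section Inversion.
Context {R : realType} {d : nat}.
Local Notation C := R[i].
Local Notation K := 'rV[int]_d.
Local Notation X := 'rV[R]_d.
Implicit Types (f g : X -> C) (x y : X).

Lemma periodic_nat f (j : 'I_d) (n : nat) x : periodic f ->
  f (x + (n%:R * (2 * pi)) *: delta_mx 0 j) = f x.
Proof.
move=> fp; elim: n => [|n IH]; first by rewrite mul0r scale0r addr0.
by rewrite -natr1 mulrDl mul1r scalerDl addrA fp IH.
Qed.

Lemma periodic_int f (j : 'I_d) (n : int) x : periodic f ->
  f (x + (n%:~R * (2 * pi)) *: delta_mx 0 j) = f x.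
Proof.
move=> fp; case: n => n; first exact: periodic_nat.
rewrite -[RHS](periodic_nat j n.+1 _ fp) NegzE mulrNz mulNr scaleNr.
rewrite -[in LHS](periodic_nat j n.+1 _ fp).
by rewrite subrK periodic_nat.
Qed.

Lemma periodic_row f (n : 'I_d -> int) x : periodic f ->
  f (x + \row_j ((n j)%:~R * (2 * pi))) = f x.
Proof.
move=> fp.
have -> : \row_j ((n j)%:~R * (2 * pi)) =
    \sum_j ((n j)%:~R * (2 * pi)) *: delta_mx 0 j :> X.
  rewrite [LHS]row_sum_delta; apply: eq_bigr => j _; by rewrite mxE.
elim: (index_enum _) => [|j r IH]; first by rewrite big_nil addr0.
by rewrite big_cons addrA addrAC periodic_int.
Qed.

Lemma periodic_cube x : exists2 y, cube y & forall f, periodic f -> f x = f y.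
Proof.
pose n j := Num.floor (x 0 j / (2 * pi)).
exists (x + \row_j ((- n j)%:~R * (2 * pi))).
  move=> j; rewrite !mxE mulrNz mulNr.
  have h1 := Num.Theory.floor_le (x 0 j / (2 * pi)).
  have h2 := Num.Theory.floorD1_gt (x 0 j / (2 * pi)).
  move: h1 h2; rewrite -/(n j) ler_pdivlMr ?twopi_gt0// ltr_pdivrMr ?twopi_gt0//.
  rewrite intrD => h1 h2; rewrite subr_ge0 h1 /= lerBlDl ltW//.
  by have -> : (n j)%:~R * (2 * pi) + 2 * pi = ((n j)%:~R + 1%:~R) * (2 * pi) :> R by ring.
by move=> f fp; rewrite (periodic_row (fun j => - n j)).
Qed.

(** Boundary points are limits of interior points along the segment to the centre of the cube. *)
Lemma zero_cube f : ccont f -> (forall x, (forall j, 0 < x 0 j < 2 * pi) -> f x = 0) ->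
  forall x, cube x -> f x = 0.
Proof.
move=> [f1 f2] f0 x xc.
pose c : X := const_mx pi.
have p0 := pi_gt0 R.
have key (h : X -> R) : continuous h -> (forall y, (forall j, 0 < y 0 j < 2 * pi) -> h y = 0) ->
  h x = 0.
  move=> hc h0; apply/eqP; rewrite -normr_eq0 eq_le normr_ge0 andbT.
  apply/ler_addgt0Pr => e e0; rewrite add0r.
  pose g (t : R) := h (x + t *: (c - x)).
  have gc : {for 0, continuous g}.
    apply: (@continuous_comp _ _ _ (fun t : R => x + t *: (c - x)) h); last exact: hc.
    by apply: cvgD; [exact: cvg_cst|apply: cvgZr_tmp; exact: cvg_id].
  have /cvgrPdist_le/(_ _ e0)/nbhs_ballP[r /= r0 Hr] := gc.
  pose t := Num.min (r / 2) 1.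
  have t0 : 0 < t by rewrite lt_min divr_gt0//= ltr01.
  have t1 : t <= 1 by rewrite ge_min lexx orbT.
  have tr : t < r.
    apply: (@le_lt_trans _ _ (r / 2)); first by rewrite ge_min lexx.
    by rewrite ltr_pdivrMr// ltr_pMr// ltr1n.
  have := Hr t; rewrite /ball /= sub0r normrN gtr0_norm// => /(_ tr).
  rewrite /g scale0r addr0 (h0 (x + t *: (c - x))) ?subr0// => j.
  rewrite !mxE; have /andP[x0 x2] := xc j.
  have -> : x 0 j + t * (pi - x 0 j) = (1 - t) * x 0 j + t * pi by ring.
  have s0 : 0 <= 1 - t by rewrite subr_ge0.
  apply/andP; split; first by rewrite ltr_wpDl ?mulr_ge0 ?mulr_gt0.
  have H1 := ler_wpM2l s0 x2; have H2 := mulr_gt0 t0 p0; nra.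
apply: complex_eqP.
  by apply: key f1 _ => y yI; rewrite f0.
by apply: key f2 _ => y yI; rewrite f0.
Qed.

Lemma periodic_wave (k : K) : periodic (wave k : X -> C).
Proof.
move=> x j; rewrite !waveE.
have -> : freq_dot k (x + (2 * pi) *: delta_mx 0 j) = freq_dot k x + (k 0 j)%:~R * (2 * pi).
  rewrite /freq_dot (bigD1 j)//= [in RHS](bigD1 j)//= !mxE !eqxx mulr1 mulrDr.
  rewrite addrAC; congr (_ + _); congr (_ + _).
  by apply: eq_bigr => i ij; rewrite !mxE eqxx (negbTE ij) mulr0 addr0.
by rewrite expiD expi_int mulr1.
Qed.

Lemma periodic_synth (a : K -> C) : periodic (synth a : X -> C).
Proof.
by move=> x j; congr csum; apply/funext => k; rewrite periodic_wave.
Qed.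

(** The difference between the function and its series is continuous and periodic with vanishing
    coefficients: uniqueness treats the interior of the cube, continuity its boundary, and
    periodicity everything else. *)
Lemma fourier_inversion f : ccont f -> periodic f -> l1 (fourier_coef f) ->
  f = synth (fourier_coef f).
Proof.
move=> fc fp la; apply/funext => x; apply/eqP; rewrite -subr_eq0; apply/eqP.
set a := fourier_coef f in la *.
have cS := ccont_synth la.
have [y yc E] := periodic_cube x.
rewrite (E _ fp) (E _ (periodic_synth a)) {E x}.
apply: (zero_cube (f := fun y => f y - synth a y)) yc; first exact: ccontB.
apply: fourier_unique_interior; first exact: ccontB.
move=> k; have := fourier_coefB (- k) fc cS.
rewrite fourier_coef_synth// -/a subrr fourier_coefE opprK => /eqP.
rewrite mulf_eq0 => /orP[|/eqP//].
by rewrite -normc_eq0 normc_real normr_eq0 invr_eq0 expf_eq0 gt_eqF ?andbF// twopi_gt0.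
Qed.

End Inversion.

(** * Integration by parts and Fourier coefficients of derivatives *)

Section IntegrationByParts.
Context {R : realType}.
Local Notation C := R[i].

(** A directional derivative sees only the restriction to a line. It can thus be transported between
    spaces, here from a point of the cube to a slice or to one real variable. *)
Lemma is_derive_line (V W : normedModType R) (f : V -> R) (g : W -> R) x v x' v' (df : R) :
  (forall h : R, f (h *: v + x) = g (h *: v' + x')) -> is_derive x v f df -> is_derive x' v' g df.
Proof.
move=> fg [fd fE].
have E0 : f x = g x' by have := fg 0; rewrite !scale0r !add0r.
have E : (fun h : R => h^-1 *: ((f \o shift x) (h *: v) - f x)) =
   (fun h : R => h^-1 *: ((g \o shift x') (h *: v') - g x')).
  by apply/funext => h; rewrite /= fg E0.
have gd : derivable g x' v' by rewrite /derivable -E.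
by apply: DeriveDef => //; rewrite /derive -E.
Qed.

Lemma consr_addl d (s h : R) (y : 'rV[R]_d) : h *: delta_mx 0 ord0 + consr s y = consr (h + s) y.
Proof.
apply/rowP => j; rewrite [LHS]mxE [X in X + _]mxE [X in h * X]mxE.
have [i ->|->] := unliftP ord0 j.
  by rewrite !consrS eqxx /= mulr0 add0r.
by rewrite !consr0 !eqxx mulr1.
Qed.

Lemma consr_addr d (s h : R) (y : 'rV[R]_d) (i : 'I_d) :
  h *: delta_mx 0 (lift ord0 i) + consr s y = consr s (h *: delta_mx 0 i + y).
Proof.
apply/rowP => j; rewrite [LHS]mxE [X in X + _]mxE [X in h * X]mxE.
have [l ->|->] := unliftP ord0 j.
  by rewrite !consrS !mxE eqxx /= (inj_eq lift_inj).
by rewrite !consr0 eqxx /= mulr0 add0r.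
Qed.

(** Along the first coordinate the derivative passes under the inner integral, and the fundamental
    theorem leaves a difference that periodicity cancels. Along any other coordinate each slice
    vanishes by induction. *)
Lemma cube_derivative0 d (j : 'I_d) (f D : 'rV[R]_d -> R) : continuous f -> continuous D ->
  (forall x, is_derive x (delta_mx 0 j) f (D x)) ->
  (forall x, f (x + (2 * pi) *: delta_mx 0 j) = f x) ->
  cube_integral D = 0.
Proof.
elim: d j f D => [[]//|d IH] j f D fc Dc fD fper.
have [i ji|j0] := unliftP ord0 j.
  have E s : cube_integral (fun y => D (consr s y)) = 0.
    apply: (IH i (fun y => f (consr s y))).
    - exact: continuous_slice.
    - exact: continuous_slice.
    - move=> y; apply: is_derive_line (fD (consr s y)) => h.
      by rewrite ji consr_addr.
    - move=> y; rewrite addrC -consr_addr addrC -ji; exact: fper.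
  rewrite -[LHS]/(rint (fun s => cube_integral (fun y => D (consr s y)))).
  by under [X in rint X]eq_fun do rewrite E; rewrite rint_cst mulr0.
have HD := @cube_derive R d (fun s y => f (consr s y)) (fun s y => D (consr s y)).
rewrite -[LHS]/(rint (fun s => cube_integral (fun y => D (consr s y)))).
have GD (s : R) : is_derive s 1 (fun s => cube_integral (fun y => f (consr s y)))
    (cube_integral (fun y => D (consr s y))).
  apply: HD.
  - near=> t => y; apply: is_derive_line (fD (consr t y)) => h.
    by rewrite j0 consr_addl /GRing.scale /= mulr1.
  - move=> y; apply: (@continuous_comp _ _ _ (fun p => consr p.1 p.2) D); last exact: Dc.
    exact: consr_cont.
  - by near=> t; exact: continuous_slice.
  - exact: continuous_slice.
have -> := rint_FTC (@slice_param R d _ (@cube_specP R d) Dc) GD.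
apply/eqP; rewrite subr_eq0; apply/eqP; congr cube_integral; apply/funext => y.
have := consr_addl 0 (2 * pi) y; rewrite addr0 => <-.
by rewrite addrC -j0 fper.
Unshelve. all: by end_near.
Qed.

End IntegrationByParts.

Section FourierDerivatives.
Context {R : realType} {d : nat}.
Local Notation C := R[i].
Local Notation K := 'rV[int]_d.
Local Notation X := 'rV[R]_d.
Implicit Types (f g : X -> C) (x y : X) (j : 'I_d) (k : K).

Definition is_pderive j f x (z : C) : Prop :=
  is_derive x (delta_mx 0 j) (fun y => Re (f y)) (Re z) /\
  is_derive x (delta_mx 0 j) (fun y => Im (f y)) (Im z).

Lemma partial_derive j f x : cderivable f x (delta_mx 0 j) -> is_pderive j f x (partial j f x).
Proof. by move=> [h1 h2]; split; [exact: DeriveDef h1 erefl|exact: DeriveDef h2 erefl]. Qed.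

Lemma pderive_line j f x z : is_pderive j f x z <->
  is_cderive (fun h : R => f (h *: delta_mx 0 j + x)) 0 z.
Proof.
split=> -[h1 h2]; split.
- by apply: is_derive_line h1 => h; rewrite addr0 /GRing.scale /= mulr1.
- by apply: is_derive_line h2 => h; rewrite addr0 /GRing.scale /= mulr1.
- by apply: is_derive_line h1 => h; rewrite addr0 /GRing.scale /= mulr1.
- by apply: is_derive_line h2 => h; rewrite addr0 /GRing.scale /= mulr1.
Qed.

Lemma ccube_pderive0 j f D : ccont f -> ccont D -> periodic f ->
  (forall x, is_pderive j f x (D x)) -> ccube D = 0.
Proof.
move=> [f1 f2] [d1 d2] fp fD; rewrite /ccube.
have -> : cube_integral (fun x => Re (D x)) = 0.
  apply: (@cube_derivative0 R d j (fun x => Re (f x))) => // x; first by have [] := fD x.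
  by rewrite fp.
have -> : cube_integral (fun x => Im (D x)) = 0.
  apply: (@cube_derivative0 R d j (fun x => Im (f x))) => // x; first by have [] := fD x.
  by rewrite fp.
by [].
Qed.

Lemma is_pderive_wave j k x : is_pderive j (wave k) x ('i%C * ((k 0 j)%:~R)%:C * wave k x).
Proof.
apply/pderive_line.
have E (h : R) : wave k (h *: delta_mx 0 j + x) = expi ((k 0 j)%:~R * h) * wave k x.
  rewrite !waveE -expiD; congr expi.
  rewrite /freq_dot (bigD1 j)//= [in RHS](bigD1 j)//= !mxE !eqxx mulr1 mulrDr -addrA.
  congr (_ + (_ + _)); apply: eq_bigr => i ij.
  by rewrite !mxE eqxx (negbTE ij) mulr0 add0r.
apply: (@is_cderive_ext _ (fun h => wave k x * expi ((k 0 j)%:~R * h))).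
  by move=> h; rewrite E mulrC.
have H := is_cderiveZ (wave k x) (is_cderive_expi (k 0 j)%:~R 0).
by apply: (is_cderive_eq _ H); rewrite mulr0 expi0 mulr1 mulrC.
Qed.

(** The derivative of [f * wave (- k)] integrates to zero, and the product rule splits this integral
    into the two sides. *)
Lemma fourier_coef_partial j f D k : ccont f -> ccont D -> periodic f ->
  (forall x, is_pderive j f x (D x)) ->
  fourier_coef D k = 'i%C * ((k 0 j)%:~R)%:C * fourier_coef f k.
Proof.
move=> fc Dc fp fD.
have fw := ccont_fw (- k) fc; have Dw := ccont_fw (- k) Dc.
have fwp : periodic (fun x => f x * wave (- k) x).
  by move=> x i; rewrite fp periodic_wave.
have H x : is_pderive j (fun x => f x * wave (- k) x) x
   (D x * wave (- k) x + - ('i%C * ((k 0 j)%:~R)%:C) * (f x * wave (- k) x)).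
  apply/pderive_line.
  have h1 := is_cderiveM ((pderive_line _ _ _ _).1 (fD x))
    ((pderive_line _ _ _ _).1 (is_pderive_wave j (- k) x)).
  apply: (is_cderive_eq _ h1).
  by rewrite scale0r add0r mxE rmorphN rmorphN /=; ring.
have := ccube_pderive0 fw _ fwp H.
rewrite ccubeD//; last by apply: ccontM => //; exact: ccont_cst.
rewrite ccubeZ// mulNr => /(_ _)E.
rewrite !fourier_coefE mulrCA; congr (_ * _); apply/eqP; rewrite -subr_eq0; apply/eqP.
apply: E; apply: ccontD => //; apply: ccontM => //; exact: ccont_cst.
Qed.

Lemma periodic_partial j f : periodic f -> periodic (partial j f).
Proof.
move=> fp x i; rewrite /partial /cderive /derive.
have E (P : C -> R) : (fun h : R => h^-1 *: (((fun y => P (f y)) \o shift (x + (2 * pi) *: delta_mx 0 i)) (h *: delta_mx 0 j)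
    - P (f (x + (2 * pi) *: delta_mx 0 i)))) =
   (fun h : R => h^-1 *: (((fun y => P (f y)) \o shift x) (h *: delta_mx 0 j) - P (f x))).
  by apply/funext => h; rewrite /= addrA !fp.
by rewrite (E (@complex.Re R)) (E (@complex.Im R)).
Qed.

Lemma fourier_coef_laplacian f k : ccont f -> periodic f ->
  (forall j, ccont (partial j f)) -> (forall j, ccont (partial j (partial j f))) ->
  (forall x j, cderivable f x (delta_mx 0 j)) ->
  (forall x j, cderivable (partial j f) x (delta_mx 0 j)) ->
  fourier_coef (laplacian f) k = - (freq_sq k)%:C * fourier_coef f k.
Proof.
move=> fc fp c1 c2 d1 d2.
have P j : fourier_coef (partial j (partial j f)) k = - ((k 0 j)%:~R ^+ 2)%:C * fourier_coef f k.
  rewrite (fourier_coef_partial (j := j) k (c1 j) (c2 j)); first last.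
  - by move=> x; apply: partial_derive; exact: d2.
  - exact: periodic_partial.
  rewrite (fourier_coef_partial (j := j) k fc (c1 j) fp); last first.
    by move=> x; apply: partial_derive; exact: d1.
  have i2 : 'i%C * 'i%C = -1 :> C by rewrite -expr2 sqr_i.
  set a := (_%:~R)%:C; set z := fourier_coef f k.
  have -> : 'i%C * a * ('i%C * a * z) = ('i%C * 'i%C) * (a * a * z) by ring.
  by rewrite i2 [(_ ^+ 2)%:C]rmorphXn /= -/a; ring.
have Q (r : seq 'I_d) : fourier_coef (fun x => \sum_(j <- r) partial j (partial j f) x) k =
   - (\sum_(j <- r) (k 0 j)%:~R ^+ 2)%:C * fourier_coef f k.
  elim: r => [|j r IH].
    rewrite big_nil; under [Y in fourier_coef Y]eq_fun do rewrite big_nil.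
    have -> : (fun _ : X => 0 : C) = (fun x => 0 * f x) by apply/funext => x; rewrite mul0r.
    by rewrite fourier_coefZ// mul0r oppr0 mul0r.
  rewrite big_cons; under [Y in fourier_coef Y]eq_fun do rewrite big_cons.
  rewrite fourier_coefD//; last exact: ccont_sum.
  by rewrite IH P rmorphD /=; ring.
exact: Q.
Qed.

End FourierDerivatives.

Section Clamp.
Context {R : realType} (T : R).

(* [t] projected to [0, T]: composing with it makes the solution, which is
   known only on [0, T], continuous in time on all of R. *)
Definition clamp (t : R) : R :=
  let a := (t + `|t|) / 2 in (a + T - `|a - T|) / 2.

Lemma clamp_cont : continuous clamp.
Proof.
have cN : continuous (fun r : R => `|r|) by move=> r; exact: norm_continuous.
have ca : continuous (fun t : R => (t + `|t|) / 2).
  apply: contM; last exact: cont_cst.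
  by apply: contD; [by move=> r; exact: cvg_id|exact: cN].
have cb : continuous (fun t : R => (t + `|t|) / 2 - T).
  by apply: contD => //; exact: cont_cst.
apply: contM; last exact: cont_cst.
apply: contD; first by apply: contD => //; exact: cont_cst.
have -> : (fun x : R => - `|(x + `|x|) / 2 - T|) = (fun x => -1 * `|(x + `|x|) / 2 - T|).
  by apply/funext => x; rewrite mulN1r.
apply: contZ => r; apply: (@continuous_comp _ _ _ (fun t : R => (t + `|t|) / 2 - T) (fun r : R => `|r|)).
  exact: cb.
exact: cN.
Qed.

Lemma clamp_id t : 0 <= t <= T -> clamp t = t.
Proof.
move=> /andP[t0 tT]; rewrite /clamp ger0_norm// (_ : (t + t) / 2 = t); last by lra.
by rewrite ler0_norm ?subr_le0//; lra.
Qed.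

Lemma clamp_itv t : 0 <= T -> 0 <= clamp t <= T.
Proof.
move=> T0; rewrite /clamp; set a := (t + _) / 2.
have a0 : 0 <= a by rewrite /a; have [h|h] := lerP 0 t; [rewrite ger0_norm//|rewrite ltr0_norm//]; lra.
by clearbody a; have [h|h] := lerP 0 (a - T); [rewrite ger0_norm//|rewrite ltr0_norm//]; apply/andP; split; lra.
Qed.

End Clamp.

(** * Fourier coefficients of the exact solution *)

Section CoefficientEquations.
Context {R : realType} {d : nat}.
Local Notation C := R[i].
Local Notation K := 'rV[int]_d.
Local Notation X := 'rV[R]_d.
Local Notation cubic m a := (tri m a a (cflip a)).

Lemma ccont_coef_param (F : R -> X -> C) k : ccont (fun p : R * X => F p.1 p.2) ->
  ccont (fun t => fourier_coef (F t) k).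
Proof.
move=> Fc.
have Fw : ccont (fun p : R * X => F p.1 p.2 * wave (- k) p.2).
  apply: ccontM => //; apply: (ccont_comp (h := snd)); last exact: ccont_wave.
  by move=> p; exact: cvg_snd.
have sl t : ccont (fun y => F t y * wave (- k) y).
  apply: (ccont_comp (f := fun p : R * X => F p.1 p.2 * wave (- k) p.2) (h := fun y => (t, y))) => //.
  by move=> y; apply: (@cvg_pair _ _ _ (nbhs y) (nbhs t) (nbhs y) _ _ _ (fun=> t) id); [exact: cvg_cst|exact: cvg_id].
under [Y in ccont Y]eq_fun do rewrite fourier_coefE.
apply: ccontM; first exact: ccont_cst.
have [w1 w2] := Fw.
split => t0 /=.
  apply: (@cube_param R d R (fun t y => Re (F t y * wave (- k) y))).
    by move=> y; exact: w1.
  by near=> t; have [] := sl t.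
apply: (@cube_param R d R (fun t y => Im (F t y * wave (- k) y))).
  by move=> y; exact: w2.
by near=> t; have [] := sl t.
Unshelve. all: by end_near.
Qed.

Lemma fourier_coef_derive (F D : R -> X -> C) (t0 : R) k :
  (\forall t \near t0, forall y, is_cderive (F ^~ y) t (D t y)) ->
  (forall y, {for (t0, y), continuous (fun p : R * X => Re (D p.1 p.2))}) ->
  (forall y, {for (t0, y), continuous (fun p : R * X => Im (D p.1 p.2))}) ->
  (\forall t \near t0, ccont (F t)) -> ccont (D t0) ->
  is_cderive (fun t => fourier_coef (F t) k) t0 (fourier_coef (D t0) k).
Proof.
move=> FD Dc1 Dc2 Fc D0.
have wc : ccont (fun p : R * X => wave (- k) p.2 : C).
  by apply: (ccont_comp (h := snd)); [move=> p; exact: cvg_snd|exact: ccont_wave].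
have [w1 w2] := wc.
have FwD : \forall t \near t0, forall y, is_cderive (fun t => F t y * wave (- k) y) t (D t y * wave (- k) y).
  apply: filterS FD => t Ht y.
  have H := is_cderiveM (Ht y) (is_cderive_cst (wave (- k) y) t).
  by apply: (is_cderive_eq _ H); rewrite mulr0 addr0.
have DwC : ccont (fun y => D t0 y * wave (- k) y) by exact: ccont_fw.
have FwC : \forall t \near t0, ccont (fun y => F t y * wave (- k) y).
  by apply: filterS Fc => t; exact: ccont_fw.
have c1 y : {for (t0, y), continuous (fun p : R * X => Re (D p.1 p.2 * wave (- k) p.2))}.
  have -> : (fun p : R * X => Re (D p.1 p.2 * wave (- k) p.2)) = (fun p =>
    Re (D p.1 p.2) * Re (wave (- k) p.2) - Im (D p.1 p.2) * Im (wave (- k) p.2)).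
    by apply/funext => p; rewrite cReM.
  by apply: cvgB; apply: cvgM; [exact: Dc1|exact: w1|exact: Dc2|exact: w2].
have c2 y : {for (t0, y), continuous (fun p : R * X => Im (D p.1 p.2 * wave (- k) p.2))}.
  have -> : (fun p : R * X => Im (D p.1 p.2 * wave (- k) p.2)) = (fun p =>
    Re (D p.1 p.2) * Im (wave (- k) p.2) + Im (D p.1 p.2) * Re (wave (- k) p.2)).
    by apply/funext => p; rewrite cImM.
  by apply: cvgD; apply: cvgM; [exact: Dc1|exact: w2|exact: Dc2|exact: w1].
have [d1 d2] := DwC.
have H : is_cderive (fun t => ccube (fun y => F t y * wave (- k) y)) t0 (ccube (fun y => D t0 y * wave (- k) y)).
  split => /=.
    apply: (@cube_derive R d (fun t y => Re (F t y * wave (- k) y)) (fun t y => Re (D t y * wave (- k) y))) => //.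
      by apply: filterS FwD => t Ht y; have [] := Ht y.
    by apply: filterS FwC => t [].
  apply: (@cube_derive R d (fun t y => Im (F t y * wave (- k) y)) (fun t y => Im (D t y * wave (- k) y))) => //.
    by apply: filterS FwD => t Ht y; have [] := Ht y.
  by apply: filterS FwC => t [].
exact: (is_cderiveZ ((2 * pi) ^- d)%:C H).
Qed.

Context (mu : R) (u0 : X -> C) (Tend : \bar R) (u : R -> X -> C) (T : R).
Context (sol : nls_solution mu u0 Tend u) (T0 : 0 < T) (TT : (T%:E < Tend)%E).

Let closed_dom := [set p : R * X | 0 <= p.1 /\ (p.1%:E < Tend)%E].
Let open_dom := [set p : R * X | 0 < p.1 /\ (p.1%:E < Tend)%E].

(** Continuity relative to the closed time domain becomes continuity on all of R, the form in which
    the mean value bounds use it up to the end points. *)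
Lemma sol_clamp_cont : ccont (fun p : R * X => u (clamp T p.1) p.2).
Proof.
have [_ _ [c1 c2] _ _] := sol.
have key (P : C -> R) : {within closed_dom, continuous (fun p => P (u p.1 p.2))} ->
    continuous (fun p : R * X => P (u (clamp T p.1) p.2)).
  move=> /subspace_continuousP H p.
  pose G (q : R * X) : R * X := (clamp T q.1, q.2).
  have GA q : closed_dom (G q).
    rewrite /closed_dom /G /=; have /andP[h1 h2] := clamp_itv q.1 (ltW T0).
    by split => //; apply: le_lt_trans TT; rewrite lee_fin.
  have cG : G @ nbhs p --> nbhs (G p).
    apply: (@cvg_pair _ _ _ (nbhs p) (nbhs (clamp T p.1)) (nbhs p.2) _ _ _ (fun q => clamp T q.1) snd).
      apply: (@continuous_comp _ _ _ fst (clamp T)); first exact: cvg_fst.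
      exact: clamp_cont.
    exact: cvg_snd.
  move=> V /(H _ (GA p)) HV.
  have HV2 : nbhs p (fun q => closed_dom (G q) -> V (P (u (G q).1 (G q).2))) := cG _ HV.
  by apply: filterS HV2 => q Hq; exact: Hq (GA q).
by split; apply: key.
Qed.

Lemma sol_cont t : 0 <= t <= T -> ccont (u t).
Proof.
move=> tT; have H := sol_clamp_cont.
have -> : u t = (fun y => u (clamp T t) y) by rewrite clamp_id.
apply: (ccont_comp (f := fun p : R * X => u (clamp T p.1) p.2) (h := fun y => (t, y))) => //.
by move=> y; apply: (@cvg_pair _ _ _ (nbhs y) (nbhs t) (nbhs y) _ _ _ (fun=> t) id); [exact: cvg_cst|exact: cvg_id].
Qed.

Lemma sol_periodic t : 0 <= t <= T -> periodic (u t).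
Proof.
move=> /andP[t0 tT]; have [_ H _ _ _] := sol; apply: H => //.
by apply: le_lt_trans TT; rewrite lee_fin.
Qed.

Lemma sol_coef_cont k : ccont (fun t => fourier_coef (u (clamp T t)) k).
Proof. exact: (ccont_coef_param k sol_clamp_cont). Qed.

Lemma open_dom_cont (h : R * X -> R) t y : {within open_dom, continuous h} ->
  0 < t < T -> {for (t, y), continuous h}.
Proof.
move=> /subspace_continuousP H /andP[t0 tT].
have O : open_dom (t, y) by split => //=; apply: lt_trans TT; rewrite lte_fin.
have N : \forall p \near (t, y), open_dom p.
  have n1 : \forall p \near (t, y), 0 < p.1 < T.
    apply: (@cvg_fst _ _ (nbhs t) (nbhs y) _ [set r | 0 < r < T]).
    near=> r; apply/andP; split; near: r; [exact: lt_nbhsr|exact: lt_nbhsl].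
  apply: filterS n1 => p /andP[p0 pT]; split => //.
  by apply: lt_trans TT; rewrite lte_fin.
move=> V /(H _ O) HV; rewrite nbhs_filterE /fmap /=.
near=> p; have : open_dom p -> V (h p) by near: p.
by apply; near: p.
Unshelve. all: by end_near.
Qed.

(** The equation solved for the time derivative of [u]. *)
Definition rhs (t : R) (x : X) : C :=
  'i%C * laplacian (u t) x - 'i%C * mu%:C * (`|u t x| ^+ 2 * u t x).

Lemma sol_time_derive t x : 0 < t < T -> is_cderive (fun s => u s x) t (rhs t x).
Proof.
move=> /andP[t0 tT]; have [_ _ _ _ H] := sol.
have [_ _ [h1 h2] E] : [/\ forall j, cderivable (u t) x (delta_mx 0 j),
   forall j l, cderivable (partial j (u t)) x (delta_mx 0 l),
   cderivable (fun s : R^o => u s x) t 1 &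
   'i%C * cderive (1 : R^o) (fun s => u s x) t = - laplacian (u t) x + mu%:C * `|u t x| ^+ 2 * u t x].
  by apply: H => //; apply: lt_trans TT; rewrite lte_fin.
have -> : rhs t x = cderive (1 : R^o) (fun s => u s x) t.
  have i2 : 'i%C * 'i%C = -1 :> C by rewrite -expr2 sqr_i.
  rewrite -[RHS]opprK -[X in - X]mulN1r -i2 -mulrA E /rhs; ring.
by split; [exact: DeriveDef h1 erefl|exact: DeriveDef h2 erefl].
Qed.

Lemma laplacian_cont t x : 0 < t < T ->
  {for (t, x), continuous (fun p : R * X => Re (laplacian (u p.1) p.2))} /\
  {for (t, x), continuous (fun p : R * X => Im (laplacian (u p.1) p.2))}.
Proof.
move=> tT; have [_ _ _ H _] := sol.
have key (P : C -> R) : P 0 = 0 -> (forall z w, P (z + w) = P z + P w) ->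
    (forall j, {for (t, x), continuous (fun p : R * X => P (partial j (partial j (u p.1)) p.2))}) ->
    {for (t, x), continuous (fun p : R * X => P (laplacian (u p.1) p.2))}.
  move=> P0 PD Pc; rewrite /laplacian; elim: (index_enum _) => [|j r IH].
    have -> : (fun p : R * X => P (\sum_(j <- [::]) partial j (partial j (u p.1)) p.2)) = (fun=> 0).
      by apply/funext => p; rewrite big_nil.
    exact: cvg_cst.
  have -> : (fun p : R * X => P (\sum_(i <- j :: r) partial i (partial i (u p.1)) p.2)) =
    (fun p => P (partial j (partial j (u p.1)) p.2) +
       P (\sum_(i <- r) partial i (partial i (u p.1)) p.2)).
    by apply/funext => p; rewrite big_cons PD.
  by apply: cvgD; [exact: Pc|exact: IH].
split; apply: key => //.
- by move=> z w; rewrite cReD.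
- move=> j; have [_ /(_ j)[b1 b2]] := H j; exact: open_dom_cont b1 tT.
- by move=> z w; rewrite cImD.
- move=> j; have [_ /(_ j)[b1 b2]] := H j; exact: open_dom_cont b2 tT.
Qed.

Lemma u_cont_interior t x : 0 < t < T ->
  {for (t, x), continuous (fun p : R * X => Re (u p.1 p.2))} /\
  {for (t, x), continuous (fun p : R * X => Im (u p.1 p.2))}.
Proof.
move=> tT; have [_ _ [c1 c2] _ _] := sol.
have sub : open_dom `<=` closed_dom by move=> p [p0 pT]; split => //; exact: ltW.
split.
  exact: open_dom_cont (continuous_subspaceW sub c1) tT.
exact: open_dom_cont (continuous_subspaceW sub c2) tT.
Qed.

Lemma interior_near (t : R) (P : R -> Prop) : 0 < t < T ->
  (forall s, 0 < s < T -> P s) -> \forall s \near t, P s.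
Proof.
move=> /andP[t0 tT] HP; near=> s; apply: HP; apply/andP; split; near: s;
  [exact: lt_nbhsr|exact: lt_nbhsl].
Unshelve. all: by end_near.
Qed.

Lemma slice_for (h : R * X -> R) t : (forall y, {for (t, y), continuous h}) ->
  continuous (fun y => h (t, y)).
Proof.
move=> H y; apply: (@continuous_comp _ _ _ (fun y => (t, y)) h); last exact: H.
by apply: (@cvg_pair _ _ _ (nbhs y) (nbhs t) (nbhs y) _ _ _ (fun=> t) id); [exact: cvg_cst|exact: cvg_id].
Qed.

Lemma normsq_conj (z : C) : `|z| ^+ 2 * z = z * z * z^*%C.
Proof. by rewrite sqr_normc; ring. Qed.

Lemma rhs_cont t x : 0 < t < T ->
  {for (t, x), continuous (fun p : R * X => Re (rhs p.1 p.2))} /\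
  {for (t, x), continuous (fun p : R * X => Im (rhs p.1 p.2))}.
Proof.
move=> tT; have [l1' l2'] := laplacian_cont x tT; have [u1 u2] := u_cont_interior x tT.
have E p : rhs p.1 p.2 =
  (- Im (laplacian (u p.1) p.2) + mu * ((Re (u p.1 p.2) * Re (u p.1 p.2) + Im (u p.1 p.2) * Im (u p.1 p.2)) * Im (u p.1 p.2)))
  +i* (Re (laplacian (u p.1) p.2) - mu * ((Re (u p.1 p.2) * Re (u p.1 p.2) + Im (u p.1 p.2) * Im (u p.1 p.2)) * Re (u p.1 p.2))).
  rewrite /rhs normsq_conj; case: (laplacian _ _) => a b; case: (u _ _) => e f.
  by apply: complex_eqP => /=; ring.
have n1 : {for (t, x), continuous (fun p : R * X => Re (u p.1 p.2) * Re (u p.1 p.2) + Im (u p.1 p.2) * Im (u p.1 p.2))}.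
  by apply: cvgD; apply: cvgM.
split.
  have -> : (fun p : R * X => Re (rhs p.1 p.2)) = (fun p => - Im (laplacian (u p.1) p.2) +
     mu * ((Re (u p.1 p.2) * Re (u p.1 p.2) + Im (u p.1 p.2) * Im (u p.1 p.2)) * Im (u p.1 p.2))).
    by apply/funext => p; rewrite E.
  apply: cvgD; first exact: cvgN.
  by apply: cvgM; [exact: cvg_cst|apply: cvgM].
have -> : (fun p : R * X => Im (rhs p.1 p.2)) = (fun p => Re (laplacian (u p.1) p.2) -
     mu * ((Re (u p.1 p.2) * Re (u p.1 p.2) + Im (u p.1 p.2) * Im (u p.1 p.2)) * Re (u p.1 p.2))).
  by apply/funext => p; rewrite E.
apply: cvgB; first by [].
by apply: cvgM; [exact: cvg_cst|apply: cvgM].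
Qed.

Lemma sol_C2 t : 0 < t < T ->
  (forall j, ccont (partial j (u t))) /\ (forall j, ccont (partial j (partial j (u t)))).
Proof.
move=> tT; have [_ _ _ H _] := sol.
split => j; have [[a1 a2] /(_ j)[b1 b2]] := H j; split.
- by apply: (slice_for (h := fun p => Re (partial j (u p.1) p.2))) => y; exact: open_dom_cont a1 tT.
- by apply: (slice_for (h := fun p => Im (partial j (u p.1) p.2))) => y; exact: open_dom_cont a2 tT.
- by apply: (slice_for (h := fun p => Re (partial j (partial j (u p.1)) p.2))) => y; exact: open_dom_cont b1 tT.
- by apply: (slice_for (h := fun p => Im (partial j (partial j (u p.1)) p.2))) => y; exact: open_dom_cont b2 tT.
Qed.

Definition sol_coef (t : R) (k : K) : C := fourier_coef (u t) k.

Lemma sol_synth t : 0 <= t <= T -> l1 (sol_coef t) -> u t = synth (sol_coef t).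
Proof.
by move=> tT lt; apply: fourier_inversion; [exact: sol_cont|exact: sol_periodic|].
Qed.

Lemma nonlinearity_synth (a : K -> C) : l1 a ->
  (fun x => `|synth a x| ^+ 2 * synth a x) = synth (cubic (fun _ _ _ => 1) a).
Proof.
move=> la; apply/funext => x.
by rewrite synth_tri// ?synth_conj ?normsq_conj -?synth_conj//; exact: l1_cflip.
Qed.

(** The equation is integrated against each exponential. The cubic term becomes a convolution only
    because [u t] equals its Fourier series, and this is where summability of the coefficients is
    required. *)
Lemma sol_coef_ode t k : 0 < t < T -> l1 (sol_coef t) ->
  is_cderive (sol_coef ^~ k) t
    (- 'i%C * (freq_sq k)%:C * sol_coef t k - 'i%C * mu%:C * cubic (fun _ _ _ => 1) (sol_coef t) k).
Proof.
move=> tT lt; have tT' : 0 <= t <= T by case/andP: tT => *; rewrite !ltW.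
have uc := sol_cont tT'; have up := sol_periodic tT'; have [c1 c2] := sol_C2 tT.
have rc : ccont (rhs t).
  split; [apply: (slice_for (h := fun p => Re (rhs p.1 p.2)))|apply: (slice_for (h := fun p => Im (rhs p.1 p.2)))];
  by move=> y; have [] := rhs_cont y tT.
have H : is_cderive (sol_coef ^~ k) t (fourier_coef (rhs t) k).
  apply: fourier_coef_derive.
  - by apply: interior_near => // s sT y; exact: sol_time_derive.
  - by move=> y; have [] := rhs_cont y tT.
  - by move=> y; have [] := rhs_cont y tT.
  - by apply: interior_near => // s /andP[s0 sT]; apply: sol_cont; rewrite !ltW.
  - exact: rc.
apply: (is_cderive_eq _ H).
have lc : l1 (cflip (sol_coef t)) by exact: l1_cflip.
have lcub : l1 (cubic (fun _ _ _ => 1) (sol_coef t)) by exact: (l1_tri tribound1).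
have Nc : ccont (fun x => `|u t x| ^+ 2 * u t x).
  by rewrite (sol_synth tT' lt) nonlinearity_synth//; exact: ccont_synth.
have cL : ccont (laplacian (u t)) by exact: ccont_sum.
rewrite /rhs fourier_coefB; first last.
- by apply: ccontM => //; exact: ccont_cst.
- by apply: ccontM => //; exact: ccont_cst.
rewrite !fourier_coefZ// fourier_coef_laplacian//; first last.
- move=> x j; have [_ _ _ _ Hs] := sol.
  have [//||_ dpart _ _] := Hs t x; first by case/andP: tT.
    by apply: lt_trans TT; rewrite lte_fin; case/andP: tT.
  exact: dpart.
- move=> x j; have [_ _ _ _ Hs] := sol.
  have [//||du _ _ _] := Hs t x; first by case/andP: tT.
    by apply: lt_trans TT; rewrite lte_fin; case/andP: tT.
  exact: du.
have -> : fourier_coef (fun x => `|u t x| ^+ 2 * u t x) k = cubic (fun _ _ _ => 1) (sol_coef t) k.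
  by rewrite [in LHS](sol_synth tT' lt) nonlinearity_synth// fourier_coef_synth.
rewrite /sol_coef; ring.
Qed.

End CoefficientEquations.

(** * Interaction picture of the exact solution and convergence of the coefficients *)

Section ExactFlow.
Context {R : realType} {d : nat}.
Local Notation C := R[i].
Local Notation K := 'rV[int]_d.
Local Notation X := 'rV[R]_d.
Local Notation cubic m a := (tri m a a (cflip a)).
Context (mu : R) (u0 : X -> C) (Tend : \bar R) (u : R -> X -> C) (T B : R).
Context (sol : nls_solution mu u0 Tend u) (T0 : 0 < T) (TT : (T%:E < Tend)%E).
Context (uB : forall t, 0 <= t <= T -> X2b (sol_coef u t) B).

(** Carrying the free flow through the cubic term collects the phase: |k|^2 from the outer factor, -
    |k1|^2 - |k2|^2 + |k3|^2 from the inner ones. *)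
Lemma cubic_free (t : R) (a : K -> C) k : l1 a ->
  expi (t * freq_sq k) * cubic (fun _ _ _ => 1) (fun k => free t k * a k) k = cubic (osc t) a k.
Proof.
move=> la; have lc := l1_cflip la.
have E : cflip (fun k => free t k * a k) = (fun k => expi (t * freq_sq k) * cflip a k).
  apply/funext => l; rewrite /cflip /free freq_sqN conjC_mul; congr (_ * _).
  by rewrite -expiN opprK.
have b1 : tribound (fun k1 k2 k3 : K => 1 * (free t k1 * free t k2 * expi (t * freq_sq k3)) : C) 1.
  by move=> k1 k2 k3; rewrite mul1r !normcM !normc_expi !mulr1.
rewrite E tri_inner -(tri_outer (fun k => expi (t * freq_sq k)) k b1 la la lc).
rewrite (@tri_eqsym R d _ (osc t))// => k1 k2 k3.
by rewrite mul1r /free /osc -!expiD; congr expi; rewrite /phase /psi; ring.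
Qed.

Lemma sol_derive_clamp t k : 0 < t < T ->
  is_cderive (fun s => sol_coef u (clamp T s) k) t
    (- 'i%C * (freq_sq k)%:C * sol_coef u t k - 'i%C * mu%:C * cubic (fun _ _ _ => 1) (sol_coef u t) k).
Proof.
move=> tT.
have lt : l1 (sol_coef u t).
  by apply: (Xb_asum (B := B)); apply: X2b_Xb; apply: uB; case/andP: tT => *; rewrite !ltW.
have [h1 h2] := sol_coef_ode sol T0 TT k tT lt.
have N : \forall s \near t, clamp T s = s.
  by apply: (interior_near tT) => s /andP[s0 sT]; rewrite clamp_id// !ltW.
split.
  by apply: near_eq_is_derive h1; apply: filterS N => s ->.
by apply: near_eq_is_derive h2; apply: filterS N => s ->.
Qed.

Lemma is_derive_affine (c sg s : R) : is_derive s 1 (fun s => c + sg * s) sg.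
Proof.
have h := is_deriveD (is_derive_cst c s (1 : R)) (is_deriveZ sg (is_derive_id s (1 : R))).
by apply: (is_derive_eq h); rewrite add0r /GRing.scale /= mulr1.
Qed.

Definition flow (t0 sg s : R) (k : K) : C :=
  expi (freq_sq k * (sg * s)) * sol_coef u (clamp T (t0 + sg * s)) k.

(** For 0 < s < tau the time [t0 + sg * s] is interior even if [t0] or [t0 + sg * tau] is an end
    point of [0, T], so the equation is available there; the clamp supplies continuity at the
    ends. *)
Lemma flow_halfflow t0 sg tau : sg = 1 \/ sg = -1 -> 0 < tau ->
  0 <= t0 <= T -> 0 <= t0 + sg * tau <= T -> halfflow mu sg B tau (flow t0 sg).
Proof.
move=> sg1 tau0 /andP[h1 h2] /andP[h3 h4].
have inI s : 0 <= s <= tau -> 0 <= t0 + sg * s <= T.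
  by case: sg1 h3 h4 => ->; rewrite ?mul1r ?mulN1r => h3 h4 /andP[? ?]; apply/andP; split; lra.
have inO s : 0 < s < tau -> 0 < t0 + sg * s < T.
  by case: sg1 h3 h4 => ->; rewrite ?mul1r ?mulN1r => h3 h4 /andP[? ?]; apply/andP; split; lra.
have aff : continuous (fun s : R => t0 + sg * s).
  by apply: contD; [exact: cont_cst|apply: contZ => s; exact: cvg_id].
split.
- move=> k; apply: ccontM.
    have -> : (fun s => expi (freq_sq k * (sg * s))) = (fun s => expi (freq_sq k * sg * s)) :> (R -> C).
      by apply/funext => s; rewrite mulrA.
    exact: ccont_expi.
  apply: (ccont_comp (f := fun t => sol_coef u (clamp T t) k)) => //.
  exact: (sol_coef_cont sol T0 TT).
- move=> s sI; rewrite -[B]mul1r; apply: X2b_mul => //.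
    by move=> k; rewrite normc_expi.
  by rewrite clamp_id ?inI//; apply: uB; exact: inI.
move=> s sI k; have tI := inO s sI.
have sI' : 0 <= s <= tau by case/andP: sI => *; rewrite !ltW.
have tI' := inI s sI'.
have lt : l1 (sol_coef u (t0 + sg * s)).
  by apply: (Xb_asum (B := B)); apply: X2b_Xb; exact: uB.
have Du := is_cderive_comp (f := fun t => sol_coef u (clamp T t) k) (is_derive_affine t0 sg s) (sol_derive_clamp k tI).
have D := is_cderiveM (is_cderive_expi (freq_sq k * sg) s) Du.
apply: (@is_cderive_ext _ (fun s => expi (freq_sq k * sg * s) * sol_coef u (clamp T (t0 + sg * s)) k)).
  by move=> t; rewrite /flow mulrA.
apply: (is_cderive_eq _ D).
rewrite clamp_id//; set a := sol_coef u _.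
have lW : l1 (flow t0 sg s).
  apply: le_lt_trans lt; apply: le_es => l.
  by rewrite /flow clamp_id// normcM normc_expi mul1r.
have -> : cubic (osc (sg * s)) (flow t0 sg s) k = expi (freq_sq k * sg * s) * cubic (fun _ _ _ => 1) a k.
  rewrite -cubic_free// mulrC [in RHS]mulrC [freq_sq k * sg * s]mulrC.
  rewrite (_ : s * (freq_sq k * sg) = sg * s * freq_sq k); last by ring.
  congr (_ * _).
  have -> : (fun k => free (sg * s) k * flow t0 sg s k) = a; last by [].
  apply/funext => l; rewrite /flow clamp_id// mulrA /free -expiD.
  by rewrite (_ : - (sg * s * freq_sq l) + freq_sq l * (sg * s) = 0) ?expi0 ?mul1r//; ring.
rewrite !rmorphM /=; ring.
Qed.

Lemma flow0 t0 sg : 0 <= t0 <= T -> flow t0 sg 0 = sol_coef u t0.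
Proof.
move=> tI; apply/funext => k; rewrite /flow mulr0 addr0 mulr0 expi0 mul1r.
by rewrite clamp_id.
Qed.

Lemma freeE (t : R) (k : K) (s : R) : free t k * expi (freq_sq k * s) = expi (freq_sq k * (s - t)) :> C.
Proof. by rewrite /free -expiD; congr expi; ring. Qed.

(** The free flow over [tau], an isometry, is applied to the bound on [Wp tau - Wm tau]: the first
    term becomes the solution at [t0 + tau], the second the free evolution over [2 * tau] of the
    solution at [t0 - tau]. *)
Lemma exact_step tau t0 : 0 < tau -> 0 <= t0 - tau -> t0 + tau <= T ->
  Xb (fun k => sol_coef u (t0 + tau) k - (free (2 * tau) k * sol_coef u (t0 - tau) k -
     'i%C * (mu * tau)%:C * (free tau k * quad2 tau (sol_coef u t0) k))) (tau ^+ 3 * step_cst mu B).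
Proof.
move=> tau0 h1 h2.
have tI : 0 <= t0 <= T by apply/andP; split; lra.
have Hp : halfflow mu 1 B tau (flow t0 1).
  by apply: flow_halfflow => //; [left|rewrite mul1r; apply/andP; split; lra].
have Hm : halfflow mu (-1) B tau (flow t0 (-1)).
  by apply: flow_halfflow => //; [right|rewrite mulN1r; apply/andP; split; lra].
have W0 : flow t0 1 0 = flow t0 (-1) 0 by rewrite !flow0.
have H := Xb_free tau (local_error_symm Hp Hm W0 tau0).
apply: XN_le H => k; rewrite flow0//; apply: le_of_eq; congr normc.
rewrite /flow mul1r mulN1r !clamp_id; [|by apply/andP; split; lra..].
move: (sol_coef u (t0 + tau) k) (sol_coef u (t0 - tau) k) => p q.
rewrite [RHS]mulrDr [X in _ = X + _]mulrBr !mulrA !freeE subrr mulr0 expi0 mul1r /quad2.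
have -> : expi (freq_sq k * (- tau - tau)) = free (2 * tau) k :> C.
  by rewrite /free; congr expi; ring.
ring.
Qed.

Lemma exact_start tau : 0 < tau -> tau <= 1 -> tau <= T ->
  Xb (fun k => sol_coef u tau k - free tau k * (sol_coef u 0 k -
     'i%C * (mu * tau)%:C * cubic (quad_symbol 1 tau) (sol_coef u 0) k)) (tau ^+ 2 * start_cst mu B).
Proof.
move=> tau0 h1 h2.
have tI : 0 <= (0 : R) <= T by apply/andP; split; lra.
have Hp : halfflow mu 1 B tau (flow 0 1).
  by apply: flow_halfflow => //; [left|rewrite mul1r add0r; apply/andP; split; lra].
have tau1 : 0 < tau <= 1 by rewrite tau0.
have H := Xb_free tau (local_error_start Hp tau1).
apply: XN_le H => k; rewrite flow0//; apply: le_of_eq; congr normc.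
rewrite /flow mul1r add0r clamp_id; last by apply/andP; split; lra.
move: (sol_coef u tau k) (sol_coef u 0 k) => p q.
rewrite [RHS]mulrDr [X in _ = X + _]mulrBr !mulrA freeE subrr mulr0 expi0 mul1r; ring.
Qed.

Lemma convergence tau (n : nat) : 0 < tau -> tau <= 1 -> tau ^+ 2 * error_cst mu T B <= 1 -> n%:R * tau <= T ->
  Xb (fun k => sol_coef u (n%:R * tau) k - coefs mu tau (sol_coef u 0) n k) (tau ^+ 2 * error_cst mu T B).
Proof.
move=> tau0 tau1 tC nT.
have -> : sol_coef u 0 = sol_coef u (0%:R * tau) by rewrite mul0r.
apply: (stability (N := n) (a := fun n => sol_coef u (n%:R * tau)) tau0 (ltW T0) tC nT) => //.
- move=> m mn; apply: X2b_Xb; apply: uB; apply/andP; split; first by rewrite mulr_ge0// ltW.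
  by apply: le_trans nT; rewrite ler_wpM2r ?(ltW tau0)// ler_nat.
- move=> n1; rewrite mul1r mul0r; apply: exact_start => //.
  by apply: le_trans nT; rewrite ler_peMl ?(ltW tau0)// ler1n.
move=> m mn.
(* The three time levels are recentred at the middle one. *)
have e1 : m.+2%:R * tau = m.+1%:R * tau + tau by rewrite -[m.+2%:R]natr1 mulrDl mul1r.
have e2 : m%:R * tau = m.+1%:R * tau - tau by rewrite -[m.+1%:R]natr1 mulrDl mul1r addrK.
rewrite e1 e2; apply: exact_step => //.
  by rewrite -e2 mulr_ge0// ltW.
by rewrite -e1; apply: le_trans nT; rewrite ler_wpM2r ?(ltW tau0)// ler_nat.
Qed.

End ExactFlow.

(** * Fourier coefficients of the scheme *)

Section SchemeCoefficients.
Context {R : realType} {d : nat} (mu : R).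
Local Notation C := R[i].
Local Notation K := 'rV[int]_d.
Local Notation X := 'rV[R]_d.
Implicit Types (a b c : K -> C) (k : K).
Local Notation cubic m a := (tri m a a (cflip a)).
Local Notation one3 := (fun _ _ _ : K => 1 : C).

Lemma l1_mul (z : K -> C) L a : (forall k, normc (z k) <= L) -> l1 a -> l1 (fun k => z k * a k).
Proof.
move=> zL la; have L0 : 0 <= L by apply: le_trans (normc_ge0 _) (zL 0).
apply: (@le_lt_trans _ _ (L%:E * asum a)%E); last by rewrite -(fineK_asum la) -EFinM ltry.
rewrite /asum -esZ//; last by move=> k; exact: normc_ge0.
by apply: le_es => k; rewrite normcM ler_wpM2r ?normc_ge0.
Qed.

Lemma eq_synth (a b : K -> C) (x : X) : (forall k, a k = b k) -> synth a x = synth b x.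
Proof. by move=> ab; congr (synth _ x); exact/funext. Qed.

Lemma free_add s t k : free s k * free t k = free (s + t) k :> C.
Proof. by rewrite /free -expiD; congr expi; ring. Qed.

Lemma freeNK t k : free (- t) k * free t k = 1 :> C.
Proof. by rewrite free_add addNr /free mul0r oppr0 expi0. Qed.

Lemma eq_tri m (a a' b b' c c' : K -> C) k : (forall l, a l = a' l) -> (forall l, b l = b' l) ->
  (forall l, c l = c' l) -> tri m a b c k = tri m a' b' c' k.
Proof. by move=> /funext-> /funext-> /funext->. Qed.

Lemma coefs1E tau a k : coefs mu tau a 1 k =
  free tau k * (a k - 'i%C * (mu * tau)%:C * cubic (quad_symbol 1 tau) a k
             - (mu ^+ 2 * (tau ^+ 2 / 2))%:C * quintic a k).
Proof. by []. Qed.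

Lemma schrod_synth (s : R) a : l1 a -> schrod s (synth a) = synth (fun k => free s k * a k) :> (X -> C).
Proof.
move=> la; rewrite /schrod (fmult_synth (L := 1))//; last first.
  by move=> r; rewrite expC_i normc_expi.
by congr synth; apply/funext => k; rewrite expC_i mulrN.
Qed.

Lemma l1_free s a : l1 a -> l1 (fun k => free s k * a k).
Proof. by apply: l1_mul => k; rewrite normc_free. Qed.

Lemma synth_prod3 a b c : l1 a -> l1 b -> l1 c ->
  (fun x => synth a x * synth b x * synth c x) = synth (tri one3 a b c).
Proof. by move=> la lb lc; apply/funext => x; rewrite synth_tri. Qed.

Lemma synth_lin (a b c e : K -> C) (z1 z2 z3 : C) (x : X) : l1 a -> l1 b -> l1 c -> l1 e ->
  synth a x - z1 * synth b x - z2 * synth c x - z3 * synth e x =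
  synth (fun k => a k - z1 * b k - z2 * c k - z3 * e k) x.
Proof.
move=> la lb lc le.
have lZ z (f : K -> C) : l1 f -> l1 (fun k => z * f k) by apply: (l1_mul (L := normc z)).
rewrite -(synthZ z1 x lb) -(synthZ z2 x lc) -(synthZ z3 x le).
rewrite -(synthB x la (lZ z1 _ lb)) -(synthB x (l1B la (lZ z1 _ lb)) (lZ z2 _ lc)).
by rewrite -(synthB x (l1B (l1B la (lZ z1 _ lb)) (lZ z2 _ lc)) (lZ z3 _ le)).
Qed.

Definition zsym (tau : R) k : C := 'i%C * (2 * freq_sq k * tau)%:C.

Lemma complex_2mul (r : R) : (2 * r)%:C = 2 * r%:C :> C.
Proof. by rewrite rmorphM rmorph_nat. Qed.

Lemma zsym_real (tau lam : R) : - 2 * 'i%C * (tau * lam)%:C = 'i%C * (- (2 * lam * tau))%:C :> C.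
Proof.
have -> : - (2 * lam * tau) = 2 * - (tau * lam) by ring.
by rewrite complex_2mul [(- _)%:C]rmorphN; ring.
Qed.

Lemma zsymE (tau : R) k : - 2 * 'i%C * (tau * - freq_sq k)%:C = zsym tau k.
Proof.
rewrite zsym_real /zsym.
by have -> : - (2 * - freq_sq k * tau) = 2 * freq_sq k * tau :> R by ring.
Qed.

Lemma slri2_start_synth tau a : l1 a ->
  slri2_start mu tau (synth a : X -> C) = synth (coefs mu tau a 1).
Proof.
move=> la; have lc := l1_cflip la.
have conjE : (fun x => (synth a x)^*%C) = synth (cflip a) :> (X -> C).
  by apply/funext => x; exact: synth_conj.
rewrite /slri2_start conjE.
have b12 r : normc (phi1 (- 2 * 'i%C * (tau * r)%:C) - phi2 (- 2 * 'i%C * (tau * r)%:C) : C) <= 2.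
  rewrite zsym_real; apply: le_trans (normcB _ _) _.
  by have := normc_phi1 (- (2 * r * tau)); have := normc_phi2 (- (2 * r * tau)); lra.
have b2 r : normc (phi2 (- 2 * 'i%C * (tau * r)%:C) : C) <= 1.
  by rewrite zsym_real normc_phi2.
rewrite (fmult_synth b12 lc) (fmult_synth b2 lc).
pose p12 k := phi1 (zsym tau k) - phi2 (zsym tau k); pose p2 k := phi2 (zsym tau k).
have -> : (fun k => (phi1 (- 2 * 'i%C * (tau * - freq_sq k)%:C) - phi2 (- 2 * 'i%C * (tau * - freq_sq k)%:C)) * cflip a k) =
  (fun k => p12 k * cflip a k) by apply/funext => k; rewrite zsymE.
have -> : (fun k => phi2 (- 2 * 'i%C * (tau * - freq_sq k)%:C) * cflip a k) = (fun k => p2 k * cflip a k).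
  by apply/funext => k; rewrite zsymE.
have lp12 : l1 (fun k => p12 k * cflip a k).
  by apply: (l1_mul (L := 2)) => // k; have := b12 (- freq_sq k); rewrite zsymE.
have lp2 : l1 (fun k => p2 k * cflip a k).
  by apply: (l1_mul (L := 1)) => // k; have := b2 (- freq_sq k); rewrite zsymE.
have lf := l1_free tau la; have lfp2 := l1_free tau lp2.
rewrite (schrod_synth tau la) (schrod_synth tau lp2).
have E1 : (fun x : X => synth a x ^+ 2 * synth (fun k => p12 k * cflip a k) x) =
   synth (tri one3 a a (fun k => p12 k * cflip a k)).
  by rewrite -synth_prod3//; apply/funext => x; rewrite expr2.
have lcub : l1 (cubic one3 a) by exact: (l1_tri tribound1).
have E4 : (fun x : X => `|synth a x| ^+ 4 * synth a x) = synth (quintic a).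
  rewrite /quintic -synth_prod3//; apply/funext => x.
  rewrite synth_tri// -synth_conj.
  have -> : `|synth a x| ^+ 4 = (`|synth a x| ^+ 2) * (`|synth a x| ^+ 2) by rewrite -exprD.
  by rewrite !sqr_normc; ring.
have lq : l1 (quintic a) by exact: (l1_tri tribound1).
rewrite E1 E4.
have lE1 : l1 (tri one3 a a (fun k => p12 k * cflip a k)) by exact: (l1_tri tribound1).
rewrite (schrod_synth tau lE1) (schrod_synth tau lq).
have E2 x : synth (fun k => free tau k * a k) x ^+ 2 * synth (fun k => free tau k * (p2 k * cflip a k)) x =
  synth (tri one3 (fun k => free tau k * a k) (fun k => free tau k * a k) (fun k => free tau k * (p2 k * cflip a k))) x :> C.
  by rewrite synth_tri// expr2.
apply/funext => x; rewrite E2.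
set A := tri one3 a a _ in lE1 *; set B := tri one3 _ _ _.
have lB : l1 B by exact: (l1_tri tribound1).
have lfA := l1_free tau lE1; have lfq := l1_free tau lq.
rewrite (synth_lin _ _ _ _ (l1_free tau la) lfA lB lfq).
apply: eq_synth => k; rewrite coefs1E.
(* The two nonlinear terms are the two nodes of the interpolation: [A] carries the value at 0 with
   weight [phi1 - phi2], [B] the value at [tau] with weight [phi2]. Pulled back by the free flow
   they add up to the quadrature symbol. *)
have q1 : cubic (quad_symbol 1 tau) a k = free (- tau) k * (free tau k * A k + B k).
  have bs1 : tribound (fun k1 k2 k3 => one3 k1 k2 k3 * (1 * 1 * p12 k3)) 2.
    by move=> k1 k2 k3; rewrite !mul1r; have := b12 (- freq_sq k3); rewrite zsymE.
  have bs2 : tribound (fun k1 k2 k3 => one3 k1 k2 k3 * (free tau k1 * free tau k2 * (free tau k3 * p2 k3))) 1.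
    move=> k1 k2 k3; rewrite mul1r !normcM !normc_free !mul1r.
    by have := b2 (- freq_sq k3); rewrite zsymE.
  have -> : A k = cubic (fun k1 k2 k3 => one3 k1 k2 k3 * (1 * 1 * p12 k3)) a k.
    rewrite -(tri_inner one3 (fun=> 1) (fun=> 1) p12) /A.
    by apply: eq_tri => l //; rewrite mul1r.
  have -> : B k = cubic (fun k1 k2 k3 => one3 k1 k2 k3 * (free tau k1 * free tau k2 * (free tau k3 * p2 k3))) a k.
    rewrite -(tri_inner one3 (free tau) (free tau) (fun k => free tau k * p2 k)) /B.
    by apply: eq_tri => l //; rewrite mulrA.
  rewrite mulrDr mulrA freeNK mul1r.
  rewrite -(tri_outer (free (- tau)) k bs2 la la lc).
  rewrite -(tri_addsym k bs1 (L' := 1)) => //; last first.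
    by move=> k1 k2 k3; rewrite normcM normc_free mul1r.
  rewrite (@tri_eqsym R d _ (quad_symbol 1 tau))// => k1 k2 k3.
  rewrite /quad_symbol /p12 /p2 /zsym !mul1r; congr (_ + _).
  rewrite !mulrA; congr (_ * _).
  by rewrite /free -!expiD; congr expi; rewrite /psi; ring.
rewrite q1.
have fK : free tau k * free (- tau) k = 1 :> C.
  by rewrite mulrC freeNK.
have -> : free tau k * (a k - 'i%C * (mu * tau)%:C * (free (- tau) k * (free tau k * A k + B k))
   - (mu ^+ 2 * (tau ^+ 2 / 2))%:C * quintic a k) =
  free tau k * a k - 'i%C * (mu * tau)%:C * ((free tau k * free (- tau) k) * (free tau k * A k + B k))
   - (mu ^+ 2 * (tau ^+ 2 / 2))%:C * (free tau k * quintic a k) by ring.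
by rewrite fK mul1r; ring.
Qed.

Lemma slri2_step_synth tau a b : l1 a -> l1 b ->
  slri2_step mu tau (synth a : X -> C) (synth b) =
  synth (fun k => free (2 * tau) k * a k - 'i%C * (mu * tau)%:C * (free tau k * quad2 tau b k)).
Proof.
move=> la lb; have lc := l1_cflip lb.
have conjE : (fun x => (synth b x)^*%C) = synth (cflip b) :> (X -> C).
  by apply/funext => x; exact: synth_conj.
rewrite /slri2_step conjE.
have bA r : normc (complex.Re (phi1 (- 2 * 'i%C * (tau * r)%:C) : C) -
    complex.Re (phi2 (- 2 * 'i%C * (tau * r)%:C) : C))%:C <= 2.
  rewrite normc_real zsym_real; apply: le_trans (ler_normB _ _) _.
  have h1 := le_trans (normRe_le _) (normc_phi1 (- (2 * r * tau))).
  have h2 := le_trans (normRe_le _) (normc_phi2 (- (2 * r * tau))).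
  have -> : 2 = 1 + 1 :> R by [].
  exact: lerD h1 h2.
have b2 r : normc (phi2 (- 2 * 'i%C * (tau * r)%:C) : C) <= 1.
  by rewrite zsym_real normc_phi2.
have b3 r : normc (phi2 (- (- 2 * 'i%C * (tau * r)%:C)) : C) <= 1.
  by rewrite zsym_real -mulrN -rmorphN normc_phi2.
rewrite (fmult_synth bA lc) (fmult_synth b2 lc) (fmult_synth b3 lc).
pose pA k : C := (complex.Re (phi1 (zsym tau k)) - complex.Re (phi2 (zsym tau k)))%:C.
pose p2 k := phi2 (zsym tau k); pose p3 k := phi2 (- zsym tau k).
have -> : (fun k => (complex.Re (phi1 (- 2 * 'i%C * (tau * - freq_sq k)%:C) : C) -
    complex.Re (phi2 (- 2 * 'i%C * (tau * - freq_sq k)%:C) : C))%:C * cflip b k) =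
  (fun k => pA k * cflip b k) by apply/funext => k; rewrite zsymE.
have -> : (fun k => phi2 (- 2 * 'i%C * (tau * - freq_sq k)%:C) * cflip b k) = (fun k => p2 k * cflip b k).
  by apply/funext => k; rewrite zsymE.
have -> : (fun k => phi2 (- (- 2 * 'i%C * (tau * - freq_sq k)%:C)) * cflip b k) = (fun k => p3 k * cflip b k).
  by apply/funext => k; rewrite zsymE.
have lpA : l1 (fun k => pA k * cflip b k).
  by apply: (l1_mul (L := 2)) => // k; have := bA (- freq_sq k); rewrite zsymE.
have lp2 : l1 (fun k => p2 k * cflip b k).
  by apply: (l1_mul (L := 1)) => // k; have := b2 (- freq_sq k); rewrite zsymE.
have lp3 : l1 (fun k => p3 k * cflip b k).
  by apply: (l1_mul (L := 1)) => // k; have := b3 (- freq_sq k); rewrite zsymE.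
have lf := l1_free tau lb; have lfp2 := l1_free tau lp2.
have lg := l1_free (- tau) lb; have lgp3 := l1_free (- tau) lp3.
rewrite (schrod_synth (2 * tau) la) (schrod_synth tau lb) (schrod_synth tau lp2)
  (schrod_synth (- tau) lb) (schrod_synth (- tau) lp3).
have E1 : (fun x : X => synth b x ^+ 2 * synth (fun k => pA k * cflip b k) x) =
   synth (tri one3 b b (fun k => pA k * cflip b k)).
  by rewrite -synth_prod3//; apply/funext => x; rewrite expr2.
have E3 : (fun x : X => synth (fun k => free (- tau) k * b k) x ^+ 2 *
    synth (fun k => free (- tau) k * (p3 k * cflip b k)) x) =
   synth (tri one3 (fun k => free (- tau) k * b k) (fun k => free (- tau) k * b k)
     (fun k => free (- tau) k * (p3 k * cflip b k))).
  by rewrite -synth_prod3//; apply/funext => x; rewrite expr2.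
rewrite E1 E3.
have lA : l1 (tri one3 b b (fun k => pA k * cflip b k)) by exact: (l1_tri tribound1).
have lD : l1 (tri one3 (fun k => free (- tau) k * b k) (fun k => free (- tau) k * b k)
     (fun k => free (- tau) k * (p3 k * cflip b k))) by exact: (l1_tri tribound1).
rewrite (schrod_synth tau lA) (schrod_synth (2 * tau) lD).
have E2 x : synth (fun k => free tau k * b k) x ^+ 2 * synth (fun k => free tau k * (p2 k * cflip b k)) x =
  synth (tri one3 (fun k => free tau k * b k) (fun k => free tau k * b k) (fun k => free tau k * (p2 k * cflip b k))) x :> C.
  by rewrite synth_tri// expr2.
apply/funext => x; rewrite E2.
set A := tri one3 b b _ in lA *; set D := tri one3 _ _ _ in lD *; set B := tri one3 _ _ _.
have lB : l1 B by exact: (l1_tri tribound1).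
have lfA := l1_free tau lA; have lfD := l1_free (2 * tau) lD.
rewrite (synth_lin _ _ _ _ (l1_free (2 * tau) la) lfA lB lfD).
apply: eq_synth => k.
(* [A] holds the node at 0 of both halves together, which explains its factor 2 and the real parts;
   [B] and [D] hold the nodes at [tau] and [- tau]. *)
have q1 : quad2 tau b k = free (- tau) k * (2 * (free tau k * A k) + B k + free (2 * tau) k * D k).
  pose sA k1 k2 k3 : C := 2 * (one3 k1 k2 k3 * (1 * 1 * pA k3)).
  pose sB k1 k2 k3 : C := one3 k1 k2 k3 * (free tau k1 * free tau k2 * (free tau k3 * p2 k3)).
  pose sD k1 k2 k3 : C := one3 k1 k2 k3 * (free (- tau) k1 * free (- tau) k2 * (free (- tau) k3 * p3 k3)).
  have bsA0 : tribound (fun k1 k2 k3 => one3 k1 k2 k3 * (1 * 1 * pA k3)) 2.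
    by move=> k1 k2 k3; rewrite !mul1r; have := bA (- freq_sq k3); rewrite zsymE.
  have bsA : tribound sA (normc (2 : C) * 2).
    by move=> k1 k2 k3; rewrite /sA normcM; apply: ler_wpM2l (bsA0 k1 k2 k3); exact: normc_ge0.
  have bsB : tribound sB 1.
    move=> k1 k2 k3; rewrite /sB mul1r; rewrite !normcM !normc_free !mul1r.
    by rewrite /p2 -zsymE b2.
  have bsD : tribound sD 1.
    move=> k1 k2 k3; rewrite /sD mul1r !normcM !normc_free !mul1r.
    by rewrite /p3 -zsymE b3.
  have AE : A k = cubic (fun k1 k2 k3 => one3 k1 k2 k3 * (1 * 1 * pA k3)) b k.
    rewrite -(tri_inner one3 (fun=> 1) (fun=> 1) pA) /A.
    by apply: eq_tri => l //; rewrite mul1r.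
  have BE : B k = cubic sB b k.
    rewrite -(tri_inner one3 (free tau) (free tau) (fun k => free tau k * p2 k)) /B.
    by apply: eq_tri => l //; rewrite mulrA.
  have DE : D k = cubic sD b k.
    rewrite -(tri_inner one3 (free (- tau)) (free (- tau)) (fun k => free (- tau) k * p3 k)) /D.
    by apply: eq_tri => l //; rewrite mulrA.
  have -> : free (- tau) k * (2 * (free tau k * A k) + B k + free (2 * tau) k * D k) =
     (free (- tau) k * free tau k) * (2 * A k) + (free (- tau) k * B k) +
     (free (- tau) k * free (2 * tau) k) * D k by ring.
  have -> : free (- tau) k * free tau k = 1 :> C.
    exact: freeNK.
  have -> : free (- tau) k * free (2 * tau) k = free tau k :> C.
    by rewrite free_add; congr (free _ k); ring.
  rewrite mul1r AE BE DE -(tri_scale 2 k bsA0 lb lb lc) -/sA.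
  rewrite -(tri_outer (free (- tau)) k bsB lb lb lc) -(tri_outer (free tau) k bsD lb lb lc).
  have bsB' : tribound (fun k1 k2 k3 => free (- tau) (k1 + k2 + k3) * sB k1 k2 k3) 1.
    by move=> k1 k2 k3; rewrite normcM normc_free mul1r.
  have bsD' : tribound (fun k1 k2 k3 => free tau (k1 + k2 + k3) * sD k1 k2 k3) 1.
    by move=> k1 k2 k3; rewrite normcM normc_free mul1r.
  rewrite -(tri_addsym k bsA bsB' lb lb lc).
  have bsAB : tribound (fun k1 k2 k3 => sA k1 k2 k3 + free (- tau) (k1 + k2 + k3) * sB k1 k2 k3) (normc (2 : C) * 2 + 1).
    by move=> k1 k2 k3; apply: le_trans (normcD _ _) _; rewrite lerD.
  rewrite -(tri_addsym k bsAB bsD' lb lb lc) /quad2.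
  rewrite -(tri_addsym k (tribound_quad 1 tau) (tribound_quad (-1) tau) lb lb lc).
  congr (_ k); rewrite (@tri_eqsym R d _ (fun k1 k2 k3 => quad_symbol 1 tau k1 k2 k3 + quad_symbol (-1) tau k1 k2 k3))// => k1 k2 k3.
  rewrite /quad_symbol /sA /sB /sD /p2 /p3 /pA !mul1r.
  have z1 : 'i%C * (2 * freq_sq k3 * tau)%:C = zsym tau k3 by [].
  have z2 : 'i%C * (-1 * (2 * freq_sq k3) * tau)%:C = - zsym tau k3.
    by rewrite mulN1r mulNr rmorphN mulrN.
  (* The arguments of the phi functions are imaginary, so changing their sign is conjugation: twice
     the real part is the sum of the forward and the backward value. *)
  have cz : - zsym tau k3 = (zsym tau k3)^*%C.
    by rewrite /zsym conjC_mul conjc_real; apply: complex_eqP => /=; ring.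
  rewrite z2 z1.
  have re w : w + w^*%C = 2 * (complex.Re w)%:C :> C by rewrite addcJ.
  have e1 : free (- tau) (k1 + k2 + k3) * (free tau k1 * free tau k2 * (free tau k3 * phi2 (zsym tau k3))) =
     expi (tau * psi k1 k2 k3) * phi2 (zsym tau k3).
    by rewrite !mulrA /free -!expiD; congr (expi _ * _); rewrite /psi; ring.
  have e2 : free tau (k1 + k2 + k3) * (free (- tau) k1 * free (- tau) k2 * (free (- tau) k3 * phi2 (- zsym tau k3))) =
     expi (tau * (-1 * psi k1 k2 k3)) * phi2 (- zsym tau k3).
    by rewrite !mulrA /free -!expiD; congr (expi _ * _); rewrite /psi; ring.
  rewrite e1 e2 [(_ - _)%:C]rmorphB mulrBr -!re /= -phi1_conj -phi2_conj -cz; ring.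
have fK : free tau k * free (- tau) k = 1 :> C.
  by rewrite mulrC freeNK.
have -> : 'i%C * (mu * tau)%:C * (free tau k * quad2 tau b k) =
  'i%C * (mu * tau)%:C * ((free tau k * free (- tau) k) * (2 * (free tau k * A k) + B k + free (2 * tau) k * D k)).
  by rewrite q1; ring.
by rewrite fK mul1r; ring.
Qed.

Lemma l1_coefs tau a n B : Xb a B -> l1 (coefs mu tau a n).
Proof. by move=> /(coefs_Xb mu tau n)[B' /Xb_asum]. Qed.

Lemma slri2_synth tau a B n : Xb a B -> slri2 mu tau (synth a : X -> C) n = synth (coefs mu tau a n).
Proof.
move=> aB.
suff [] : slri2 mu tau (synth a : X -> C) n = synth (coefs mu tau a n) /\
  slri2 mu tau (synth a : X -> C) n.+1 = synth (coefs mu tau a n.+1) by [].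
elim: n => [|n [IH1 IH2]].
  by split => //; exact: slri2_start_synth (Xb_asum aB).
split => //.
rewrite -[LHS]/(slri2_step mu tau (slri2 mu tau (synth a) n) (slri2 mu tau (synth a) n.+1)).
by rewrite IH1 IH2 slri2_step_synth//; exact: l1_coefs aB.
Qed.

End SchemeCoefficients.

(** * Sobolev norms *)

Section ConvergentSums.
Context {R : realType}.
Local Notation es f := (\esum_(i in [set: _]) (f i)%:E)%E.

(** Integral comparison for the power series in telescoping form. It rests on [1 + h <= e^h] for
    [h = p ln ((x + 1) / x)] and on [1 / (x + 1) <= ln ((x + 1) / x)]. *)
Lemma powR_telescope (x p : R) : 0 < x -> 0 < p ->
  (x + 1) `^ (- (1 + p)) <= p^-1 * (x `^ (- p) - (x + 1) `^ (- p)).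
Proof.
move=> x0 p0; have y0 : 0 < x + 1 by lra.
have -> : (x + 1) `^ (- (1 + p)) = (x + 1)^-1 * (x + 1) `^ (- p).
  by rewrite opprD powRD ?(gt_eqF y0) ?implybT// powR_inv1// ltW.
have -> : x `^ (- p) = (x + 1) `^ (- p) * expR (p * (- ln (x / (x + 1)))).
  rewrite /powR !gt_eqF// -expRD ln_div ?posrE//; congr expR; ring.
have l : (x + 1)^-1 <= - ln (x / (x + 1)).
  have e : (x + 1)^-1 = - (x / (x + 1) - 1) by field; rewrite gt_eqF.
  have xy0 : 0 < x / (x + 1) by rewrite divr_gt0.
  have := @le_ln1Dx R (x / (x + 1) - 1); rewrite subrKC => h.
  by rewrite [leLHS]e lerN2; apply: h; lra.
have h := expR_ge1Dx (p * (- ln (x / (x + 1)))).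
have E0 : 0 <= (x + 1) `^ (- p) by exact: powR_ge0.
rewrite ler_pdivlMl//.
have := ler_wpM2l E0 h; have := ler_wpM2l (ltW p0) (ler_wpM2l E0 l).
move: (- ln _) => L; move: (expR _) (_^-1) (_ `^ _) => F y E; lra.
Qed.

Lemma psum_powR (p : R) N : 0 < p ->
  \sum_(i < N.+1) i.+1%:R `^ (- (1 + p)) <= 1 + p^-1 * (1 - N.+1%:R `^ (- p)).
Proof.
move=> p0; elim: N => [|N IH].
  by rewrite big_ord1 !powR1 subrr mulr0 addr0.
rewrite big_ord_recr /=.
have := @powR_telescope N.+1%:R p (ltr0Sn _ _) p0.
rewrite natr1; move: IH; rewrite !mulrBr; lra.
Qed.

Lemma esum_powR (p : R) : 0 < p ->
  (es (fun n : nat => n.+1%:R `^ (- (1 + p))) <= (1 + p^-1)%:E)%E.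
Proof.
move=> p0; rewrite -nneseries_esumT; last by move=> n; rewrite lee_fin powR_ge0.
apply: lime_le.
  by apply: is_cvg_nneseries => n _ _; rewrite lee_fin powR_ge0.
apply: nearW => n; rewrite sumEFin lee_fin big_mkord.
apply: (@le_trans _ _ (\sum_(i < n.+1) i.+1%:R `^ (- (1 + p)))).
  by rewrite big_ord_recr /= lerDl powR_ge0.
apply: le_trans (psum_powR n p0) _.
by rewrite lerD2l ler_piMr ?invr_ge0 ?(ltW p0)//.
Qed.

(** A summable weight on the integers whose products over the coordinates dominate negative powers
    of [rho] and can be summed one coordinate at a time. *)
Definition zweight (p : R) (m : int) : R := (1 + `|m%:~R|) `^ (- (1 + p)).

Lemma zweight_ge0 p m : 0 <= zweight p m.
Proof. exact: powR_ge0. Qed.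

Lemma esum_zweight (p : R) : 0 < p -> (es (zweight p) <= (2 * (1 + p^-1))%:E)%E.
Proof.
move=> p0.
rewrite (esumID [set Posz n | n in [set: nat]]); last by move=> m _; rewrite lee_fin zweight_ge0.
rewrite mulr_natl mulr2n EFinD; apply: leeD.
  rewrite setTI esum_image; last by move=> m n _ _ [].
  apply: le_trans (esum_powR p0); apply: le_esum => n _.
  by rewrite lee_fin /zweight /= normr_nat nat1r.
rewrite setTI (_ : ~` _ = [set Negz n | n in [set: nat]]); last first.
  apply/seteqP; split => [[n|n] /=|_ [n _ <-] [m _]//].
    by case; exists n.
  by exists n.
rewrite esum_image; last by move=> m n _ _ [].
apply: le_trans (esum_powR p0); apply: le_esum => n _.
rewrite lee_fin /zweight /= NegzE rmorphN normrN normr_nat nat1r !powRN.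
rewrite lef_pV2 ?posrE ?powR_gt0//.
by apply: ge0_ler_powR; rewrite ?nnegrE// ?ler_nat//; lra.
Qed.

Lemma esum_prod_zweight d (p : R) : 0 < p ->
  (es (fun k : 'rV[int]_d => \prod_(j < d) zweight p (k 0 j)) <= ((2 * (1 + p^-1)) ^+ d)%:E)%E.
Proof.
move=> p0; have pr0 e (k : 'rV[int]_e) : 0 <= \prod_(j < e) zweight p (k 0 j).
  by apply: prodr_ge0 => j _; exact: zweight_ge0.
elim: d => [|d IH].
  rewrite expr0 (_ : [set: 'rV[int]_0] = [set 0]); last first.
    by apply/seteqP; split => // k _; apply/rowP => -[].
  by rewrite esum_set1 ?lee_fin// big_ord0.
rewrite -(@esum_reindex_bij R (int * 'rV[int]_d)%type _ (fun q => consz q.1 q.2)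
  (fun k => (k 0 ord0, tailz k))); first last.
- by move=> k; rewrite consz_tailz.
- by move=> [m k]; rewrite consz0 tailz_consz.
under eq_esum => q _.
  rewrite big_ord_recl consz0; under eq_bigr do rewrite mxE liftK; over.
rewrite (@esum_pair R _ _ (fun m (k : 'rV[int]_d) => (zweight p m * \prod_(j < d) zweight p (k 0 j))%:E)).
  2: by move=> m k; rewrite lee_fin mulr_ge0 ?zweight_ge0.
have S0 : 0 <= (2 * (1 + p^-1)) ^+ d by rewrite exprn_ge0// mulr_ge0// addr_ge0// invr_ge0 ltW.
apply: (@le_trans _ _ (es (fun m => (2 * (1 + p^-1)) ^+ d * zweight p m))).
  apply: le_esum => m _.
  rewrite (esZ (zweight_ge0 p m)); last by move=> k; exact: pr0.
  by rewrite mulrC EFinM lee_wpmul2l// lee_fin zweight_ge0.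
rewrite (esZ S0); last exact: zweight_ge0.
by rewrite exprSr EFinM lee_wpmul2l// ?lee_fin// esum_zweight.
Qed.

End ConvergentSums.

(** * Comparison of Sobolev sums with the norms of l^1 and H^1 *)

Section Embedding.
Context {R : realType} {d : nat}.
Local Notation C := R[i].
Local Notation K := 'rV[int]_d.
Local Notation es f := (\esum_(i in [set: _]) (f i)%:E)%E.
Implicit Types (a : K -> C) (k : K).

Lemma rho_gt0 k : 0 < rho k :> R.
Proof. exact: lt_le_trans ltr01 (rho_ge1 k). Qed.

Lemma rho_ge_coord k j : 1 + `|(k 0 j)%:~R| <= rho k :> R.
Proof. by rewrite /rho lerD2l (bigD1 j)//= lerDl sumr_ge0. Qed.

(** The exponent [d + 2 e] is shared equally among the coordinates, [1 + 2 e / d] for each, and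
    [rho k] is at least [1 + |k_j|] for every j. *)
Lemma rho_powR_prod (e : R) k : (0 < d)%N -> 0 < e ->
  rho k `^ (- (d%:R + 2 * e)) <= \prod_(j < d) zweight (2 * e / d%:R) (k 0 j).
Proof.
move=> d0 e0; have dR : 0 < d%:R :> R by rewrite ltr0n.
have -> : - (d%:R + 2 * e) = - (1 + 2 * e / d%:R) * d%:R by field; rewrite gt_eqF.
rewrite powRrM powR_mulrn ?powR_ge0// -[X in _ ^+ X]card_ord -prodr_const.
apply: ler_prod => j _; rewrite powR_ge0 /= /zweight !powRN.
have p1 : 0 < 1 + `|(k 0 j)%:~R| :> R by rewrite ltr_pwDl.
rewrite lef_pV2 ?posrE ?powR_gt0 ?rho_gt0//.
apply: ge0_ler_powR; rewrite ?nnegrE ?rho_ge0 ?(ltW p1)// ?rho_ge_coord//.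
by rewrite addr_ge0// divr_ge0 ?(ltW dR)// mulr_ge0// ltW.
Qed.

Lemma sum_sqr_le (n : nat) (x : 'I_n -> R) : (\sum_(i < n) x i) ^+ 2 <= n%:R * \sum_(i < n) x i ^+ 2.
Proof.
elim: n x => [|n IH] x; first by rewrite big_ord0 expr0n mul0r.
rewrite !big_ord_recr /=; have := IH (fun i => x (widen_ord (leqnSn n) i)).
set s := \sum_(i < n) x _; set q := \sum_(i < n) x _ ^+ 2; set y := x ord_max => h.
rewrite -natr1; have n0 : 0 <= n%:R :> R by [].
have q0 : 0 <= q by apply: sumr_ge0 => i _; exact: sqr_ge0.
have [n1|n1] := eqVneq (n%:R : R) 0.
  rewrite n1 in h *; have s0 : s = 0 by nra.
  by rewrite s0; nra.
have np : 0 < n%:R :> R by rewrite lt_neqAle eq_sym n1.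
have : n%:R * (2 * s * y) <= n%:R * (n%:R * y ^+ 2 + q).
  have := sqr_ge0 (s - n%:R * y); nra.
rewrite ler_pM2l//; nra.
Qed.

(** Cauchy-Schwarz for the [d.+1] numbers 1, |k_1|, ..., |k_d|. *)
Lemma rho_sqr_le k : rho k ^+ 2 <= d.+1%:R * (1 + freq_sq k) :> R.
Proof.
have := @sum_sqr_le d.+1 (fun i => if unlift ord0 i is Some j then `|(k 0 j)%:~R| else 1).
rewrite !big_ord_recl unlift_none expr1n.
under eq_bigr do rewrite liftK.
under [X in _ * (_ + X)]eq_bigr do rewrite liftK real_normK ?num_real//.
by [].
Qed.

Lemma esum_le_half (x y z : K -> R) A B :
  (forall k, 0 <= x k) -> (forall k, 0 <= y k) -> (forall k, 0 <= z k) ->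
  (forall k, 2 * z k <= x k + y k) -> (es x <= A%:E)%E -> (es y <= B%:E)%E ->
  (es z <= ((A + B) / 2)%:E)%E.
Proof.
move=> x0 y0 z0 h xA yB.
have h2 : (es z <= es (fun k => 2^-1 * (x k + y k)))%E.
  by apply: le_es => k; have := h k; lra.
apply: le_trans h2 _; rewrite esZ//; last by move=> k; rewrite addr_ge0.
rewrite esD// mulrC EFinM; apply: lee_wpmul2l; first by rewrite lee_fin.
by rewrite EFinD leeD.
Qed.

(** The three summands bound the weighted Sobolev sum, the square of an l^2 test sequence, and the
    sum of [rho^(- (d + 2 e))]; their total serves both halves of the norm. *)
Definition X2b_bound (e M : R) : R :=
  (d.+1%:R `^ (2 + d%:R / 2 + e) * M ^+ 2) + 1 + (2 * (1 + (2 * e / d%:R)^-1)) ^+ d.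

Lemma X2b_sobolev a (e M : R) : (1 < d)%N -> 0 < e ->
  (es (fun k => ((1 + freq_sq k) `^ (2 + d%:R / 2 + e) * normc (a k) ^+ 2)%R) <= (M ^+ 2)%:E)%E ->
  X2b a (X2b_bound e M).
Proof.
move=> d1 e0 H; have d0 : (0 < d)%N by exact: leq_trans d1.
have dR : 2 <= d%:R :> R by rewrite ler_nat.
have dS : 0 <= d.+1%:R :> R by [].
set del := 2 + d%:R / 2 + e in H *.
have del0 : 0 <= del by rewrite /del; lra.
(* AM-GM: [2 rho^2 |a| <= rho^(2 del) |a|^2 + rho^(- (d + 2 e))], and for
   [l2unit b], [2 b rho^3 |a| <= b^2 + rho^6 |a|^2] with [6 <= 2 del]. *)
pose P k : R := (rho k `^ 2) `^ del.
have PE k : P k = rho k `^ (2 * del) by rewrite /P powRrM.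
have P0 k : 0 < P k by rewrite /P !powR_gt0// rho_gt0.
have Ple k : P k <= d.+1%:R `^ del * (1 + freq_sq k) `^ del.
  have w0 : 0 <= 1 + freq_sq k :> R by rewrite addr_ge0 ?freq_sq_ge0.
  rewrite -powRM// /P; apply: ge0_ler_powR; rewrite ?nnegrE ?mulr_ge0 ?powR_ge0//.
  by rewrite powR_mulrn ?rho_ge0// rho_sqr_le.
set N := d.+1%:R `^ del * M ^+ 2; pose Z : R := (2 * (1 + (2 * e / d%:R)^-1)) ^+ d.
have N0 : 0 <= N by rewrite mulr_ge0 ?powR_ge0 ?sqr_ge0.
have pZ : 0 < 2 * e / d%:R by rewrite divr_gt0 ?mulr_gt0 ?ltr0n.
have Z0 : 0 <= Z by rewrite exprn_ge0// mulr_ge0// addr_ge0// invr_ge0 ltW.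
have PN : (es (fun k => (P k * normc (a k) ^+ 2)%R) <= N%:E)%E.
  apply: (@le_trans _ _ (es (fun k => (d.+1%:R `^ del * ((1 + freq_sq k) `^ del * normc (a k) ^+ 2))%R))).
    by apply: le_es => k; rewrite mulrA ler_wpM2r ?sqr_ge0.
  rewrite esZ ?powR_ge0//; last by move=> k; rewrite mulr_ge0 ?powR_ge0 ?sqr_ge0.
  by rewrite EFinM lee_wpmul2l ?lee_fin ?powR_ge0.
have Pa0 k : 0 <= P k * normc (a k) ^+ 2 by rewrite mulr_ge0 ?sqr_ge0 ?(ltW (P0 k)).
move=> g [g1|[b [b0 b1] gb]].
  under eq_esum => k _ do rewrite g1 mul1r.
  have QZ : (es (fun k => rho k `^ (- (d%:R + 2 * e))) <= Z%:E)%E.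
    apply: le_trans (esum_prod_zweight d pZ).
    by apply: le_es => k; exact: rho_powR_prod.
  have := esum_le_half Pa0 (fun k => powR_ge0 (rho k) (- (d%:R + 2 * e))) (rho2normc_ge0 a) _ PN QZ.
  move=> /(_ _)/le_trans; apply; last by rewrite lee_fin /X2b_bound -/N -/Z; lra.
  move=> k.
  have PQ : P k * rho k `^ (- (d%:R + 2 * e)) = rho k ^+ 4.
    rewrite PE -powRD; last by rewrite (gt_eqF (rho_gt0 k)) implybT.
    by rewrite -powR_mulrn ?rho_ge0//; congr powR; rewrite /del; field.
  rewrite -(ler_pM2l (P0 k)) mulrDr PQ.
  by have := sqr_ge0 (P k * normc (a k) - rho k ^+ 2); lra.
have z0 k : 0 <= g k * (rho k ^+ 2 * normc (a k)).
  by rewrite mulr_ge0 ?rho2normc_ge0// gb mulr_ge0 ?rho_ge0.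
have := esum_le_half Pa0 (fun k => sqr_ge0 (b k)) z0 _ PN b1.
move=> /(_ _)/le_trans; apply; last by rewrite lee_fin /X2b_bound -/N -/Z; lra.
move=> k; rewrite gb.
(* The inequality [6 <= 2 * del] is where [d >= 2] enters. *)
have P6 : rho k ^+ 6 <= P k.
  rewrite PE -powR_mulrn ?rho_ge0//; apply: ler_powR; first exact: rho_ge1.
  by rewrite /del; lra.
have := ler_wpM2r (sqr_ge0 (normc (a k))) P6.
by have := sqr_ge0 (b k - rho k ^+ 3 * normc (a k)); lra.
Qed.

Lemma freq_sq_lt_rho k : 1 + freq_sq k <= rho k ^+ 2 :> R.
Proof.
rewrite /rho; set S := \sum_(j < d) _.
have S0 : 0 <= S by rewrite sumr_ge0.
suff h : freq_sq k <= S ^+ 2 by nra.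
rewrite expr2 {1}/S mulr_suml; apply: ler_sum => j _.
rewrite -real_normK ?num_real// expr2 ler_wpM2l//.
by rewrite /S (bigD1 j)//= lerDl sumr_ge0.
Qed.

Lemma esum_indic (F : set K) (f : K -> R) : finite_set F -> (forall k, 0 <= f k) ->
  es (fun k => if k \in F then f k else 0) = (\sum_(k \in F) f k)%:E.
Proof.
move=> finF f0; rewrite -fsumEFin// -esum_fset//; last by move=> k _; rewrite lee_fin.
rewrite [RHS]esum_mkcond; apply: eq_esum => k _.
by case: ifP.
Qed.

(** Duality read backwards: on a finite set of frequencies the normalised sequence [rho |a|] is
    itself an admissible test sequence and attains the l^2 norm. Working on finite sets keeps the
    normalisation finite before summability is known. *)
Lemma Xb_sobolev1 a (r : R) : Xb a r ->
  (es (fun k => ((1 + freq_sq k) * normc (a k) ^+ 2)%R) <= (r ^+ 2)%:E)%E.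
Proof.
move=> ar.
have r0 := Xb_ge0 ar.
pose q k : R := rho k * normc (a k).
have q0 k : 0 <= q k by rewrite mulr_ge0 ?rho_ge0 ?normc_ge0.
apply: (@le_trans _ _ (es (fun k => q k ^+ 2))).
  by apply: le_es => k; rewrite /q exprMn ler_wpM2r ?sqr_ge0 ?freq_sq_lt_rho.
apply: ge_ereal_sup => _ [F [finF _]] <-.
rewrite fsumEFin// lee_fin; set s2 := \sum_(k \in F) _.
have s20 : 0 <= s2 by apply: fsumr_ge0 => k _; exact: sqr_ge0.
have [->|s2n] := eqVneq s2 0; first exact: sqr_ge0.
have s2p : 0 < s2 by rewrite lt_neqAle eq_sym s2n.
have sp : 0 < Num.sqrt s2 by rewrite sqrtr_gt0.
pose b k := if k \in F then q k / Num.sqrt s2 else 0.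
have lb : l2unit b.
  split=> [k|]; first by rewrite /b; case: ifP => // _; rewrite divr_ge0 ?(ltW sp).
  have -> : (fun k => (b k ^+ 2)%:E) = (fun k => (if k \in F then q k ^+ 2 / s2 else 0)%:E).
    apply/funext => k; rewrite /b; case: ifP => _; last by rewrite expr0n.
    by rewrite expr_div_n sqr_sqrtr.
  rewrite esum_indic//; last by move=> k; rewrite divr_ge0 ?sqr_ge0.
  by rewrite -mulr_fsuml// -/s2 divff.
have := ar (fun k => b k * rho k) (or_intror (ex_intro2 _ _ b lb (fun=> erefl))).
have -> : (fun k => (b k * rho k * normc (a k))%:E) =
    (fun k => (if k \in F then q k ^+ 2 / Num.sqrt s2 else 0)%:E).
  apply/funext => k; rewrite /b; case: ifP => _; last by rewrite !mul0r.
  by congr EFin; rewrite /q; field; rewrite gt_eqF.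
rewrite esum_indic//; last by move=> k; rewrite divr_ge0 ?sqr_ge0 ?(ltW sp).
rewrite -mulr_fsuml// -/s2 lee_fin ler_pdivrMr// => h.
have s2E : Num.sqrt s2 ^+ 2 = s2 by rewrite sqr_sqrtr.
have h2 : Num.sqrt s2 <= r by rewrite -(ler_pM2r sp) -expr2 s2E.
by rewrite -s2E ler_pXn2r ?nnegrE ?(ltW sp).
Qed.

End Embedding.

Section SobolevNorm.
Context {R : realType} {d : nat}.
Local Notation X := 'rV[R]_d.
Local Notation K := 'rV[int]_d.
Local Notation es f := (\esum_(i in [set: _]) (f i)%:E)%E.
Implicit Types f : X -> R[i].

Definition sob_sum (delta : R) f : \bar R :=
  es (fun k => ((1 + freq_sq k) `^ delta * normc (fourier_coef f k) ^+ 2)%R).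

Lemma sob_sum_ge0 delta f : (0 <= sob_sum delta f)%E.
Proof. by apply: es_ge0 => k; rewrite mulr_ge0 ?powR_ge0 ?sqr_ge0. Qed.

Lemma sobolev_normE delta f : sobolev_norm delta f = (sob_sum delta f `^ 2^-1)%E.
Proof.
congr (_ `^ _)%E; apply: eq_esum => k _; congr (_ * _)%:E.
have -> : `|fourier_coef f k| = (normc (fourier_coef f k))%:C by case: (fourier_coef f k).
by rewrite -rmorphXn.
Qed.

Lemma sobolev_norm_ge0 delta f : (0 <= sobolev_norm delta f)%E.
Proof. by rewrite sobolev_normE poweR_ge0. Qed.

(** Undoes the square root once and for all. The condition [0 <= M] restores the sign lost by
    squaring, and an infinite sum makes both sides false. *)
Lemma sobolev_norm_le delta f (M : R) : (sobolev_norm delta f <= M%:E)%E = (0 <= M) && (sob_sum delta f <= (M ^+ 2)%:E)%E.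
Proof.
rewrite sobolev_normE; have := sob_sum_ge0 delta f.
case: (sob_sum delta f) => [s| |//].
  rewrite poweR_EFin !lee_fin => s0; rewrite powR12_sqrt//.
  have [M0|M0] := lerP 0 M; last first.
    by apply/negbTE; rewrite -ltNge (lt_le_trans M0)// sqrtr_ge0.
  by rewrite -[in RHS](sqr_sqrtr s0) ler_pXn2r// ?nnegrE// sqrtr_ge0.
by move=> _; rewrite poweRyr ?invr_neq0// !leye_eq andbF.
Qed.

End SobolevNorm.

(** * Choice of the constants and the error bound in the Sobolev norm *)

Theorem theorem3p15 (R : realType) (d : nat) (mu T eps : R)
    (hd : d = 2%N \/ d = 3%N) (hmu : mu <> 0) (hT : 0 < T) (heps : 0 < eps) :
  let delta := 2 + d%:R / 2 + eps in
  exists C tau0 : R -> R,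
    (forall M, 0 < C M /\ 0 < tau0 M) /\
    forall (u0 : 'rV[R]_d -> R[i]) (u : R -> 'rV[R]_d -> R[i]) (Tmax : \bar R),
      nls_maximal_solution mu u0 Tmax u ->
      (T%:E < Tmax)%E ->
      let M := sup_norm delta T u in
      (M < +oo)%E ->
      forall tau : R, 0 < tau -> tau <= tau0 (fine M) ->
      forall n : nat, n%:R <= T / tau ->
        (sobolev_norm 1 (fun x => u (n%:R * tau) x - slri2 mu tau u0 n x)%R
           <= (C (fine M) * tau ^+ 2)%:E)%E.
Proof.
move=> delta; have d1 : (1 < d)%N by case: hd => ->.
pose B M : R := @X2b_bound R d eps M.
have B0 M : 0 <= B M.
  have z0 : 0 <= (2 * (1 + (2 * eps / d%:R)^-1)) ^+ d.
    by apply/exprn_ge0/mulr_ge0/addr_ge0 => //; rewrite invr_ge0 divr_ge0// mulr_ge0// ltW.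
  have s0 := mulr_ge0 (powR_ge0 d.+1%:R (2 + d%:R / 2 + eps)) (sqr_ge0 M).
  by rewrite /B /X2b_bound; lra.
(* The added 1 makes [CC] at least 1, so that [tau <= 1 / CC] yields both [tau <= 1] and the
   smallness [tau ^+ 2 * error_cst <= 1] on which stability relies. *)
pose CC M : R := error_cst mu T (B M) + 1.
have CC1 M : 1 <= CC M by rewrite lerDr error_cst_ge0// ltW.
have CC0 M : 0 < CC M by exact: lt_le_trans (CC1 M).
exists CC, (fun M => (CC M)^-1); split; first by move=> M; rewrite invr_gt0.
move=> u0 u Tmax [_ sol _] TT M Mfin tau t0 tt n nT.
have [u0E _ _ _ _] := sol.
have sM t : 0 <= t <= T -> (sobolev_norm delta (u t) <= M)%E.
  by move=> tT; apply: ereal_sup_ubound; exists t => //=; rewrite in_itv.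
have M0 : (0 <= M)%E.
  by apply: le_trans (sM 0 _); rewrite ?sobolev_norm_ge0// lexx ltW.
have ME : M = (fine M)%:E by rewrite fineK// ge0_fin_numE.
have uB t : 0 <= t <= T -> X2b (sol_coef u t) (B (fine M)).
  move=> /sM; rewrite ME sobolev_norm_le => /andP[_ h].
  exact: X2b_sobolev.
set m := fine M in tt uB *.
have tC : tau * CC m <= 1 by rewrite -ler_pdivlMr// mul1r.
have tau1 : tau <= 1 by apply: le_trans tC; rewrite ler_peMr ?(ltW t0).
have t2C : tau ^+ 2 * error_cst mu T (B m) <= 1.
  apply: le_trans tC; rewrite expr2 -mulrA ler_wpM2l ?(ltW t0)//.
  apply: le_trans (_ : 1 * error_cst mu T (B m) <= _).
    by rewrite ler_wpM2r// error_cst_ge0// ltW.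
  by rewrite mul1r lerDl.
have nT' : n%:R * tau <= T by rewrite -ler_pdivlMr.
have ntT : 0 <= n%:R * tau <= T by rewrite nT' mulr_ge0// ltW.
have cv := convergence sol hT TT uB t0 tau1 t2C nT'.
have zT : 0 <= (0 : R) <= T by rewrite lexx ltW.
have la := Xb_asum (X2b_Xb (uB _ zT)).
have E0 : u0 = synth (sol_coef u 0).
  by rewrite -(sol_synth sol hT TT zT la); apply/funext => x; rewrite u0E.
have lt := Xb_asum (X2b_Xb (uB _ ntT)).
have lc := l1_coefs mu tau n (X2b_Xb (uB _ zT)).
have -> : (fun x => u (n%:R * tau) x - slri2 mu tau u0 n x) =
   synth (fun k => sol_coef u (n%:R * tau) k - coefs mu tau (sol_coef u 0) n k).
  apply/funext => x; rewrite E0 (slri2_synth mu tau n (X2b_Xb (uB _ zT))) synthB//.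
  by rewrite {1}(sol_synth sol hT TT ntT lt).
have Cge : 0 <= error_cst mu T (B m) by rewrite error_cst_ge0// ltW.
rewrite sobolev_norm_le mulr_ge0 ?(ltW (CC0 m)) ?sqr_ge0//=.
apply: le_trans (_ : ((tau ^+ 2 * error_cst mu T (B m)) ^+ 2)%:E <= _)%E; last first.
  have le1 : tau ^+ 2 * error_cst mu T (B m) <= CC m * tau ^+ 2.
    by rewrite mulrC ler_wpM2r ?sqr_ge0// lerDl.
  have ge1 : 0 <= tau ^+ 2 * error_cst mu T (B m) by apply: mulr_ge0 => //; exact: sqr_ge0.
  by rewrite lee_fin ler_pXn2r// nnegrE// (le_trans ge1).
apply: le_trans (Xb_sobolev1 cv); apply: le_of_eq.
apply: eq_esum => k _; rewrite powRr1 ?addr_ge0 ?freq_sq_ge0//.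
by rewrite fourier_coef_synth//; exact: l1B.
Qed.
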